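(* Assume that $0<p<\infty$ and that $\phi:[0,\infty)\to\mathbb{R}^+$ is twice continuously differentiable, that there exists $r_0>0$ such that $\phi'(r)\ne0$ for $r>r_0$, and that $$\lim_{r\to\infty}\frac{re^{-p\phi(r)}}{\phi'(r)}=0,\qquad \limsup_{r\to\infty}\frac1r\Bigl(\frac{r}{\phi'(r)}\Bigr)'<p,\qquad \liminf_{r\to\infty}\frac1r\Bigl(\frac{r}{\phi'(r)}\Bigr)'>-\infty .$$ Then $$\|f\|^p_{\mathcal{F}^\phi_p}\asymp|f(0)|^p+\int_{\mathbb{C}}|f'(z)|^p\,(\psi_{p,\phi}(z))^p\,e^{-p\phi(z)}\,dm(z)$$ for any entire function $f$, where the distortion function $\psi_{p,\phi}$ satisfies $$\psi_{p,\phi}(z)\asymp\frac1{\phi'(z)}\quad\text{for }|z|\ge r_1,$$ for some $r_1>0$. In particular, if $\phi\in\mathcal{I}$, then $$\|f\|^p_{\mathcal{F}^\phi_p}\asymp|f(0)|^p+\int_{\mathbb{C}}|f'(z)|^p\,\frac{e^{-p\phi(z)}}{(1+\phi'(z))^p}\,dm(z)$$ for any entire function $f$.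
   Context: $dm$ is Lebesgue area measure on $\mathbb{C}$. A function $\phi:[0,\infty)\to\mathbb{R}^+=[0,\infty)$ is extended radially to $\mathbb{C}$ by $\phi(z)=\phi(|z|)$, and $\phi'(z)=\phi'(|z|)$, $\Delta\phi(z)=\phi''(|z|)+\phi'(|z|)/|z|$ for $z\ne0$. For an entire function $f$, $\|f\|^p_{\mathcal{F}^\phi_p}=\int_{\mathbb{C}}|f(z)|^pe^{-p\phi(z)}\,dm(z)$ (possibly $+\infty$). The $p$-distortion function of $\phi$ is $$\psi_{p,\phi}(r)=\frac{\int_r^\infty se^{-p\phi(s)}\,ds}{(1+r)e^{-p\phi(r)}},\quad 0\le r<\infty,\qquad\psi_{p,\phi}(z)=\psi_{p,\phi}(|z|).$$ $E_1\asymp E_2$ means that there is a constant $k>0$ independent of the argument (of $f$, resp. of $z$; it may depend on $p$ and $\phi$) with $\frac1kE_1\le E_2\le kE_1$. The class $\mathcal{I}$ of rapidly increasing functions: $\phi\in\mathcal{I}$ if $\phi:[0,\infty)\to\mathbb{R}^+$ is twice continuously differentiable, $\Delta\phi>0$ (on $\mathbb{C}\setminus\{0\}$), and there is a radial positive differentiable function $\tau(z)=\tau(|z|)$ on $\mathbb{C}$ such that $\tau(z)\asymp1$ for $|z|<1$, $\tau(z)\asymp(\Delta\phi(z))^{-1/2}$ for $|z|\ge1$, $\tau(r)$ decreases to $0$ as $r\to\infty$, $\lim_{r\to\infty}\tau'(r)=0$, and either there is a constant $C>0$ such that $\tau(r)r^C$ increases for large $r$, or $\lim_{r\to\infty}\tau'(r)\log\frac1{\tau(r)}=0$.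 *)

(* Defs.v *)
(* R is an arbitrary realType; the complex plane is R[i]. *)
From HB Require Import structures.
From mathcomp Require Import all_boot all_order all_algebra.
From mathcomp Require Import complex.
From mathcomp Require Import all_classical all_reals all_analysis.

Set Implicit Arguments.
Unset Strict Implicit.
Unset Printing Implicit Defensive.

Import Order.TTheory GRing.Theory Num.Theory.
Import numFieldNormedType.Exports.

Local Open Scope classical_set_scope.
Local Open Scope ring_scope.

(* R[i]^o is R[i] seen as a normed module over itself, so that derivatives of
   functions C -> C are complex derivatives. *)
Definition C (R : realType) : normedModType R[i] := R[i]^o.

(* The norm of the field R[i] is R[i]-valued; this is the modulus as a real. *)
Definition cmod (R : realType) (z : C R) : R := complex.Re `|z|.

Section Complex.
Variable R : realType.
Local Notation mu := (@lebesgue_measure R).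

Definition entire (f : C R -> C R) : Prop := forall z, derivable f z 1.

(* Area measure is the product Lebesgue measure in the coordinates x + iy. *)
Definition area_integral (g : C R -> \bar R) : \bar R :=
  (\int[mu \x mu]_(w in [set: R * R]) g (Complex w.1 w.2))%E.

(* E1 x and E2 x are comparable, with a constant uniform in x satisfying P. *)
Definition asymp_on (T : Type) (P : set T) (E1 E2 : T -> \bar R) : Prop :=
  exists2 k : R, 0 < k & forall x, P x ->
    (k^-1%:E * E1 x <= E2 x)%E /\ (E2 x <= k%:E * E1 x)%E.

(* Derivative of a function given on [0, +oo[: one-sided at the endpoint 0. *)
Definition hquot0 (g : R -> R) (h : R) : R := h^-1 * (g h - g 0).

Definition hderivable (g : R -> R) : Prop :=
  (forall r, 0 < r -> derivable g r 1) /\ cvg (hquot0 g h @[h --> 0^'+]).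

Definition hderive (g : R -> R) (r : R) : R :=
  if 0 < r then derive1 g r else lim (hquot0 g h @[h --> 0^'+]).

Definition C2_halfline (g : R -> R) : Prop :=
  [/\ hderivable g, hderivable (hderive g) &
      {within `[0, +oo[, continuous (hderive (hderive g))}].

(* The Laplacian at |z| = r > 0 of z |-> g |z|. *)
Definition radial_laplacian (g : R -> R) (r : R) : R :=
  hderive (hderive g) r + hderive g r / r.

Definition fock_normp (p : R) (phi : R -> R) (f : C R -> C R) : \bar R :=
  area_integral (fun z => (cmod (f z) `^ p * expR (- (p * phi (cmod z))))%:E).

(* Rintegral is 0 when the integral diverges, so psi is meaningful only when
   s * expR (- (p * phi s)) is integrable at infinity. *)
Definition distortion (p : R) (phi : R -> R) (r : R) : R :=
  (\int[mu]_(s in `[r, +oo[) (s * expR (- (p * phi s))))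
    / ((1 + r) * expR (- (p * phi r))).

(* "Increases" and "decreases" are read non-strictly; tau is the profile of the
   radial function v |-> tau |v|, whose differentiability is that of a map on
   the real plane, the origin included. *)
Definition rapidly_increasing (phi : R -> R) : Prop :=
  [/\ (forall r, 0 <= r -> 0 <= phi r),
      C2_halfline phi,
      (forall r, 0 < r -> 0 < radial_laplacian phi r) &
  exists tau : R -> R,
    [/\ (forall r, 0 <= r -> 0 < tau r),
        (forall w : R * R,
           differentiable
             (fun v : R * R => tau (cmod (Complex v.1 v.2)) : R^o) w),
        asymp_on [set r | 0 <= r < 1] (fun r => (tau r)%:E) (fun=> 1%E) &
        asymp_on [set r | 1 <= r] (fun r => (tau r)%:E)
          (fun r => ((Num.sqrt (radial_laplacian phi r))^-1)%:E)] /\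
    [/\ {in `[0, +oo[ &, {homo tau : r s / r <= s >-> s <= r}},
        tau r @[r --> +oo] --> (0 : R),
        derive1 tau r @[r --> +oo] --> (0 : R) &
        (exists2 a : R, 0 < a &
           exists M : R, {in `[M, +oo[ &,
             {homo (fun r => tau r * r `^ a) : r s / r <= s}})
        \/ derive1 tau r * ln (tau r)^-1 @[r --> +oo] --> (0 : R)]].

End Complex.

(* Main.v *)
Require Import Defs.
From HB Require Import structures.
From mathcomp Require Import all_boot all_order all_algebra.
From mathcomp Require Import complex.
From mathcomp Require Import all_classical all_reals all_analysis.
From mathcomp Require Import measurable_realfun.
From mathcomp Require Import ring lra.

(* Cauchy's theorem on squares yields the mean value estimate
   |f(z)|^p <= C r^-2 int_Q |f|^p over the square Q of radius r at z, for f and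
   for f', every 0 < p.  The hypotheses say that tau = 1 / phi' satisfies
   tau(r) <= L r, |tau'| <= L and (r tau)' / r <= p - e for large r, so that
   exp(-p phi) is comparable to a constant on squares of radius c tau, and that
   psi is comparable to tau, since (r tau exp(-p phi))' / (r exp(-p phi))
   = (r tau)' / r - p lies between two negative constants.

   The bound of f' by f averages the estimate tau^p |f'|^p <= C tau^-2 int_Q |f|^p.
   Conversely, shifting a ray by s(r) = r + d tau(r) gives
   s e^{-p phi(s)} s' <= e^{-e d / 2} r e^{-p phi(r)}, while
   |f(s)|^p <= (1 + k) |f(r)|^p + C tau^{p-2} int_Q |f'|^p.  When k is small the
   first term is absorbed in the left-hand side, and the second one averages to
   int |f'|^p tau^p e^{-p phi}.

   In the class I, (r phi' - c r / tau)' >= 0 for large r, so phi' tau is bounded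
   below; hence phi' tends to infinity and Lap phi / phi'^2 is bounded, which
   gives the hypotheses on (r / phi')' / r = 2 / (r phi') - Lap phi / phi'^2. *)

Set Implicit Arguments.
Unset Strict Implicit.
Unset Printing Implicit Defensive.

Import Order.TTheory GRing.Theory Num.Theory.
Import numFieldNormedType.Exports.

Local Open Scope classical_set_scope.
Local Open Scope ring_scope.

(** * Goursat's theorem on squares *)

(** The norms may be infinite, so the inequality A <= th A + X with th < 1 cannot be solved for A
    globally. It is solved on each ray over a bounded range, where A is finite, and the range then
    grows; lines through the origin, parametrised by slope, assemble the rays.

    Squares fit the product measure: their boundary integrals are integrals over intervals, and
    Fubini turns an average over concentric squares into an area integral. The derivative inherits
    subaveraging as the limit of the entire functions n (f(z + 1/n) - f(z)).

    The budget of the shift is as follows. To first order a shift by d tau contracts by exp(-e d).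
    The second-order loss p L d^2 is kept below e d / 2, and the factor (1 + k)^p is kept below
    exp(e d / 4), which leaves th = exp(-e d / 4).

    In the class I, (r phi')' = r Lap phi is of order r / tau^2, while (r / tau)' = (r / tau^2) (tau
    / r - tau') is at most twice r / tau^2 as soon as r >= 1 and tau, |tau'| <= 1. This is why r /
    tau is the function to compare with r phi'. *)

Lemma square_bisection (R : realType) (bad : R -> R -> R -> Prop) :
  (forall x y L, 0 < L -> bad x y L ->
    [\/ bad x y (L / 2), bad (x + L / 2) y (L / 2),
        bad x (y + L / 2) (L / 2) | bad (x + L / 2) (y + L / 2) (L / 2)]) ->
  forall x y L, 0 < L -> bad x y L ->
  exists a b : R, forall d, 0 < d -> exists x' y' L' : R,
    [/\ 0 < L' < d, x' <= a <= x' + L', y' <= b <= y' + L' & bad x' y' L'].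
Proof.
move=> split4 x0 y0 L0 L0_gt0 bad0.
pose good (t : R * R * R) := 0 < t.2 /\ bad t.1.1 t.1.2 t.2.
(* The premise [good t] stands under the existential so that [choice] yields a total function [f],
   which is then iterated from the initial square. *)
have stepE (t : R * R * R) : exists t' : R * R * R, good t ->
    [/\ good t', t'.2 = t.2 / 2,
        t.1.1 <= t'.1.1 <= t.1.1 + t.2 / 2 & t.1.2 <= t'.1.2 <= t.1.2 + t.2 / 2].
  case: t => [[x y] L]; have [[/= L_gt0 bt]|nb] := pselect (good (x, y, L)); last first.
    by exists (x, y, L).
  have [h|h|h|h] := split4 x y L L_gt0 bt.
  - by exists (x, y, L / 2) => _; split => //=; [split => //=; lra|lra|lra].
  - by exists (x + L / 2, y, L / 2) => _; split => //=; [split => //=; lra|lra|lra].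
  - by exists (x, y + L / 2, L / 2) => _; split => //=; [split => //=; lra|lra|lra].
  - by exists (x + L / 2, y + L / 2, L / 2) => _; split => //=; [split => //=; lra|lra|lra].
have [f fP] := choice stepE.
pose s n := iter n f (x0, y0, L0).
have gs n : good (s n).
  by elim: n => [//|n /fP[]].
have sS n := fP _ (gs n).
have LE n : (s n).2 = L0 / 2 ^+ n.
  elim: n => [|n IH]; first by rewrite expr0 divr1.
  have [_ -> _ _] := sS n; rewrite IH exprS; field.
  by rewrite expf_neq0.
(* Nested intervals, for either coordinate: lower ends increase and upper ends decrease, so the
   supremum of the lower ends lies in every interval. *)
have nest (g : R * R * R -> R) :
    (forall n, g (s n) <= g (s n.+1) <= g (s n) + (s n).2 / 2) ->
    exists a, forall n, g (s n) <= a <= g (s n) + (s n).2.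
  move=> gP.
  have up n k : g (s n) <= g (s (n + k)%N) /\
      g (s (n + k)%N) + (s (n + k)%N).2 <= g (s n) + (s n).2.
    elim: k => [|k [IH1 IH2]]; first by rewrite addn0.
    rewrite addnS; have := gP (n + k)%N; have [_ -> _ _] := sS (n + k)%N.
    by move=> /andP[? ?]; split; lra.
  have ub m n : g (s m) <= g (s n) + (s n).2.
    have [L_gt0 _] := gs n; have [Lm_gt0 _] := gs m.
    have [mn|/ltnW nm] := leqP m n.
      by have := (up m (n - m)%N).1; rewrite subnKC//; lra.
    by have := (up n (m - n)%N).2; rewrite subnKC//; lra.
  exists (sup (range (g \o s))) => n; apply/andP; split.
    apply: ub_le_sup; last by exists n.
    by exists (g (s 0%N) + (s 0%N).2) => _ [m _ <-]; exact: (ub m 0%N).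
  apply: ge_sup; first by exists (g (s 0%N)); exists 0%N.
  by move=> _ [m _ <-]; exact: (ub m n).
have [a aP] : exists a, forall n, (s n).1.1 <= a <= (s n).1.1 + (s n).2.
  by apply: (nest (fun t => t.1.1)) => n; have [] := sS n.
have [b bP] : exists b, forall n, (s n).1.2 <= b <= (s n).1.2 + (s n).2.
  by apply: (nest (fun t => t.1.2)) => n; have [] := sS n.
exists a, b => d d_gt0.
have [n Ln] : exists n, (s n).2 < d.
  exists (Num.truncn (L0 / d)).+1; rewrite LE ltr_pdivrMr ?exprn_gt0//.
  rewrite mulrC -ltr_pdivrMr//; apply: (@lt_le_trans _ _ (Num.truncn (L0 / d)).+1%:R).
    by rewrite truncnS_gt// divr_ge0 ?ltW.
  by rewrite -natrX ler_nat ltnW// ltn_expl.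
exists (s n).1.1, (s n).1.2, (s n).2; have [? ?] := gs n.
by split => //; apply/andP.
Qed.

(** A square on which |F| exceeds M has a quarter with the same defect, since F is additive and M
    superadditive. The point to which the defective squares shrink contradicts the local bound. *)
Lemma square_majorant (R : realType) (F M : R -> R -> R -> R) :
  (forall x y L, 0 < L -> F x y L = F x y (L / 2) + F (x + L / 2) y (L / 2)
     + F x (y + L / 2) (L / 2) + F (x + L / 2) (y + L / 2) (L / 2)) ->
  (forall x y L, 0 < L -> M x y (L / 2) + M (x + L / 2) y (L / 2)
     + M x (y + L / 2) (L / 2) + M (x + L / 2) (y + L / 2) (L / 2) <= M x y L) ->
  (forall a b : R, exists2 d, 0 < d & forall x y L, 0 < L < d ->
     x <= a <= x + L -> y <= b <= y + L -> `|F x y L| <= M x y L) ->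
  forall x y L, 0 < L -> `|F x y L| <= M x y L.
Proof.
move=> Fadd Madd loc x y L L_gt0; rewrite leNgt; apply/negP => bad0.
have [|a [b ab]] := @square_bisection R (fun x y L => M x y L < `|F x y L|) _ x y L L_gt0 bad0.
  move=> {bad0 L_gt0}x {}y {}L L_gt0; rewrite (Fadd x y L L_gt0) => bad.
  have := Madd x y L L_gt0.
  case: (ltP (M x y (L / 2)) `|F x y (L / 2)|) => h1; first by constructor 1.
  case: (ltP (M (x + L / 2) y (L / 2)) `|F (x + L / 2) y (L / 2)|) => h2; first by constructor 2.
  case: (ltP (M x (y + L / 2) (L / 2)) `|F x (y + L / 2) (L / 2)|) => h3; first by constructor 3.
  case: (ltP (M (x + L / 2) (y + L / 2) (L / 2)) `|F (x + L / 2) (y + L / 2) (L / 2)|) => h4;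
    first by constructor 4.
  move=> h5; exfalso; move: bad; apply/negP; rewrite -leNgt; apply: le_trans h5.
  by do 3![apply: (le_trans (ler_normD _ _)); apply: lerD => //].
have [d d_gt0 dP] := loc a b.
have [x' [y' [L' [L'd xa yb]]]] := ab d d_gt0.
by rewrite ltNge dP.
Qed.

(** * Integrals of continuous functions over compact intervals *)

Section IntervalIntegral.
Context {R : realType}.
Implicit Types (f g : R -> R) (a b c e : R).
Notation mu := (@lebesgue_measure R).

Definition cint f a b : R := \int[mu]_(x in `[a, b]) f x.

Lemma continuous_integrable_itv f a b : continuous f ->
  mu.-integrable `[a, b] (EFin \o f).
Proof.
move=> cf; apply: continuous_compact_integrable; first exact: segment_compact.
exact: continuous_subspaceT.
Qed.

Lemma cint_chasles f a b c : continuous f -> a <= b -> b <= c ->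
  cint f a c = cint f a b + cint f b c.
Proof.
move=> cf ab bc; apply/eqP; rewrite addrC -subr_eq; apply/eqP.
rewrite /cint Rintegral_itvB ?bnd_simp//; last exact: continuous_integrable_itv.
rewrite Rintegral_itv_obnd_cbnd//.
apply: (integrableS _ _ _ (continuous_integrable_itv b c cf)) => //.
by apply: subset_itvr; rewrite bnd_simp.
Qed.

Lemma cint_cst a b c : a <= b -> cint (fun=> c) a b = c * (b - a).
Proof.
move=> ab; rewrite /cint Rintegral_cst//= lebesgue_measure_itv/= lte_fin.
case: ltP => [//|ba]; rewrite (_ : b = a) ?subrr//.
by apply/le_anti; rewrite ab ba.
Qed.

Lemma cintD f g a b : continuous f -> continuous g ->
  cint (fun x => f x + g x) a b = cint f a b + cint g a b.
Proof. by move=> cf cg; rewrite /cint RintegralD//; exact: continuous_integrable_itv. Qed.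

Lemma cintB f g a b : continuous f -> continuous g ->
  cint (fun x => f x - g x) a b = cint f a b - cint g a b.
Proof. by move=> cf cg; rewrite /cint RintegralB//; exact: continuous_integrable_itv. Qed.

Lemma le_cint f g a b : continuous f -> continuous g ->
  (forall x, a <= x <= b -> f x <= g x) -> cint f a b <= cint g a b.
Proof.
move=> cf cg fg; by rewrite /cint; apply: le_Rintegral => //; exact: continuous_integrable_itv.
Qed.

Lemma cint_approx f a L c e : continuous f -> 0 <= L ->
  (forall x, a <= x <= a + L -> `|f x - c| <= e) ->
  `|cint f a (a + L) - c * L| <= e * L.
Proof.
move=> cf L_ge0 fP.
have cc (d : R) : continuous (fun _ : R => d) by exact: cst_continuous.
have E d : d * L = cint (fun=> d) a (a + L).
  by rewrite cint_cst ?lerDl// addrAC subrr add0r.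
rewrite ler_norml; apply/andP; split.
  rewrite lerBrDl -mulNr -mulrDl E; apply: le_cint => // x /fP.
  by rewrite ler_norml; lra.
rewrite lerBlDl -mulrDl E; apply: le_cint => // x /fP.
by rewrite ler_norml; lra.
Qed.

End IntervalIntegral.

Section Goursat.
Context {R : realType}.
Implicit Types (P Q : R -> R -> R).

(** The circulation of P dx + Q dy, counterclockwise around the square with lower left corner (x, y)
    and side L. For P = Im k and Q = Re k it is the imaginary part of the integral of k dz. *)
Definition circ P Q (x y L : R) : R :=
  cint (fun s => P s y - P s (y + L)) x (x + L) +
  cint (fun t => Q (x + L) t - Q x t) y (y + L).

Definition jcont P := forall (a b e : R), 0 < e -> exists2 d, 0 < d &
  forall x y, `|x - a| <= d -> `|y - b| <= d -> `|P x y - P a b| <= e.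

Lemma jcont_cont1 P y : jcont P -> continuous (P^~ y).
Proof.
move=> cP a; apply/cvgrPdist_le => /= e e_gt0.
have [d d_gt0 dP] := cP a y e e_gt0; near=> x.
by rewrite distrC; apply: dP; rewrite ?subrr ?normr0 ?ltW// distrC; near: x;
  exact: (@cvgr_dist_le _ _ _ _ _ id).
Unshelve. all: by end_near. Qed.

Lemma jcont_cont2 P x : jcont P -> continuous (P x).
Proof.
move=> cP a; apply/cvgrPdist_le => /= e e_gt0.
have [d d_gt0 dP] := cP x a e e_gt0; near=> y.
by rewrite distrC; apply: dP; rewrite ?subrr ?normr0 ?ltW// distrC; near: y;
  exact: (@cvgr_dist_le _ _ _ _ _ id).
Unshelve. all: by end_near. Qed.

(** The inner sides are traversed twice, in opposite directions, and cancel. *)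
Lemma circ_split P Q : jcont P -> jcont Q -> forall x y L, 0 < L ->
  circ P Q x y L = circ P Q x y (L / 2) + circ P Q (x + L / 2) y (L / 2)
     + circ P Q x (y + L / 2) (L / 2) + circ P Q (x + L / 2) (y + L / 2) (L / 2).
Proof.
move=> jP jQ x y L L_gt0.
have cP v := @jcont_cont1 P v jP; have cQ u := @jcont_cont2 Q u jQ.
have E u : u + L / 2 + L / 2 = u + L by rewrite -addrA -splitr.
rewrite /circ !E !cintB//.
have ch f u : continuous f -> cint f u (u + L) =
    cint f u (u + L / 2) + cint f (u + L / 2) (u + L).
  by move=> cf; apply: cint_chasles => //; lra.
by rewrite !(ch _ x)// !(ch _ y)//; ring.
Qed.

Definition ssqrt (x : R) : R := if 0 <= x then Num.sqrt x else - Num.sqrt (- x).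

Lemma le_ssqrt x y : x <= y -> ssqrt x <= ssqrt y.
Proof.
rewrite /ssqrt => xy; case: (leP 0 x) => x0; case: (leP 0 y) => y0.
- by rewrite ler_sqrt.
- by lra.
- by apply: (@le_trans _ _ 0); rewrite ?oppr_le0 ?sqrtr_ge0.
- by rewrite lerN2 ler_sqrt; lra.
Qed.

(** Here (sqrt a + sqrt b)^2 >= a + b, with a = x + L and b = - x. *)
Lemma ssqrt_straddle x L : 0 < L -> x <= 0 <= x + L ->
  Num.sqrt L <= ssqrt (x + L) - ssqrt x.
Proof.
move=> L0 /andP[x0 xL]; rewrite {1}/ssqrt xL.
have -> : - ssqrt x = Num.sqrt (- x).
  rewrite /ssqrt; case: (leP 0 x) => h; rewrite ?opprK//.
  by have -> : x = 0; [lra|rewrite oppr0 sqrtr0 oppr0].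
have h1 : 0 <= Num.sqrt (x + L) by exact: sqrtr_ge0.
have h2 : 0 <= Num.sqrt (- x) by exact: sqrtr_ge0.
rewrite -(@ler_pXn2r _ 2)// ?nnegrE ?sqrtr_ge0 ?addr_ge0//.
rewrite sqrrD !sqr_sqrtr; [|lra..].
have := mulr_ge0 h1 h2; lra.
Qed.

Lemma dist_itv (a u x L : R) : x <= a <= x + L -> x <= u <= x + L -> `|u - a| <= L.
Proof. by rewrite ler_norml; lra. Qed.

(* The products of increments of [ssqrt] are additive on squares, and dominate
   the side of any square that contains the point: exceptional points of
   [goursat_square] cost nothing. *)
Lemma goursat_square P Q (E : seq (R * R)) : jcont P -> jcont Q ->
  (forall a b, (a, b) \notin E -> exists p1 p2 q2 : R,
    forall e, 0 < e -> exists2 d, 0 < d &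
    forall x y, `|x - a| <= d -> `|y - b| <= d ->
      `|P x y - P a b - p1 * (x - a) - p2 * (y - b)| <= e * (`|x - a| + `|y - b|) /\
      `|Q x y - Q a b - p2 * (x - a) - q2 * (y - b)| <= e * (`|x - a| + `|y - b|)) ->
  forall x y L, 0 < L -> circ P Q x y L = 0.
Proof.
move=> jP jQ dPQ x y L L_gt0.
have cP v := @jcont_cont1 P v jP; have cQ u := @jcont_cont2 Q u jQ.
pose N (c : R * R) (x y L : R) := (ssqrt (x + L - c.1) - ssqrt (x - c.1)) *
  (ssqrt (y + L - c.2) - ssqrt (y - c.2)).
have N_ge0 c u v l : 0 < l -> 0 <= N c u v l.
  by move=> l0; apply: mulr_ge0; rewrite subr_ge0 le_ssqrt//; lra.
pose M e (x y L : R) := e * (L ^+ 2 + \sum_(c <- E) N c x y L).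
(* The factor of e in [M] is independent of e, so a bound for every e > 0 makes the circulation
   vanish. *)
suff H e : 0 < e -> `|circ P Q x y L| <= M e x y L.
  apply/eqP; rewrite -normr_eq0; apply/eqP/le_anti; rewrite normr_ge0 andbT.
  have K_gt0 : 0 < L ^+ 2 + \sum_(c <- E) N c x y L.
    by rewrite ltr_pwDl ?exprn_gt0// sumr_ge0// => c _; exact: N_ge0.
  apply/ler_addgt0Pr => e e_gt0; rewrite add0r; have := H (e / (L ^+ 2 + \sum_(c <- E) N c x y L)).
  by rewrite /M divfK ?gt_eqF//; apply; rewrite divr_gt0.
move=> e_gt0; apply: square_majorant L_gt0; first exact: circ_split.
  move=> {}x {}y {}L _; rewrite /M -!mulrDr ler_pM2l//.
  have S : \sum_(c <- E) N c x y (L / 2) + \sum_(c <- E) N c (x + L / 2) y (L / 2)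
     + \sum_(c <- E) N c x (y + L / 2) (L / 2)
     + \sum_(c <- E) N c (x + L / 2) (y + L / 2) (L / 2) = \sum_(c <- E) N c x y L.
    rewrite -!big_split/=; apply: eq_bigr => c _; rewrite /N.
    have F u : u + L / 2 + L / 2 = u + L by rewrite -addrA -splitr.
    by rewrite !F; ring.
  rewrite -S le_eqVlt; apply/predU1P; left; by field.
have ends (u l : R) : 0 < l -> u <= u <= u + l /\ u <= u + l <= u + l.
  by move=> l0; rewrite !lexx lerDl ltW.
(* At an exceptional point continuity alone bounds the circulation by e L, and the term of [M]
   attached to that point is at least sqrt L sqrt L = L. *)
move=> a b; have [abE|abE] := boolP ((a, b) \in E).
  have e4 : 0 < e / 4 by lra.
  have [d1 d1_gt0 Pd1] := jP a b _ e4; have [d2 d2_gt0 Qd2] := jQ a b _ e4.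
  exists (Num.min d1 d2); first by rewrite lt_min d1_gt0.
  move=> {}x {}y {}L /andP[L_gt0]; rewrite lt_min => /andP[Ld1 Ld2] xa yb.
  have ME : e * L <= M e x y L.
    rewrite /M ler_pM2l// (big_rem _ abE)/= addrCA ler_wpDr//.
      by rewrite addr_ge0 ?sqr_ge0// sumr_ge0// => c _; exact: N_ge0.
    rewrite -[L in leLHS]sqr_sqrtr ?(ltW L_gt0)// expr2 /N/=.
    by apply: ler_pM; rewrite ?sqrtr_ge0// addrAC; apply: ssqrt_straddle => //; lra.
  apply: le_trans ME; rewrite /circ.
  have [[x1 x2] [y1 y2]] := (ends x L L_gt0, ends y L L_gt0).
  have half (u v c : R) : `|u - c| <= e / 4 -> `|v - c| <= e / 4 -> `|u - v| <= e / 2.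
    move=> h1 h2; rewrite (_ : u - v = (u - c) - (v - c)); last by ring.
    rewrite (_ : e / 2 = e / 4 + e / 4); last by field.
    exact: le_trans (ler_normB _ _) (lerD h1 h2).
  have h1 := @cint_approx _ (fun s => P s y - P s (y + L)) x L 0 (e / 2) _ (ltW L_gt0) _.
  have h2 := @cint_approx _ (fun t => Q (x + L) t - Q x t) y L 0 (e / 2) _ (ltW L_gt0) _.
  rewrite !(mul0r, subr0) in h1 h2.
  rewrite (splitr e) mulrDl (le_trans (ler_normD _ _))// lerD ?h1 ?h2//.
  - by move=> u; apply: cvgB; exact: cP.
  - move=> s xs.
    by rewrite subr0; apply: (half _ _ (P a b)); apply: Pd1; apply: le_trans (ltW Ld1);
      first [exact: (dist_itv xa xs)|exact: (dist_itv yb y1)|exact: (dist_itv yb y2)].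
  - by move=> u; apply: cvgB; exact: cQ.
  - move=> t yt.
    by rewrite subr0; apply: (half _ _ (Q a b)); apply: Qd2; apply: le_trans (ltW Ld2);
      first [exact: (dist_itv xa x1)|exact: (dist_itv xa x2)|exact: (dist_itv yb yt)].
(* At a regular point the affine parts contribute - p2 L^2 and p2 L^2, which cancel because the
   y-slope of P equals the x-slope of Q. On each of the four sides the remainder is at most (e / 8)
   (L + L) per unit length, which makes e L^2 in all. *)
have [p1 [p2 [q2 D]]] := dPQ a b abE.
have e8 : 0 < e / 8 by lra.
have [d d_gt0 dP] := D _ e8; exists d => // {}x {}y {}L /andP[L_gt0 Ld] xa yb.
have ME : e * L ^+ 2 <= M e x y L.
  by rewrite /M ler_pM2l// lerDl sumr_ge0// => c _; exact: N_ge0.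
apply: le_trans ME.
have [[x1 x2] [y1 y2]] := (ends x L L_gt0, ends y L L_gt0).
have near1 u v : x <= u <= x + L -> y <= v <= y + L ->
    `|u - a| <= d /\ `|v - b| <= d /\ e / 8 * (`|u - a| + `|v - b|) <= e / 4 * L.
  move=> xu yv.
  have A1 : `|u - a| <= L by exact: dist_itv xa xu.
  have A2 : `|v - b| <= L by exact: dist_itv yb yv.
  split; first exact: le_trans A1 (ltW Ld).
  split; first exact: le_trans A2 (ltW Ld).
  rewrite [leRHS](_ : _ = e / 8 * (L + L)); last by field.
  by rewrite ler_pM2l// lerD.
have h1 := @cint_approx _ (fun s => P s y - P s (y + L)) x L (- p2 * L) (e * L / 2) _ (ltW L_gt0) _.
have h2 := @cint_approx _ (fun t => Q (x + L) t - Q x t) y L (p2 * L) (e * L / 2) _ (ltW L_gt0) _.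
have -> : circ P Q x y L = (cint (fun s => P s y - P s (y + L)) x (x + L) - - p2 * L * L)
    + (cint (fun t => Q (x + L) t - Q x t) y (y + L) - p2 * L * L).
  by rewrite /circ; ring.
have -> : e * L ^+ 2 = e * L / 2 * L + e * L / 2 * L by field.
rewrite (le_trans (ler_normD _ _))// lerD ?h1 ?h2//.
- by move=> u; apply: cvgB; exact: cP.
- move=> s xs.
  have [s1 [v1 e1]] := near1 s y xs y1; have [_ [v2 e2]] := near1 s (y + L) xs y2.
  have [A1 _] := dP s y s1 v1; have [A2 _] := dP s (y + L) s1 v2.
  rewrite (_ : _ - _ = (P s y - P a b - p1 * (s - a) - p2 * (y - b)) -
    (P s (y + L) - P a b - p1 * (s - a) - p2 * (y + L - b))); last by ring.
  rewrite (_ : e * L / 2 = e / 4 * L + e / 4 * L); last by field.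
  exact: le_trans (ler_normB _ _) (lerD (le_trans A1 e1) (le_trans A2 e2)).
- by move=> u; apply: cvgB; exact: cQ.
- move=> t yt.
  have [s1 [v1 e1]] := near1 x t x1 yt; have [s2 [_ e2]] := near1 (x + L) t x2 yt.
  have [_ A1] := dP x t s1 v1; have [_ A2] := dP (x + L) t s2 v1.
  rewrite (_ : _ - _ = (Q (x + L) t - Q a b - p2 * (x + L - a) - q2 * (t - b)) -
    (Q x t - Q a b - p2 * (x - a) - q2 * (t - b))); last by ring.
  rewrite (_ : e * L / 2 = e / 4 * L + e / 4 * L); last by field.
  exact: le_trans (ler_normB _ _) (lerD (le_trans A2 e2) (le_trans A1 e1)).
Qed.

End Goursat.

(** * Modulus and derivative in real terms, and Cauchy's theorem on squares *)

Section ComplexPlane.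
Context {R : realType}.
Implicit Types (z w a b : C R) (f g k : C R -> C R) (e t : R).

Lemma cmodE (x y : R) : cmod (Complex x y : C R) = Num.sqrt (x ^+ 2 + y ^+ 2).
Proof. by []. Qed.

Lemma cmodC z : `|z : R[i]| = ((cmod z)%:C)%C.
Proof. by case: z. Qed.

Lemma cmod_ge0 z : 0 <= cmod z.
Proof. by case: z => x y; rewrite cmodE sqrtr_ge0. Qed.

Lemma cmod0 : cmod (0 : C R) = 0.
Proof. by rewrite /cmod normr0. Qed.

Lemma cmodM z w : cmod (z * w : R[i]) = cmod z * cmod w.
Proof. exact: Normc.normcM. Qed.

Lemma cmodV z : cmod (z^-1 : R[i]) = (cmod z)^-1.
Proof. exact: Normc.normcV. Qed.

Lemma cmodN z : cmod (- z) = cmod z.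
Proof. exact: normcN. Qed.

Lemma cmodB z w : cmod (z - w) = cmod (w - z).
Proof. by rewrite -cmodN opprB. Qed.

Lemma cmodD z w : cmod (z + w) <= cmod z + cmod w.
Proof. exact: le_normcD. Qed.

Lemma cmod_eq0 z : (cmod z == 0) = (z == 0).
Proof.
apply/eqP/eqP => [|->]; last exact: cmod0.
exact: Normc.eq0_normc.
Qed.

Lemma cmod_gt0 z : (0 < cmod z) = (z != 0).
Proof. by rewrite lt_def cmod_ge0 andbT cmod_eq0. Qed.

Lemma Re_cmod z : `|complex.Re z| <= cmod z.
Proof.
case: z => x y /=; rewrite cmodE -sqrtr_sqr ler_sqrt ?addr_ge0 ?sqr_ge0//.
by rewrite lerDl sqr_ge0.
Qed.

Lemma Im_cmod z : `|complex.Im z| <= cmod z.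
Proof.
case: z => x y /=; rewrite cmodE -sqrtr_sqr ler_sqrt ?addr_ge0 ?sqr_ge0//.
by rewrite lerDr sqr_ge0.
Qed.

Lemma cmod_ReIm z : cmod z <= `|complex.Re z| + `|complex.Im z|.
Proof.
case: z => x y /=; rewrite cmodE -(@ler_pXn2r _ 2)// ?nnegrE ?sqrtr_ge0 ?addr_ge0//.
rewrite sqr_sqrtr ?addr_ge0 ?sqr_ge0// sqrrD !real_normK ?num_real//.
have : 0 <= `|x| * `|y| by rewrite mulr_ge0.
lra.
Qed.

(** A positive element of [R[i]] has zero imaginary part, so the [R[i]]-valued radii of the topology
    can be exchanged for real ones. *)
Lemma continuous_eps f z : {for z, continuous f} <-> forall e, 0 < e ->
  exists2 d, 0 < d & forall w, cmod (w - z) <= d -> cmod (f w - f z) <= e.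
Proof.
split.
  move=> /cvgrPdist_le /= fz e e0; have := fz (e%:C)%C.
  rewrite ltcR => /(_ e0) /nbhs_normP[/= [d1 d2]].
  rewrite ltcE/= => /andP[/eqP d20 d1_gt0] dP; subst d2.
  exists (d1 / 2); first by rewrite divr_gt0.
  move=> w zw; have := dP w; rewrite /ball_/= !cmodC lecR ltcE/= eqxx/= => h.
  by rewrite cmodB; apply: h; rewrite cmodB; lra.
move=> fz; apply/cvgrPdist_le; first exact: (@nbhs_filter (C R)).
move=> -[e1 e2]; rewrite ltcE/= => /andP[/eqP e20 e1_gt0]; subst e2.
have [d d0 dP] := fz e1 e1_gt0.
exists (d%:C)%C => /=; first by rewrite ltcR.
move=> w; rewrite /ball_/= !cmodC ltcR => /ltW zw.
by rewrite lecE/= eqxx/= cmodB dP// cmodB.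
Qed.

(** An identity proved over an arbitrary field and then instantiated at [R[i]], to which [C R] is
    only convertible; [mulVB_div], [mul_dquot] and [mul_sub_inv] play the same part. *)
Lemma sub_mul_div (F : fieldType) (x d l : F) : x != 0 ->
  d - l * x = x * - (l - x^-1 * d).
Proof. by move=> x0; field. Qed.

Lemma derivable_eps f z : derivable f z 1 -> forall e, 0 < e ->
  exists2 d, 0 < d & forall w, cmod (w - z) <= d ->
   cmod (f w - f z - (derive1 f z : R[i]) * (w - z)) <= e * cmod (w - z).
Proof.
move=> df e e0; move: df; rewrite /derivable => /cvg_ex[l hl].
have -> : derive1 f z = l.
  by rewrite derive1E /derive; apply: cvg_lim hl; exact: norm_hausdorff.
move/cvgrPdist_le : hl => /(_ (e%:C)%C); rewrite ltcR => /(_ e0).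
move=> /nbhs_norm0P[/= [d1 d2]]; rewrite ltcE/= => /andP[/eqP d20 d1_gt0] dP; subst d2.
exists (d1 / 2); first by rewrite divr_gt0.
move=> w zw; have [->|wz] := eqVneq w z.
  by rewrite !subrr mulr0 subrr cmod0 mulr0.
have wz0 : w - z != 0 by rewrite subr_eq0.
have := dP (w - z); rewrite /= !cmodC lecR ltcE/= eqxx/=.
rewrite (_ : (w - z)%:A + z = w); last by rewrite [_%:A]mulr1 subrK.
move=> /(_ _ wz0) h; have {}h : cmod (l - (w - z)^-1 *: (f w - f z)) <= e.
  by apply: h; lra.
have E : f w - f z - (l : R[i]) * (w - z) = (w - z : R[i]) * - (l - (w - z)^-1 *: (f w - f z)).
  exact: (@sub_mul_div R[i] (w - z) (f w - f z) l wz0).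
rewrite E.
by rewrite cmodM cmodN mulrC ler_wpM2r ?cmod_ge0.
Qed.

Lemma entire_continuous f : entire f -> continuous f.
Proof. by move=> ef z; apply: differentiable_continuous; exact/derivable1_diffP. Qed.


Lemma eps_jcont f (p : R[i] -> R) :
  (forall z w, `|p z - p w| <= cmod (z - w : C R)) -> continuous f ->
  jcont (fun x y => p (f (Complex x y))).
Proof.
move=> pl cf a b e e0; have [d d0 dP] := (continuous_eps f (Complex a b)).1 (@cf _) e e0.
exists (d / 2); first by rewrite divr_gt0.
move=> x y xa yb; apply: le_trans (pl _ _) _; apply: dP.
by apply: le_trans (cmod_ReIm _) _ => /=; lra.
Qed.

Lemma Re_sub (z w : R[i]) : complex.Re (z - w) = complex.Re z - complex.Re w.
Proof. by case: z w => [? ?] []. Qed.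

Lemma Im_sub (z w : R[i]) : complex.Im (z - w) = complex.Im z - complex.Im w.
Proof. by case: z w => [? ?] []. Qed.

Lemma goursat_complex k (E : seq (C R)) : continuous k ->
  (forall a, a \notin E -> derivable k a 1) -> forall x y L, 0 < L ->
  circ (fun x y => complex.Im (k (Complex x y)))
       (fun x y => complex.Re (k (Complex x y))) x y L = 0.
Proof.
move=> ck dk; apply: (@goursat_square _ _ _ [seq (complex.Re z, complex.Im z) | z <- E]).
- by apply: (@eps_jcont k (@complex.Im R)) => // z w; rewrite -Im_sub Im_cmod.
- by apply: (@eps_jcont k (@complex.Re R)) => // z w; rewrite -Re_sub Re_cmod.
move=> a b abE; have /dk/derivable_eps : (Complex a b : C R) \notin E.
  apply: contra abE => abE; exact: (map_f (fun z : C R => (complex.Re z, complex.Im z)) abE).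
move=> dE; case El : (derive1 k (Complex a b)) dE => [l1 l2] dE.
(* Cauchy-Riemann: if k' = l1 + i l2, then Im k has gradient (l2, l1) and Re k has gradient (l1, -
   l2). *)
exists l2, l1, (- l2) => e e0; have [d d0 dP] := dE e e0.
exists (d / 2); first by rewrite divr_gt0.
move=> x y xa yb.
have xyE : cmod (Complex x y - Complex a b : C R) <= `|x - a| + `|y - b|.
  exact: le_trans (cmod_ReIm _) _.
have {}dP := dP (Complex x y) _.
have {}dP : cmod (k (Complex x y) - k (Complex a b) -
    (Complex l1 l2 : R[i]) * (Complex x y - Complex a b)) <= e * (`|x - a| + `|y - b|).
  by apply: le_trans (dP _) _; [lra|rewrite ler_pM2l].
split.
  apply: le_trans dP; apply: le_trans (Im_cmod _); rewrite !Im_sub/=.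
  by rewrite le_eqVlt; apply/predU1P; left; congr `|_|; ring.
apply: le_trans dP; apply: le_trans (Re_cmod _); rewrite !Re_sub/=.
by rewrite le_eqVlt; apply/predU1P; left; congr `|_|; ring.
Qed.

End ComplexPlane.

(** * Cauchy's estimates *)

Section Cauchy.
Context {R : realType}.
Implicit Types (z w a b : C R) (f g : C R -> C R) (e t : R).

Definition dquot g w z : C R :=
  if z == w then derive1 g w else ((g z - g w : R[i]) * (z - w : R[i])^-1 : R[i]).

Lemma near_neq b w : b != w -> \forall z \near b, z != w.
Proof.
move=> bw; apply/nbhs_normP; exists `|b - w| => /=.
  by rewrite normr_gt0 subr_eq0.
by move=> z; rewrite /ball_/=; apply: contraTneq => ->; rewrite ltxx.
Qed.

Lemma near_dquot g w b : b != w ->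
  {near b, (fun z : C R => (g z - g w : R[i]) * (z - w : R[i])^-1 : C R) =1 dquot g w}.
Proof.
move=> bw; near=> z; rewrite /dquot ifF//; apply/negbTE; near: z.
exact: near_neq.
Unshelve. all: by end_near. Qed.

Lemma derivable_dquot g w b : b != w -> derivable g b 1 -> derivable (dquot g w) b 1.
Proof.
move=> bw dg; apply: near_eq_derivable (near_dquot g bw) _.
apply: (@derivableM R[i] (C R) (fun z => g z - g w) (fun z => (z - w : R[i])^-1)).
  exact: (@derivableB R[i] (C R) (C R) g (cst (g w)) b 1 dg (derivable_cst _ _ _)).
apply: (@derivableV R[i] (C R) (fun z => z - w)); first by rewrite subr_eq0.
have H1 : derivable (id : C R -> C R) b 1 by exact: derivable_id.
have H2 : derivable (cst w : C R -> C R) b 1 by exact: derivable_cst.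
exact: (derivableB H1 H2).
Qed.

Lemma mulVB_div (F : fieldType) (x d l : F) : x != 0 ->
  d * x^-1 - l = (d - l * x) * x^-1.
Proof. by move=> x0; field. Qed.

Lemma continuous_dquot g w : continuous g -> derivable g w 1 -> continuous (dquot g w).
Proof.
move=> cg dg b; have [->|bw] := eqVneq b w; last first.
  have E : (fun z : C R => (g z - g w : R[i]) * (z - w : R[i])^-1 : C R) @ b --> dquot g w b.
    rewrite /dquot (negbTE bw).
    apply: (@cvgM R[i] (C R) (nbhs b) _ (fun z => g z - g w) (fun z => (z - w : R[i])^-1)).
      by apply: cvgB; [exact: cg|exact: cvg_cst].
    apply: (@cvgV R[i] (C R) (nbhs b) _ (fun z => z - w : R[i])); first by rewrite subr_eq0.
    by apply: cvgB; [exact: cvg_id|exact: cvg_cst].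
  by apply: cvg_trans E; exact: (near_eq_cvg (near_dquot g bw)).
apply/continuous_eps => e e0; have [d d0 dP] := derivable_eps dg e0.
exists d => // z zw; rewrite /dquot eqxx; case: eqVneq => [_|zw0].
  by rewrite subrr cmod0 ltW.
have zw1 : z - w != 0 by rewrite subr_eq0.
have E : (g z - g w : R[i]) * (z - w : R[i])^-1 - derive1 g w =
    (g z - g w - (derive1 g w : R[i]) * (z - w)) * (z - w : R[i])^-1.
  exact: (@mulVB_div R[i] (z - w) (g z - g w) (derive1 g w) zw1).
rewrite [X in cmod X]E cmodM cmodV ler_pdivrMr ?cmod_gt0//.
exact: dP.
Qed.

Lemma mul_dquot (F : fieldType) (c d a x : F) :
  c * ((d - a) * x) = c * (d * x) - c * a * x.
Proof. by ring. Qed.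

(* Goursat's theorem for the product of [conj (g w)] with the difference
   quotient of [g] at [w]: the imaginary part of [dz / (z - w)] is at least
   [1 / (2 t)] times arc length on the boundary of the square of centre [w]. *)
Lemma cauchy_square g (E : seq (C R)) (x0 y0 t : R) : 0 < t -> continuous g ->
  (forall a, a \notin E -> derivable g a 1) -> Complex x0 y0 \notin E ->
  4 * t * cmod (g (Complex x0 y0)) <=
    cint (fun s => cmod (g (Complex s (y0 - t)))) (x0 - t) (x0 + t) +
    cint (fun s => cmod (g (Complex s (y0 + t)))) (x0 - t) (x0 + t) +
    cint (fun s => cmod (g (Complex (x0 - t) s))) (y0 - t) (y0 + t) +
    cint (fun s => cmod (g (Complex (x0 + t) s))) (y0 - t) (y0 + t).
Proof.
move=> t_gt0 cg dg; set w : C R := Complex x0 y0 => wE.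
pose G x y := cmod (g (Complex x y)).
(* The factor [conjc (g w)] turns the polar part of k into the real multiple m^2 / (z - w), whose
   contribution has a definite sign on every side. *)
pose m := cmod (g w); pose k z : C R := (conjc (g w) : R[i]) * dquot g w z.
have ck : continuous k.
  move=> z; apply: (@cvgM R[i] (C R) (nbhs z) _ (fun=> conjc (g w)) (dquot g w)).
    exact: cvg_cst.
  by apply: continuous_dquot => //; exact: dg.
have dk a : a \notin w :: E -> derivable k a 1.
  rewrite inE negb_or => /andP[aw aE].
  apply: (@derivableM R[i] (C R) (fun=> conjc (g w)) (dquot g w)).
    exact: derivable_cst.
  by apply: derivable_dquot => //; exact: dg.
have cmodG (u v u' v' : R) : `|G u v - G u' v'| <= cmod (g (Complex u v) - g (Complex u' v')).
  rewrite ler_norml; apply/andP; split.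
    by rewrite lerBrDl lerBlDr addrC cmodB (le_trans _ (cmodD _ _))// subrK.
  by rewrite lerBlDr (le_trans _ (cmodD _ _))// subrK.
have jG : jcont G.
  move=> a b e e0; have [d d0 dP] := (continuous_eps g (Complex a b)).1 (@cg _) e e0.
  exists (d / 2); first by rewrite divr_gt0.
  move=> x y xa yb; apply: le_trans (cmodG _ _ _ _) _; apply: dP.
  by apply: le_trans (cmod_ReIm _) _ => /=; lra.
have cG1 y : continuous (fun s => G s y) by exact: jcont_cont1.
have cG2 x : continuous (G x) by exact: jcont_cont2.
(* On the boundary |z - w| >= t, so the part [X] of k that carries g z is at most (m / t) |g z|. The
   other part, m^2 / (z - w), is written out in coordinates. *)
have kE (a b : R) : t ^+ 2 <= a ^+ 2 + b ^+ 2 -> exists X1 X2 : R,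
    [/\ `|X1| <= m / t * G (x0 + a) (y0 + b), `|X2| <= m / t * G (x0 + a) (y0 + b),
    complex.Re (k (Complex (x0 + a) (y0 + b))) = X1 - m ^+ 2 * (a / (a ^+ 2 + b ^+ 2)) &
    complex.Im (k (Complex (x0 + a) (y0 + b))) = X2 + m ^+ 2 * (b / (a ^+ 2 + b ^+ 2))].
  move=> tab; have n0 : 0 < a ^+ 2 + b ^+ 2 by rewrite (lt_le_trans _ tab)// exprn_gt0.
  pose z : C R := Complex (x0 + a) (y0 + b).
  have zw : z - w = Complex a b.
    by rewrite /z /w; congr Complex => /=; ring.
  have zw0 : z != w.
    rewrite -subr_eq0 zw; apply: contraTneq n0 => -[-> ->].
    by rewrite expr0n/= addr0 ltxx.
  pose X : R[i] := (conjc (g w) : R[i]) * ((g z : R[i]) * (z - w : R[i])^-1).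
  have Xle : cmod (X : C R) <= m / t * G (x0 + a) (y0 + b).
    rewrite /X !cmodM cmodV [leRHS]mulrAC -mulrA.
    have -> : cmod (conjc (g w) : C R) = m.
      by rewrite /m; case: (g w) => u v; rewrite !cmodE sqrrN.
    rewrite ler_wpM2l ?cmod_ge0// ler_wpM2l ?cmod_ge0//.
    rewrite lef_pV2 ?posrE ?cmod_gt0 ?subr_eq0// zw cmodE.
    by rewrite -[leLHS]gtr0_norm// -sqrtr_sqr ler_sqrt// ltW.
  have kz : k z = X - (conjc (g w) * g w : R[i]) * (z - w : R[i])^-1.
    rewrite /k /dquot (negbTE zw0) /X.
    exact: (@mul_dquot R[i]).
  have I : (z - w : R[i])^-1 = Complex (a / (a ^+ 2 + b ^+ 2)) (- (b / (a ^+ 2 + b ^+ 2))).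
    by rewrite zw.
  have N : (conjc (g w) * g w : R[i]) = Complex (m ^+ 2) 0.
    rewrite /m; case: (g w) => u v; rewrite cmodE sqr_sqrtr ?addr_ge0 ?sqr_ge0//.
    by congr Complex => /=; ring.
  exists (complex.Re X), (complex.Im X); split.
  - exact: le_trans (Re_cmod X) Xle.
  - exact: le_trans (Im_cmod X) Xle.
  - by rewrite -/z kz Re_sub I N /=; ring.
  - by rewrite -/z kz Im_sub I N /=; ring.
have m_ge0 : 0 <= m by exact: cmod_ge0.
(* On a side a^2 + t^2 <= 2 t^2, whence the 1 / (2 t). *)
have mt (a : R) : - t <= a <= t -> m ^+ 2 * (2 * t)^-1 <= m ^+ 2 * (t / (a ^+ 2 + t ^+ 2)).
  move=> at_; rewrite ler_wpM2l ?sqr_ge0//.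
  have a2 : a ^+ 2 <= t ^+ 2 by rewrite -subr_ge0 subr_sqr mulr_ge0//; lra.
  have t2 : 0 < t ^+ 2 by rewrite exprn_gt0.
  have a3 := sqr_ge0 a.
  rewrite ler_pdivlMr; last lra.
  rewrite mulrC ler_pdivrMr; last lra.
  by rewrite (_ : t * (2 * t) = 2 * t ^+ 2); [lra|ring].
(* A side has length 2 t, so the constant m^2 / (2 t) integrates to m^2; the four sides produce the
   4 m^2 below. *)
have side (F H : R -> R) (u : R) : continuous F -> continuous H ->
    (forall a : R, - t <= a <= t -> F (u + a) <= m / t * H (u + a) - m ^+ 2 * (2 * t)^-1) ->
    cint F (u - t) (u + t) <= m / t * cint H (u - t) (u + t) - m ^+ 2.
  move=> cF cH FH; pose c := m ^+ 2 * (2 * t)^-1.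
  have cc : continuous (fun _ : R => c) by exact: cst_continuous.
  have cmH : continuous (fun x => m / t * H x).
    by move=> x; apply: cvgM; [exact: cvg_cst|exact: cH].
  apply: (@le_trans _ _ (cint (fun x => m / t * H x - c) (u - t) (u + t))).
    apply: le_cint => //; first by move=> x; apply: cvgB; [exact: cmH|exact: cc].
    by move=> x xu; have := FH (x - u); rewrite (_ : u + (x - u) = x); [apply; lra|ring].
  rewrite cintB// cint_cst; last lra.
  have -> : cint (fun x => m / t * H x) (u - t) (u + t) = m / t * cint H (u - t) (u + t).
    by rewrite /cint RintegralZl//; exact: continuous_integrable_itv.
  rewrite lerD2l lerN2 /c (_ : u + t - (u - t) = 2 * t); last ring.
  by rewrite divfK// mulf_neq0// gt_eqF.
have tsq (a : R) : t ^+ 2 <= a ^+ 2 + t ^+ 2 by rewrite lerDr sqr_ge0.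
have tsq' (a : R) : t ^+ 2 <= t ^+ 2 + a ^+ 2 by rewrite lerDl sqr_ge0.
have cIm (y : R) : continuous (fun s => complex.Im (k (Complex s y))).
  apply: (@jcont_cont1 _ (fun x y => complex.Im (k (Complex x y)))).
  by apply: (@eps_jcont _ k (@complex.Im R)) => // z' w'; rewrite -Im_sub Im_cmod.
have cRe (x : R) : continuous (fun s => complex.Re (k (Complex x s))).
  apply: (@jcont_cont2 _ (fun x y => complex.Re (k (Complex x y)))).
  by apply: (@eps_jcont _ k (@complex.Re R)) => // z' w'; rewrite -Re_sub Re_cmod.
have cN (F : R -> R) : continuous F -> continuous (fun x => - F x).
  by move=> cF x; apply: cvgN; exact: cF.
have bot : cint (fun s => complex.Im (k (Complex s (y0 - t)))) (x0 - t) (x0 + t) <=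
    m / t * cint (fun s => G s (y0 - t)) (x0 - t) (x0 + t) - m ^+ 2.
  apply: side => // a at_; have := mt a at_.
  have [|X1 [X2 [_ + _ ->]]] := kE a (- t); first by rewrite sqrrN.
  by rewrite sqrrN !mulNr ler_norml; lra.
have top : cint (fun s => - complex.Im (k (Complex s (y0 + t)))) (x0 - t) (x0 + t) <=
    m / t * cint (fun s => G s (y0 + t)) (x0 - t) (x0 + t) - m ^+ 2.
  apply: side => //; first exact: cN.
  move=> a at_; have := mt a at_; have [//|X1 [X2 [_ + _ ->]]] := kE a t.
  by rewrite ler_norml; lra.
have lft : cint (fun s => - complex.Re (k (Complex (x0 - t) s))) (y0 - t) (y0 + t) <=
    m / t * cint (G (x0 - t)) (y0 - t) (y0 + t) - m ^+ 2.
  apply: side => //; first exact: cN.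
  move=> a at_; have := mt a at_.
  have [|X1 [X2 [+ _ -> _]]] := kE (- t) a; first by rewrite sqrrN.
  by rewrite sqrrN !mulNr (addrC (a ^+ 2)) ler_norml; lra.
have rgt : cint (fun s => complex.Re (k (Complex (x0 + t) s))) (y0 - t) (y0 + t) <=
    m / t * cint (G (x0 + t)) (y0 - t) (y0 + t) - m ^+ 2.
  apply: side => // a at_; have := mt a at_.
  have [//|X1 [X2 [+ _ -> _]]] := kE t a.
  by rewrite (addrC (a ^+ 2)) ler_norml; lra.
have two (u : R) : u - t + 2 * t = u + t by ring.
have := @goursat_complex _ k (w :: E) ck dk (x0 - t) (y0 - t) (2 * t).
rewrite /circ !two => /(_ (mulr_gt0 (ltr0Sn R 1) t_gt0)).
have spl (F H : R -> R) (u : R) : continuous F -> continuous H ->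
    cint (fun x => F x - H x) (u - t) (u + t) =
    cint F (u - t) (u + t) + cint (fun x => - H x) (u - t) (u + t).
  by move=> cF cH; rewrite -cintD//; exact: cN.
rewrite !spl// => sum0.
set I1 := cint (fun s => G s _) _ _ in bot; set I2 := cint (fun s => G s _) _ _ in top.
set I3 := cint (G _) _ _ in lft; set I4 := cint (G _) _ _ in rgt.
rewrite -/m -[leRHS]/(I1 + I2 + I3 + I4).
have le0 : 0 <= m / t * (I1 + I2 + I3 + I4) - 4 * m ^+ 2 by lra.
have [m0|m_neq0] := eqVneq m 0.
  rewrite -/m m0 mulr0 !addr_ge0//; apply: Rintegral_ge0 => ? _; exact: cmod_ge0.
have m_gt0 : 0 < m by rewrite lt_def m_neq0.
rewrite -/m -(ler_pM2l (divr_gt0 m_gt0 t_gt0)).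
by rewrite (_ : m / t * (4 * t * m) = 4 * m ^+ 2); [lra|field; rewrite gt_eqF].
Qed.

End Cauchy.

(** * Measurability and averages over squares in the plane *)

Section PlaneMeasure.
Context {R : realType}.
Notation mu := (@lebesgue_measure R).

(** The set where G > c is open, hence the countable union of the rational squares that it
    contains. *)
Lemma jcont_measurable (G : R -> R -> R) : jcont G ->
  measurable_fun [set: R * R] (fun w : R * R => G w.1 w.2).
Proof.
move=> jG; apply: (measurability _ (RGenOInfty.measurableE R)) => //.
move=> /= _ [_ [c ->] <-]; rewrite setTI.
pose box (a b r : rat) := [set w : R * R | `|w.1 - ratr a| < ratr r] `&`
  [set w : R * R | `|w.2 - ratr b| < ratr r].
pose S := [set w : R * R | c < G w.1 w.2].
pose part (a b r : rat) := [set w | box a b r w /\ box a b r `<=` S].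
have -> : (fun w : R * R => G w.1 w.2) @^-1` `]c, +oo[ =
    \bigcup_a \bigcup_b \bigcup_r part a b r.
  apply/seteqP; split => [[x y] /=|[x y] [a _ [b _ [r _ [abr /(_ _ abr)]]]]]; last first.
    by rewrite /S/= in_itv/= andbT.
  rewrite in_itv/= andbT => cG; have e0 : 0 < (G x y - c) / 2 by lra.
  have [d d0 dP] := jG x y _ e0.
  have [r] := rat_in_itvoo (divr_gt0 d0 (ltr0Sn R 1)); rewrite in_itv/= => /andP[r0 rd].
  have xr u : u < u + ratr r :> R by rewrite ltrDl.
  have [a] := rat_in_itvoo (xr x); have [b] := rat_in_itvoo (xr y).
  rewrite !in_itv/= => /andP[yb by_] /andP[xa ax].
  exists a => //; exists b => //; exists r => //; split.
    by split => /=; rewrite ltr_norml; lra.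
  move=> [u v] [/= ua vb]; rewrite /S/=; have := dP u v.
  rewrite !ltr_norml in ua vb; rewrite !ler_norml => h.
  have : - ((G x y - c) / 2) <= G u v - G x y <= (G x y - c) / 2 by apply: h; lra.
  lra.
apply: bigcupT_measurable_rat => a; apply: bigcupT_measurable_rat => b.
apply: bigcupT_measurable_rat => r.
have [h|h] := pselect (box a b r `<=` S); last first.
  rewrite (_ : part _ _ _ = set0)//; apply/seteqP; split => // w [_]; exact: h.
rewrite (_ : part _ _ _ = box a b r); last first.
  by apply/seteqP; split => [w []|w ?].
have E : box a b r = [set x : R | `|x - ratr a| < ratr r] `*` [set y : R | `|y - ratr b| < ratr r].
  by [].
rewrite E; apply: measurableX.
  rewrite (_ : [set _ | _] = `](ratr a - ratr r), (ratr a + ratr r)[%classic)//.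
  by apply/seteqP; split => x /=; rewrite in_itv/= ltr_norml; lra.
rewrite (_ : [set _ | _] = `](ratr b - ratr r), (ratr b + ratr r)[%classic)//.
by apply/seteqP; split => x /=; rewrite in_itv/= ltr_norml; lra.
Qed.

(** The pushforward of the measure by the affine map, scaled by |a|, gives half-open intervals their
    length, so it is Lebesgue measure. A negative slope exchanges the open and the closed end. *)
Lemma integral_affine (F : R -> \bar R) (a b : R) : a != 0 ->
  measurable_fun [set: R] F -> (forall x, (0 <= F x)%E) ->
  (\int[mu]_x F x = `|a|%:E * \int[mu]_x F (a * x + b)%R)%E.
Proof.
move=> a0 mF F0; pose h (x : measurableTypeR R) : measurableTypeR R := a * x + b.
have mh : measurable_fun setT h.
  by apply: measurable_funD => //; apply: measurable_funM.
pose nu := mscale (NngNum (normr_ge0 a)) (pushforward mu h).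
pose nu' := nu mh.
have nuE (A : set R) : measurable A -> mu A = nu' A.
  apply: lebesgue_measure_unique => _ [[u v] _ <-].
  rewrite /nu' /nu /mscale /= /mscale /= /pushforward.
  have [a_gt0|a_lt0|a_eq0] := ltgtP 0 a; last by move: a0; rewrite -a_eq0 eqxx.
    have -> : h @^-1` `]u, v] = `](u - b) / a, (v - b) / a]%classic.
      apply/seteqP; split => x /=; rewrite /h !in_itv/= ltr_pdivrMr// ler_pdivlMr//;
        by rewrite (mulrC x) ltrBlDr lerBrDr.
    rewrite !lebesgue_measure_itv/= !lte_fin ltr_pM2r ?invr_gt0// ltrD2r.
    case: ifP => _; last by rewrite mule0.
    by rewrite -!EFinD -EFinM gtr0_norm//; congr EFin; field.
  have -> : h @^-1` `]u, v] = `[(v - b) / a, (u - b) / a[%classic.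
    apply/seteqP; split => x /=; rewrite /h !in_itv/= ltr_ndivlMr// ler_ndivrMr//;
      by rewrite (mulrC x) ltrBlDr lerBrDr andbC.
  rewrite !lebesgue_measure_itv/= !lte_fin ltr_nM2r ?invr_lt0// ltrD2r.
  case: ifP => _; last by rewrite mule0.
  by rewrite -!EFinD -EFinM ltr0_norm//; congr EFin; field.
rewrite (eq_measure_integral nu'); last by move=> A mA _; exact: nuE.
rewrite ge0_integral_mscale//=; congr (_ * _)%E.
by rewrite ge0_integral_pushforward.
Qed.

(** The closed square of centre w and half-side r, in contrast with the corner-and-side convention
    of [square_bisection]. *)
Definition sq (w : R * R) (r : R) : set (R * R) :=
  [set v | `|v.1 - w.1| <= r /\ `|v.2 - w.2| <= r].

Lemma sqE w r : sq w r =
  `[(w.1 - r), (w.1 + r)]%classic `*` `[(w.2 - r), (w.2 + r)]%classic.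
Proof.
apply/seteqP; split => v /=; rewrite /sq/= !in_itv/= !ler_norml; lra.
Qed.

Lemma measurable_sq w r : measurable (sq w r : set (R * R)).
Proof. by rewrite sqE; apply: measurableX. Qed.

Lemma mu_sq w r : 0 <= r -> (mu \x mu)%E (sq w r) = (4 * r ^+ 2)%:E.
Proof.
move=> r0; rewrite sqE product_measure1E//=  !lebesgue_measure_itv/= !lte_fin.
have E u : u + r - (u - r) = 2 * r by ring.
have [r_gt0|r_le0] := ltP 0 r; last first.
  have -> : r = 0 by lra.
  by rewrite !ifF ?subr0 ?addr0 ?ltxx// mul0e expr0n/= mulr0.
by rewrite !ifT; [rewrite -!EFinD !E -EFinM; congr EFin; ring|lra|lra].
Qed.

(** The hypothesis bounds c by integrals over the boundary of concentric squares. Integrated over t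
    in [r / 2, r], each of the four sides sweeps out part of the square of half-side r, which
    explains the factor 4. *)
Lemma square_average (G : R -> R -> R) (x0 y0 c r : R) : jcont G ->
  (forall x y, 0 <= G x y) -> 0 <= c -> 0 < r ->
  (forall t, 0 < t -> 4 * t * c <=
    cint (fun s => G s (y0 - t)) (x0 - t) (x0 + t) +
    cint (fun s => G s (y0 + t)) (x0 - t) (x0 + t) +
    cint (G (x0 - t)) (y0 - t) (y0 + t) + cint (G (x0 + t)) (y0 - t) (y0 + t)) ->
  ((r ^+ 2 * c)%:E <= 4%:E * \int[mu \x mu]_(w in sq (x0, y0) r) (G w.1 w.2)%:E)%E.
Proof.
move=> jG G0 c0 r0 avg.
have cG1 y := @jcont_cont1 _ G y jG; have cG2 x := @jcont_cont2 _ G x jG.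
pose F : R * R -> \bar R := (fun w => (G w.1 w.2)%:E) \_ (sq (x0, y0) r).
have F0 w : (0 <= F w)%E.
  by rewrite /F patchE; case: ifP => // _; rewrite lee_fin.
have mF : measurable_fun [set: R * R] F.
  apply/(measurable_restrictT _ _).1; first exact: measurable_sq.
  apply: measurable_funTS; apply/measurable_EFinP; exact: jcont_measurable.
rewrite integral_mkcond -/F.
set A := (X in (_ <= _ * X)%E). have AE : A = (\int[mu \x mu]_w F w)%E by [].
(* Integrals of the truncated G along horizontal and vertical lines; each dominates the integral
   over a side of an inner square. *)
pose B (y : R) := (\int[mu]_x F (x, y))%E.
pose D (x : R) := (\int[mu]_y F (x, y))%E.
have mB : measurable_fun [set: R] B by exact: measurable_fun_fubini_tonelli_G.
have mD : measurable_fun [set: R] D by exact: measurable_fun_fubini_tonelli_F.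
have B0 y : (0 <= B y)%E by apply: integral_ge0 => ? _.
have D0 x : (0 <= D x)%E by apply: integral_ge0 => ? _.
have AD : A = (\int[mu]_x D x)%E by rewrite AE; exact: fubini_tonelli1.
have AB : A = (\int[mu]_y B y)%E by rewrite AE; exact: fubini_tonelli2.
have leB y t : 0 < t <= r -> `|y - y0| <= r ->
    ((cint (fun s => G s y) (x0 - t) (x0 + t))%:E <= B y)%E.
  move=> /andP[t0 tr] yr; rewrite /cint /Rintegral fineK; last first.
    by apply: integrable_fin_num => //; exact: continuous_integrable_itv.
  rewrite integral_mkcond; apply: ge0_le_integral => //.
  - by move=> s _; rewrite patchE; case: ifP => // _; rewrite lee_fin.
  - apply/(measurable_restrictT _ _).1 => //; apply/measurable_EFinP.
    by apply: measurable_funTS; exact: continuous_measurable_fun.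
  - by apply: measurableT_comp => //; exact: measurable_pair2.
  - move=> s _; rewrite patchE; case: ifPn => [|_]; last exact: F0.
    rewrite inE/= in_itv/= => st; rewrite /F patchE ifT// inE; split => //=.
    by rewrite ler_norml; lra.
have leD x t : 0 < t <= r -> `|x - x0| <= r ->
    ((cint (G x) (y0 - t) (y0 + t))%:E <= D x)%E.
  move=> /andP[t0 tr] xr; rewrite /cint /Rintegral fineK; last first.
    by apply: integrable_fin_num => //; exact: continuous_integrable_itv.
  rewrite integral_mkcond; apply: ge0_le_integral => //.
  - by move=> s _; rewrite patchE; case: ifP => // _; rewrite lee_fin.
  - apply/(measurable_restrictT _ _).1 => //; apply/measurable_EFinP.
    by apply: measurable_funTS; exact: continuous_measurable_fun.
  - by apply: measurableT_comp => //; exact: measurable_pair1.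
  - move=> s _; rewrite patchE; case: ifPn => [|_]; last exact: F0.
    rewrite inE/= in_itv/= => st; rewrite /F patchE ifT// inE; split => //=.
    by rewrite ler_norml; lra.
have aff (H : R -> \bar R) (a b : R) : `|a| = 1 -> measurable_fun [set: R] H ->
    (forall x, 0 <= H x)%E ->
    (\int[mu]_(x in `[(r / 2)%R, r]) H (a * x + b)%R <= \int[mu]_x H x)%E.
  move=> a1 mH H0; rewrite [leRHS](@integral_affine _ a b)//; last first.
    by rewrite -normr_eq0 a1 oner_eq0.
  rewrite a1 mul1e; apply: ge0_subset_integral => //.
  by apply: measurableT_comp => //; apply: measurable_funD => //; apply: measurable_funM.
have mcomp (H : R -> \bar R) (a b : R) : measurable_fun [set: R] H ->
    measurable_fun `[r / 2, r]%classic (fun x => H (a * x + b)).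
  move=> mH; apply: measurable_funTS; apply: measurableT_comp => //.
  by apply: measurable_funD => //; apply: measurable_funM.
pose S t := (B (-1 * t + y0)%R + B (1 * t + y0)%R + D (-1 * t + x0)%R + D (1 * t + x0)%R)%E.
(* For t >= r / 2 the hypothesis gives 4 t c >= 2 r c, and the interval has length r / 2, so the
   left-hand side equals r^2 c. *)
have key : (\int[mu]_(t in `[(r / 2)%R, r]) (2 * r * c)%:E <= \int[mu]_(t in `[(r / 2)%R, r]) S t)%E.
  apply: ge0_le_integral => //.
  - by move=> t _; rewrite lee_fin !mulr_ge0// ltW.
  - by repeat (apply: emeasurable_funD; last exact: mcomp); exact: mcomp.
  move=> t; rewrite /= in_itv/= => /andP[rt tr].
  have t0 : 0 < t by lra.
  have tr' : 0 < t <= r by rewrite t0.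
  apply: (@le_trans _ _ (4 * t * c)%:E).
    by rewrite lee_fin ler_wpM2r//; lra.
  rewrite /S !mul1r !mulN1r !(addrC _ x0) !(addrC _ y0).
  have N u : `|u + t - u| <= r by rewrite addrC addKr gtr0_norm.
  have N' u : `|u - t - u| <= r by rewrite addrC addKr normrN gtr0_norm.
  apply: le_trans (leeD (leeD (leeD (leB _ t _ _) (leB _ t _ _)) (leD _ t _ _)) (leD _ t _ _)) => //.
  by rewrite -!EFinD lee_fin; exact: avg.
have -> : (r ^+ 2 * c)%:E = (\int[mu]_(t in `[(r / 2)%R, r]) (2 * r * c)%:E)%E.
  rewrite integral_cst//= lebesgue_measure_itv/= lte_fin ifT; last lra.
  by rewrite -EFinD -EFinM; congr EFin; field.
apply: le_trans key _.
have S1 := mcomp B (-1) y0 mB; have S2 := mcomp B 1 y0 mB.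
have S3 := mcomp D (-1) x0 mD; have S4 := mcomp D 1 x0 mD.
have S12 := emeasurable_funD S1 S2; have S123 := emeasurable_funD S12 S3.
have pos2 (t : R) : (0 <= B (-1 * t + y0)%R + B (1 * t + y0)%R)%E by rewrite adde_ge0.
have pos3 (t : R) : (0 <= B (-1 * t + y0)%R + B (1 * t + y0)%R + D (-1 * t + x0)%R)%E.
  by rewrite adde_ge0.
rewrite /S ge0_integralD// ge0_integralD// ge0_integralD//.
have n1 : `|-1| = 1 :> R by rewrite normrN1.
have n2 : `|1| = 1 :> R by rewrite normr1.
apply: (@le_trans _ _ (A + A + A + A)%E).
  apply: leeD; [apply: leeD; [apply: leeD|]|].
  - by rewrite AB; exact: aff.
  - by rewrite AB; exact: aff.
  - by rewrite AD; exact: aff.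
  - by rewrite AD; exact: aff.
have -> : (4%:E : \bar R) = (1 + 1 + 1 + 1)%:E by congr EFin; ring.
by rewrite !EFinD !ge0_muleDl ?mul1e// !adde_ge0.
Qed.

End PlaneMeasure.

(** * Subaveraging of powers *)

Section PowerSubaverage.
Context {R : realType}.
Notation mu := (@lebesgue_measure R).
Implicit Types (u : R * R -> R) (K p r : R) (w v a : R * R).

(** Normalised by r^2 and not by the area 4 r^2 of the square, so the exact mean value property
    would be the case K = 1/4. *)
Definition subav K u := forall w r, 0 < r ->
  ((r ^+ 2 * u w)%:E <= K%:E * \int[mu \x mu]_(v in sq w r) (u v)%:E)%E.

Lemma measurable_powR_comp u p : measurable_fun [set: R * R] u ->
  measurable_fun [set: R * R] (fun w => u w `^ p).
Proof. by move=> mu_; exact: (measurableT_comp (measurable_powR p) mu_). Qed.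

(** The elementary bound x <= l + l^(1 - p) x^p, valid for every l > 0, replaces Jensen's
    inequality: the part of u below the level l is absorbed in the left-hand side. *)
Lemma subav_powR_ge1 K p : 0 < K -> 1 <= p -> exists2 K', 0 < K' &
  forall u, (forall w, 0 <= u w) -> measurable_fun [set: R * R] u ->
  subav K u -> subav K' (fun w => u w `^ p).
Proof.
move=> K0 p1; have p0 : p != 0 by rewrite gt_eqF//; lra.
exists (2 * K * (8 * K) `^ (p - 1)) => [|u u0 mu_ uK w r r0].
  by rewrite !mulr_gt0// powR_gt0//; lra.
have [uw0|uw_neq0] := eqVneq (u w) 0.
  rewrite uw0 powR0// mulr0 mule_ge0//; first by rewrite lee_fin !mulr_ge0 ?powR_ge0//; lra.
  by apply: integral_ge0 => v _; rewrite lee_fin powR_ge0.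
have uw : 0 < u w by rewrite lt_def uw_neq0 u0.
(* With this level 4 K r^2 l is half of r^2 u(w), so the constant term is absorbed. *)
pose l := u w / (8 * K); have l0 : 0 < l by rewrite divr_gt0// mulr_gt0.
have point (x : R) : 0 <= x -> x <= l + l `^ (1 - p) * x `^ p.
  move=> x0; have [xl|lx] := leP x l.
    by rewrite (le_trans xl)// lerDl mulr_ge0 ?powR_ge0.
  apply: (@le_trans _ _ (l `^ (1 - p) * x `^ p)); last by rewrite lerDr ltW.
  have x0' : 0 < x by apply: lt_trans lx.
  have -> : p = 1 + (p - 1) by ring.
  rewrite (@powRD _ x) ?(gt_eqF x0') ?implybT// powRr1//.
  rewrite (_ : 1 - (1 + (p - 1)) = - (p - 1)); last by ring.
  rewrite powRN mulrCA -[leLHS]mulr1 ler_pM2l// mulrC ler_pdivlMr ?powR_gt0// mul1r.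
  by rewrite ge0_ler_powR ?nnegrE ?(ltW l0) ?(ltW lx)//; lra.
set I := (\int[_]_(v in _) _)%E.
have I0 : (0 <= I)%E by apply: integral_ge0 => v _; rewrite lee_fin powR_ge0.
have mp := measurable_powR_comp p mu_.
have msq := measurable_sq w r.
have step : ((r ^+ 2 * u w)%:E <= K%:E * ((4 * r ^+ 2 * l)%:E + (l `^ (1 - p))%:E * I))%E.
  apply: le_trans (uK w r r0) _; apply: lee_wpmul2l; first by rewrite lee_fin ltW.
  apply: (@le_trans _ _ (\int[mu \x mu]_(v in sq w r) (l%:E + (l `^ (1 - p))%:E * (u v `^ p)%:E))%E).
    apply: ge0_le_integral => //.
    - by move=> v _; rewrite lee_fin.
    - by apply: measurable_funTS; exact/measurable_EFinP.
    - apply: measurable_funTS; apply: emeasurable_funD => //.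
      by apply/measurable_EFinP; apply: measurable_funM.
    - by move=> v _; rewrite -EFinM -EFinD lee_fin; exact: point.
  have l_ge0 : (0 <= l%:E)%E by rewrite lee_fin ltW.
  have lup0 v : (0 <= (l `^ (1 - p))%:E * (u v `^ p)%:E)%E.
    by rewrite -EFinM lee_fin mulr_ge0 ?powR_ge0.
  have mlup : measurable_fun (sq w r) (fun v => (l `^ (1 - p))%:E * (u v `^ p)%:E)%E.
    by apply: measurable_funTS; apply/measurable_EFinP; apply: measurable_funM.
  rewrite ge0_integralD//.
  rewrite integral_cst//= mu_sq ?(ltW r0)// -EFinM (mulrC l) ge0_integralZl_EFin//.
  - by move=> v _; rewrite lee_fin powR_ge0.
  - by apply: measurable_funTS; exact/measurable_EFinP.
  - exact: powR_ge0.
case: I I0 step => [i||]//; last first.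
  by move=> _ _; rewrite gt0_muley ?leey// lte_fin !mulr_gt0// powR_gt0; lra.
rewrite lee_fin => i0; rewrite -(EFinM (l `^ (1 - p))) -EFinD -!EFinM !lee_fin => step.
have Kl : 4 * K * r ^+ 2 * l = r ^+ 2 * u w / 2 by rewrite /l; field; rewrite gt_eqF.
have {step} : r ^+ 2 * u w / 2 <= K * l `^ (1 - p) * i by move: Kl step; lra.
have -> : l `^ (1 - p) = l / l `^ p.
  by rewrite powRD ?(gt_eqF l0) ?implybT// powRr1 ?(ltW l0)// powRN.
have lpE : l `^ p = u w `^ p / (8 * K) `^ p.
  rewrite /l powRM ?(ltW uw)//; last by rewrite invr_ge0; lra.
  by rewrite -powR_inv1 ?mulr_ge0 ?(ltW K0)// -powRrM mulN1r powRN.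
have k8 : (8 * K) `^ p = 8 * K * (8 * K) `^ (p - 1).
  rewrite -{2}[8 * K]powRr1; last by lra.
  by rewrite -powRD; [congr (_ `^ _); ring|rewrite gt_eqF ?implybT//; lra].
have c0 : 0 < (8 * K) `^ (p - 1) by rewrite powR_gt0; lra.
have up0 : 0 < u w `^ p by rewrite powR_gt0.
rewrite lpE k8 /l => step.
have -> : 2 * K * (8 * K) `^ (p - 1) * i =
   K * (u w / (8 * K) / (u w `^ p / (8 * K * (8 * K) `^ (p - 1)))) * i *
   (2 * u w `^ p / u w).
  by field; rewrite !gt_eqF//; lra.
have -> : r ^+ 2 * u w `^ p = r ^+ 2 * u w / 2 * (2 * u w `^ p / u w).
  by field; rewrite gt_eqF.
by rewrite ler_wpM2r// !mulr_ge0 ?invr_ge0 ?(ltW uw) ?powR_ge0.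
Qed.

(* Hardy-Littlewood: compare [u] with the maximum over the square of
   [d ^ (2 / p) * u], [d] the distance to the boundary. *)
Lemma subav_powR_lt1 K p : 0 < K -> 0 < p < 1 ->
  forall u, (forall w, 0 <= u w) -> measurable_fun [set: R * R] u ->
  (forall w r, exists M, forall v, sq w r v -> u v <= M) ->
  subav K u -> subav (K * 2 `^ (2 / p)) (fun w => u w `^ p).
Proof.
move=> K0 /andP[p0 p1] u u0 mu_ ubd uK w r r0.
have [M MP] := ubd w r.
set I := (\int[_]_(v in _) _)%E.
have I0 : (0 <= I)%E by apply: integral_ge0 => v _; rewrite lee_fin powR_ge0.
have K'0 : 0 < K * 2 `^ (2 / p) by rewrite mulr_gt0// powR_gt0.
have mp := measurable_powR_comp p mu_.
case IE : I I0 => [i||]//; last by rewrite gt0_muley ?leey// lte_fin.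
rewrite -EFinM !lee_fin => i0.
(* Local boundedness of u makes [S] finite. At the centre d w = r, so S^p dominates r^2 u(w)^p. *)
pose d a := r - Num.max `|a.1 - w.1| `|a.2 - w.2|.
pose S := sup [set d a `^ (2 / p) * u a | a in sq w r].
have q0 : 0 < 2 / p by rewrite divr_gt0.
have dr a : sq w r a -> 0 <= d a <= r.
  case=> h1 h2; rewrite /d subr_ge0 ge_max h1 h2/= gerBl le_max normr_ge0//.
have sww : sq w r w by split; rewrite subrr normr0 ltW.
have Sub a : sq w r a -> d a `^ (2 / p) * u a <= S.
  move=> wa; apply: ub_le_sup; last by exists a.
  exists (r `^ (2 / p) * M) => _ [b wb <-]; have /andP[db dbr] := dr b wb.
  by rewrite ler_pM ?powR_ge0 ?MP// ge0_ler_powR// ?nnegrE ?(ltW q0) ?(ltW r0).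
have S0 : 0 <= S by apply: le_trans (Sub w sww); rewrite mulr_ge0 ?powR_ge0.
suff : S `^ p <= K * 2 `^ (2 / p) * i.
  apply: le_trans; have -> : r ^+ 2 * u w `^ p = (r `^ (2 / p) * u w) `^ p.
    rewrite powRM ?powR_ge0// -powRrM divfK ?gt_eqF// -powR_mulrn ?(ltW r0)//.
  apply: ge0_ler_powR; rewrite ?nnegrE ?mulr_ge0 ?powR_ge0 ?(ltW p0)//.
  have := Sub w sww; rewrite /d !subrr normr0 maxxx subr0; apply.
have [->|S_neq0] := eqVneq S 0; first by rewrite powR0 ?gt_eqF// !mulr_ge0 ?powR_ge0// ltW.
have S_gt0 : 0 < S by rewrite lt_def S_neq0.
(* This is the claim multiplied by S^(1 - p), a positive finite number. *)
suff H : S <= K * 2 `^ (2 / p) * i * S `^ (1 - p).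
  rewrite -(@ler_pM2r _ (S `^ (1 - p))) ?powR_gt0//.
  rewrite -powRD; last by rewrite S_neq0 implybT.
  by rewrite addrC subrK powRr1.
apply: ge_sup; first by exists (d w `^ (2 / p) * u w); exists w.
move=> _ [a wa <-]; have /andP[da_ge0 dar] := dr a wa.
have [->|da_neq0] := eqVneq (d a) 0.
  by rewrite powR0 ?gt_eqF// mul0r !mulr_ge0 ?powR_ge0 ?(ltW K0).
have da0 : 0 < d a by rewrite lt_def da_neq0.
have dE : r - d a = Num.max `|a.1 - w.1| `|a.2 - w.2| by rewrite /d; ring.
have d20 : 0 < d a / 2 by rewrite divr_gt0.
have sub v : sq a (d a / 2) v -> d a / 2 <= d v /\ sq w r v.
  case=> h1 h2.
  have m1 : `|a.1 - w.1| <= r - d a by rewrite dE le_max lexx.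
  have m2 : `|a.2 - w.2| <= r - d a by rewrite dE le_max lexx orbT.
  have n1 : `|v.1 - w.1| <= r - d a / 2.
    by move: h1 m1; rewrite !ler_norml; lra.
  have n2 : `|v.2 - w.2| <= r - d a / 2.
    by move: h2 m2; rewrite !ler_norml; lra.
  split; last by have h := ltW d20; split; [apply: le_trans n1 _|apply: le_trans n2 _]; rewrite gerBl.
  by rewrite lerBrDr addrC -lerBrDr ge_max n1 n2.
(* On the square of half-side d a / 2 about a one has d >= d a / 2, hence u <= S (d a / 2)^(- 2 / p)
   and u = u^(1 - p) u^p <= c u^p. As c equals S^(1 - p) (d a / 2)^(2 - 2 / p), the square of d a /
   2 cancels against that in the subaverage; this dictates the exponent 2 / p. *)
pose c := (S * (d a / 2) `^ (- (2 / p))) `^ (1 - p).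
have c0 : 0 <= c by exact: powR_ge0.
have uc v : sq a (d a / 2) v -> u v <= c * u v `^ p.
  move=> /sub[dv wv]; have [->|uv] := eqVneq (u v) 0; first by rewrite mulr_ge0// powR_ge0.
  have uv0 : 0 < u v by rewrite lt_def uv u0.
  rewrite -{1}[u v]powRr1// -{1}(subrK p 1) powRD ?uv ?implybT//.
  rewrite ler_wpM2r ?powR_ge0// ge0_ler_powR ?nnegrE ?mulr_ge0 ?powR_ge0//; first lra.
  rewrite powRN ler_pdivlMr ?powR_gt0// mulrC; apply: le_trans (Sub v wv).
  by rewrite ler_wpM2r// ge0_ler_powR ?nnegrE ?(ltW q0) ?(ltW d20)// (le_trans (ltW d20)).
have := uK a (d a / 2) d20.
have : (\int[mu \x mu]_(v in sq a (d a / 2)%R) (u v)%:E <= (c * i)%:E)%E.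
  apply: (@le_trans _ _ (\int[mu \x mu]_(v in sq a (d a / 2)%R) (c%:E * (u v `^ p)%:E))%E).
    apply: ge0_le_integral => //.
    - exact: measurable_sq.
    - by move=> v _; rewrite lee_fin.
    - by apply: measurable_funTS; exact/measurable_EFinP.
    - by apply: measurable_funTS; apply/measurable_EFinP; apply: measurable_funM.
  rewrite ge0_integralZl_EFin//; last 3 first.
  - exact: measurable_sq.
  - by move=> v _; rewrite lee_fin powR_ge0.
  - by apply: measurable_funTS; exact/measurable_EFinP.
  rewrite EFinM -IE; apply: lee_wpmul2l; first by rewrite lee_fin.
  apply: ge0_subset_integral => //; try exact: measurable_sq.
  - by apply: measurable_funTS; exact/measurable_EFinP.
  - by move=> v _; rewrite lee_fin powR_ge0.
  - by move=> v /sub[].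
move=> h1 h2.
have : (((d a / 2) ^+ 2 * u a)%:E <= (K * (c * i))%:E)%E.
  apply: le_trans h2 _; rewrite (EFinM K); apply: lee_wpmul2l => //.
  by rewrite lee_fin ltW.
rewrite lee_fin => {h1 h2} h.
have cE : c = S `^ (1 - p) * ((d a / 2) ^+ 2 * (d a / 2) `^ (- (2 / p))).
  rewrite /c (powRM _ S0 (powR_ge0 _ _)) -powRrM; congr (_ * _).
  rewrite -powR_mulrn ?(ltW d20)// -powRD ?(gt_eqF d20) ?implybT//; congr (_ `^ _).
  by field; rewrite gt_eqF.
have daE : d a `^ (2 / p) = 2 `^ (2 / p) * (d a / 2) `^ (2 / p).
  by rewrite -powRM ?(ltW d20)//; congr (_ `^ _); field.
move: h; rewrite cE powRN.
have e0 : 0 < (d a / 2) `^ (2 / p) by rewrite powR_gt0.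
have f0 : 0 < (d a / 2) ^+ 2 by rewrite exprn_gt0.
rewrite daE; move: ((d a / 2) `^ (2 / p)) ((d a / 2) ^+ 2) e0 f0 => e f e0 f0.
rewrite (_ : K * _ = f * (K * S `^ (1 - p) * i / e)); last by field; rewrite gt_eqF.
rewrite ler_pM2l// ler_pdivlMr// => h.
rewrite -mulrA (_ : K * _ * i * _ = 2 `^ (2 / p) * (K * S `^ (1 - p) * i)); last by ring.
by rewrite ler_wpM2l ?powR_ge0// mulrC.
Qed.

Lemma subav_powR K p : 0 < K -> 0 < p -> exists2 K', 0 < K' &
  forall u, (forall w, 0 <= u w) -> measurable_fun [set: R * R] u ->
  (forall w r, exists M, forall v, sq w r v -> u v <= M) ->
  subav K u -> subav K' (fun w => u w `^ p).
Proof.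
move=> K0 p0; have [p1|p1] := ltP p 1; last first.
  have [K' K'0 K'P] := subav_powR_ge1 K0 p1; exists K' => // u ? ? _; exact: K'P.
exists (K * 2 `^ (2 / p)); first by rewrite mulr_gt0// powR_gt0.
by apply: subav_powR_lt1 => //; rewrite p0.
Qed.

End PowerSubaverage.

(** * Subaveraging and increments for an entire function and its derivative *)

Section EntireModulus.
Context {R : realType}.
Notation mu := (@lebesgue_measure R).
Implicit Types (f g : C R -> C R) (w z v : R * R).

Definition pl w : C R := Complex w.1 w.2.

Lemma jcont_cmod f : continuous f -> jcont (fun x y => cmod (f (Complex x y))).
Proof.
move=> cf a b e e0; have [d d0 dP] := (continuous_eps f (Complex a b)).1 (@cf _) e e0.
exists (d / 2); first by rewrite divr_gt0.
move=> x y xa yb; apply: (@le_trans _ _ (cmod (f (Complex x y) - f (Complex a b)))).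
  rewrite ler_norml; apply/andP; split.
    by rewrite lerBrDl lerBlDr addrC cmodB (le_trans _ (cmodD _ _))// subrK.
  by rewrite lerBlDr (le_trans _ (cmodD _ _))// subrK.
apply: dP; apply: le_trans (cmod_ReIm _) _ => /=; lra.
Qed.

Lemma measurable_cmod f : continuous f ->
  measurable_fun [set: R * R] (fun w => cmod (f (pl w))).
Proof. by move=> /jcont_cmod/jcont_measurable. Qed.

(** Compactness by bisection: a function unbounded on a square is unbounded on one of its quarters,
    whereas continuity bounds it near every point. *)
Lemma jcont_bounded (G : R -> R -> R) : jcont G ->
  forall w r, exists M, forall v, sq w r v -> G v.1 v.2 <= M.
Proof.
move=> jG [x y] r; have [r0|r0] := leP r 0.
  exists (G x y) => -[u v] [/=]; rewrite !ler_norml => h1 h2.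
  by have -> : u = x; [lra|have -> : v = y; [lra|]].
apply: contrapT => unb.
pose bad (x y L : R) := ~ exists M, forall u v : R, x <= u <= x + L -> y <= v <= y + L -> G u v <= M.
have [| | |a [b]] := @square_bisection R bad _ (x - r) (y - r) (2 * r).
- move=> x1 y1 L L0; move=> nb; apply: contrapT => no4; apply: nb.
  have /contrapT[M1 H1] : ~ bad x1 y1 (L / 2) by move=> h; apply: no4; constructor 1.
  have /contrapT[M2 H2] : ~ bad (x1 + L / 2) y1 (L / 2) by move=> h; apply: no4; constructor 2.
  have /contrapT[M3 H3] : ~ bad x1 (y1 + L / 2) (L / 2) by move=> h; apply: no4; constructor 3.
  have /contrapT[M4 H4] : ~ bad (x1 + L / 2) (y1 + L / 2) (L / 2).
    by move=> h; apply: no4; constructor 4.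
  exists (Num.max (Num.max M1 M2) (Num.max M3 M4)) => u v ux vy.
  rewrite !le_max; case: (leP u (x1 + L / 2)) => hu; case: (leP v (y1 + L / 2)) => hv.
  + by rewrite H1//; lra.
  + by rewrite H3 ?orbT//; lra.
  + by rewrite H2 ?orbT//; lra.
  + by rewrite H4 ?orbT//; lra.
- by rewrite mulr_gt0.
- move=> [M MP]; apply: unb; exists M => -[u v] [/=]; rewrite !ler_norml => h1 h2.
  by apply: MP; lra.
have [d d0 dP] := jG a b 1 ltr01.
move=> /(_ d d0)[x' [y' [L [Ld xa yb]]]]; apply.
exists (G a b + 1) => u v ux vy.
by have := dP u v; rewrite !ler_norml => H; have : -1 <= G u v - G a b <= 1; [apply: H; lra|lra].
Qed.

Lemma subav_entire f : entire f -> subav 4 (fun w => cmod (f (pl w))).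
Proof.
move=> ef [x y] r r0; have cf := entire_continuous ef.
apply: (@square_average R (fun x y => cmod (f (Complex x y)))) => //; [exact: jcont_cmod|by move=> *; exact: cmod_ge0|exact: cmod_ge0|].
by move=> t t0; apply: (@cauchy_square _ f [::]).
Qed.

(** A maximum principle. The square of half-side r / 2 about w has its boundary inside [sq z r] and
    at distance at least r / 4 from z, where the quotient is at most 2 M / (r / 4) = 8 M / r. Then
    [cauchy_square], with z as exceptional point, carries a bound to w. At w = z this is Cauchy's
    estimate; elsewhere it bounds difference quotients uniformly. *)
Lemma dquot_bound f z r M : entire f -> 0 < r ->
  (forall v, sq z r v -> cmod (f (pl v)) <= M) ->
  forall w, sq z (r / 4) w -> cmod (dquot f (pl z) (pl w)) <= 16 * M / r.
Proof.
case: z => a b ef r0 MP; have cf := entire_continuous ef.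
set g := dquot f (pl (a, b)).
have cg : continuous g by apply: continuous_dquot => //; exact: ef.
have M0 : 0 <= M.
  by apply: le_trans (MP (a, b) _); [exact: cmod_ge0|split; rewrite subrr normr0 ltW].
have main w : pl w != pl (a, b) -> sq (a, b) (r / 4) w -> cmod (g (pl w)) <= 16 * M / r.
  case: w => x y xyab [/=]; rewrite !ler_norml => xa yb.
  have far (u v : R) : sq (a, b) r (u, v) -> r / 4 <= `|u - a| \/ r / 4 <= `|v - b| ->
      cmod (g (Complex u v)) <= 8 * M / r.
    move=> uvr uvab.
    have d0 : r / 4 <= cmod (pl (u, v) - pl (a, b)).
      have h1 : `|u - a| <= cmod (pl (u, v) - pl (a, b)) := Re_cmod (pl (u, v) - pl (a, b)).
      have h2 : `|v - b| <= cmod (pl (u, v) - pl (a, b)) := Im_cmod (pl (u, v) - pl (a, b)).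
      by case: uvab => h; apply: (le_trans h).
    have r4 : 0 < r / 4 by rewrite divr_gt0.
    have uv_neq : pl (u, v) != pl (a, b).
      by rewrite -subr_eq0 -cmod_gt0; apply: lt_le_trans d0.
    rewrite /g /dquot (negbTE uv_neq) cmodM cmodV ler_pdivrMr; last exact: lt_le_trans d0.
    have h1 : cmod (f (pl (u, v)) - f (pl (a, b))) <= 2 * M.
      apply: le_trans (cmodD _ _) _; rewrite cmodN (_ : 2 * M = M + M); last ring.
      by apply: lerD; apply: MP => //; split; rewrite subrr normr0 ltW.
    apply: (le_trans h1); apply: (@le_trans _ _ (8 * M / r * (r / 4))).
      by rewrite le_eqVlt; apply/predU1P; left; field; rewrite gt_eqF.
    by rewrite ler_wpM2l// divr_ge0 ?mulr_ge0// ltW.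
  have t0 : 0 < r / 2 by rewrite divr_gt0.
  have dE c : c \notin [:: pl (a, b)] -> derivable g c 1.
    by rewrite inE => cab; exact: derivable_dquot.
  have xyE : (Complex x y : C R) \notin [:: pl (a, b)] by rewrite inE.
  set B := 8 * M / r.
  have side F (u : R) : continuous F -> (forall s, u - r / 2 <= s <= u + r / 2 -> F s <= B) ->
      cint F (u - r / 2) (u + r / 2) <= B * r.
    move=> cF FB; apply: (@le_trans _ _ (cint (fun=> B) (u - r / 2) (u + r / 2))).
      by apply: le_cint => //; exact: cst_continuous.
    by rewrite cint_cst; [rewrite (_ : u + _ - _ = r)//; field|lra].
  have jg := jcont_cmod cg.
  have s1 : cint (fun s => cmod (g (Complex s (y - r / 2)))) (x - r / 2) (x + r / 2) <= B * r.
    apply: side; first exact: (jcont_cont1 jg).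
    move=> s sx; apply: far; first by split; rewrite /= ler_norml; lra.
    by right; rewrite ltr0_norm; lra.
  have s2 : cint (fun s => cmod (g (Complex s (y + r / 2)))) (x - r / 2) (x + r / 2) <= B * r.
    clear s1.
    apply: side; first exact: (jcont_cont1 jg).
    move=> s sx; apply: far; first by split; rewrite /= ler_norml; lra.
    by right; rewrite gtr0_norm; lra.
  have s3 : cint (fun s => cmod (g (Complex (x - r / 2) s))) (y - r / 2) (y + r / 2) <= B * r.
    clear s1 s2.
    apply: side; first exact: (jcont_cont2 jg).
    move=> s sx; apply: far; first by split; rewrite /= ler_norml; lra.
    by left; rewrite ltr0_norm; lra.
  have s4 : cint (fun s => cmod (g (Complex (x + r / 2) s))) (y - r / 2) (y + r / 2) <= B * r.
    clear s1 s2 s3.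
    apply: side; first exact: (jcont_cont2 jg).
    move=> s sx; apply: far; first by split; rewrite /= ler_norml; lra.
    by left; rewrite gtr0_norm; lra.
  have : 4 * (r / 2) * cmod (g (Complex x y)) <= 4 * (B * r).
    apply: (le_trans (cauchy_square t0 cg dE xyE)).
    rewrite (_ : 4 * (B * r) = B * r + B * r + B * r + B * r); last ring.
    by apply: lerD s4; apply: lerD s3; apply: lerD s1 s2.
  have -> : 4 * (B * r) = 4 * (r / 2) * (16 * M / r).
    by rewrite /B; field; rewrite gt_eqF.
  by rewrite ler_pM2l// mulr_gt0.
move=> w wz; have [E|] := eqVneq (pl w) (pl (a, b)); last by move=> ?; exact: main.
(* At the centre itself the bound follows by continuity, from the points (a + h, b). *)
rewrite -/(g _) E; apply/ler_addgt0Pl => e e0.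
have [d d0 dP] := (continuous_eps g (pl (a, b))).1 (@cg _) e e0.
pose h := Num.min d (r / 4).
have h0 : 0 < h by rewrite lt_min d0 divr_gt0.
have hd : h <= d by rewrite ge_min lexx.
have hr : h <= r / 4 by rewrite ge_min lexx orbT.
have hE : cmod (pl (a + h, b) - pl (a, b)) <= h.
  apply: le_trans (cmod_ReIm _) _ => /=; rewrite subrr normr0 addr0 addrC addKr gtr0_norm//.
have := dP _ (le_trans hE hd); rewrite cmodB => gh.
have gb : cmod (g (pl (a + h, b))) <= 16 * M / r.
  apply: main; last by split; rewrite /= ?subrr ?normr0 ?divr_ge0 ?(ltW r0)// addrC addKr gtr0_norm.
  by apply/eqP => -[]; lra.
by rewrite -[g _](subrK (g (pl (a + h, b)))); apply: le_trans (cmodD _ _) _; exact: lerD.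
Qed.

Lemma cauchy_estimate f z r M : entire f -> 0 < r ->
  (forall v, sq z r v -> cmod (f (pl v)) <= M) ->
  cmod (derive1 f (pl z)) <= 16 * M / r.
Proof.
move=> ef r0 MP; have := dquot_bound ef r0 MP (w := z).
by rewrite /dquot eqxx; apply; split; rewrite subrr normr0 divr_ge0// ltW.
Qed.

Lemma deriv_bounded f : entire f ->
  forall w r, exists M, forall v, sq w r v -> cmod (derive1 f (pl v)) <= M.
Proof.
move=> ef w r; have [M MP] := jcont_bounded (jcont_cmod (entire_continuous ef)) w (r + 1).
exists (16 * M / 1) => v [v1 v2]; apply: cauchy_estimate => // u [u1 u2].
by apply: MP; split; move: u1 u2 v1 v2; rewrite !ler_norml; lra.
Qed.

(** Difference quotients with step 1 / (n + 1). They are entire and converge to f', to which they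
    transmit measurability and subaveraging. *)
Definition fdiff f n (z : C R) : C R :=
  ((n.+1%:R : R[i]) * (f (z + (n.+1%:R^-1)%:C%C) - f z) : R[i]).

Lemma entire_fdiff f n : entire f -> entire (fdiff f n).
Proof.
move=> ef z; set c : C R := (n.+1%:R^-1)%:C%C.
have dfc : derivable (fun z : C R => f (z + c)) z 1.
  have E : (fun h : R[i] => h^-1 *: (f (h *: (1 : C R) + z + c) - f (z + c))) =
      (fun h : R[i] => h^-1 *: (f (h *: (1 : C R) + (z + c)) - f (z + c))).
    by apply/funext => h; rewrite -addrA.
  by have := ef (z + c); rewrite /derivable -E.
have d1 : derivable (cst (n.+1%:R : R[i]) : C R -> C R) z 1 by exact: derivable_cst.
exact: (@derivableM R[i] (C R) _ _ z 1 d1 (derivableB dfc (ef z))).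
Qed.

Lemma mul_sub_inv (F : fieldType) (N d l : F) : N != 0 ->
  N * d - l = N * (d - l * N^-1).
Proof. by move=> N0; field. Qed.

Lemma complexr_inv_nat n : ((n.+1%:R^-1)%:C)%C = (n.+1%:R : R[i])^-1.
Proof. by rewrite fmorphV rmorph_nat. Qed.

Lemma cmod_nat n : cmod (n%:R : C R) = n%:R.
Proof.
rewrite /cmod normr_nat.
by have := rmorph_nat (real_complex R) n; rewrite /= => <-.
Qed.

Lemma cmod_dist (a b : C R) : `|cmod a - cmod b| <= cmod (a - b).
Proof.
rewrite ler_norml; apply/andP; split.
  by rewrite lerBrDl lerBlDr addrC cmodB (le_trans _ (cmodD _ _))// subrK.
by rewrite lerBlDr (le_trans _ (cmodD _ _))// subrK.
Qed.

Lemma cvg_fdiff f z : entire f ->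
  cmod (fdiff f n (pl z)) @[n --> \oo] --> cmod (derive1 f (pl z)).
Proof.
move=> ef; apply/cvgrPdist_le => e e0.
have [d d0 dP] := derivable_eps (ef (pl z)) e0.
near=> n; set c : C R := (n.+1%:R^-1)%:C%C.
have n0 : 0 < n.+1%:R^-1 :> R by rewrite invr_gt0.
have cE : cmod c = n.+1%:R^-1.
  by rewrite /c cmodE expr0n/= addr0 sqrtr_sqr gtr0_norm.
have E : pl z + c - pl z = c by rewrite addrAC subrr add0r.
have := dP (pl z + c); rewrite E cE => H.
apply: le_trans (cmod_dist _ _) _; rewrite cmodB.
have N0 : n.+1%:R != 0 :> R[i] by rewrite pnatr_eq0.
rewrite [X in cmod X](@mul_sub_inv R[i] n.+1%:R (f (pl z + c) - f (pl z))
  (derive1 f (pl z)) N0).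
rewrite cmodM cmod_nat -complexr_inv_nat -ler_pdivlMl ?ltr0n// [leRHS]mulrC.
apply: H; apply: ltW; near: n; exact: (near_infty_natSinv_lt (PosNum d0)).
Unshelve. all: by end_near. Qed.

Lemma measurable_deriv f : entire f ->
  measurable_fun [set: R * R] (fun w => cmod (derive1 f (pl w))).
Proof.
move=> ef; apply: (@measurable_fun_cvg _ _ _ _ (fun n w => cmod (fdiff f n (pl w)))).
  by move=> n; apply: measurable_cmod; apply: entire_continuous; exact: entire_fdiff.
by move=> w _; exact: cvg_fdiff.
Qed.

Lemma subav_deriv f : entire f -> subav 4 (fun w => cmod (derive1 f (pl w))).
Proof.
move=> ef w r r0.
(* [dquot_bound] on squares of half-side 4 covers points at distance up to 4 / 4 = 1, hence every
   step 1 / (n + 1). Its bound is the constant that dominates in the limit. *)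
have [M MP] := jcont_bounded (jcont_cmod (entire_continuous ef)) w (r + 4).
have bnd n v : sq w r v -> cmod (fdiff f n (pl v)) <= 16 * M / 4.
  move=> [v1 v2]; set c : C R := (n.+1%:R^-1)%:C%C.
  have n0 : 0 < n.+1%:R^-1 :> R by rewrite invr_gt0.
  have n1 : n.+1%:R^-1 <= 1 :> R by rewrite invf_le1// ler1n.
  have cE : pl (v.1 + n.+1%:R^-1, v.2) = pl v + c.
    by rewrite /c /pl/=; congr Complex; rewrite addr0.
  have v4 u : sq v 4 u -> cmod (f (pl u)) <= M.
    by move=> [u1 u2]; apply: MP; split; move: u1 u2 v1 v2; rewrite !ler_norml; lra.
  have := dquot_bound ef (ltr0Sn R 3) v4 (w := (v.1 + n.+1%:R^-1, v.2)).
  rewrite cE /dquot ifF; last first.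
    apply/negbTE; rewrite -cE; apply/eqP => -[h]; move: n0.
    by rewrite -(ltrDl v.1) h ltxx.
  rewrite addrAC subrr add0r /c complexr_inv_nat invrK [X in cmod X]mulrC => H.
  by rewrite /fdiff complexr_inv_nat; apply: H; split; rewrite /= ?subrr ?normr0// addrC addKr gtr0_norm// divff.
have := @dominated_cvg _ _ _ (mu \x mu)%E (sq w r) (measurable_sq w r)
  (fun n v => (cmod (fdiff f n (pl v)))%:E) (fun v => (cmod (derive1 f (pl v)))%:E)
  (fun=> (16 * M / 4)%:E).
have mf n : measurable_fun (sq w r) (fun v => (cmod (fdiff f n (pl v)))%:E).
  apply: measurable_funTS; apply/measurable_EFinP; apply: measurable_cmod.
  by apply: entire_continuous; exact: entire_fdiff.
have cf v : sq w r v -> (cmod (fdiff f n (pl v)))%:E @[n --> \oo] --> (cmod (derive1 f (pl v)))%:E.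
  by move=> _; apply: cvg_EFin; [exact: nearW|exact: cvg_fdiff].
have ib : (mu \x mu)%E.-integrable (sq w r) (fun=> (16 * M / 4)%:E).
  apply/integrableP; split; first exact: measurable_cst.
  rewrite integral_cst//=; last exact: measurable_sq.
  by rewrite mu_sq ?(ltW r0)// -EFinM ltry.
move=> /(_ mf cf _ ib) H.
have c0 : r ^+ 2 * cmod (fdiff f n (pl w)) @[n --> \oo] --> r ^+ 2 * cmod (derive1 f (pl w)).
  by apply: (@cvgM _ _ _ _ (fun=> r ^+ 2)); [exact: cvg_cst|exact: cvg_fdiff].
have c1 : (r ^+ 2 * cmod (fdiff f n (pl w)))%:E @[n --> \oo] -->
    (r ^+ 2 * cmod (derive1 f (pl w)))%:E.
  by apply: cvg_EFin; [exact: nearW|exact: c0].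
have c2 : (4%:E * \int[mu \x mu]_(v in sq w r) (cmod (fdiff f n (pl v)))%:E @[n --> \oo] -->
    4%:E * \int[mu \x mu]_(v in sq w r) (cmod (derive1 f (pl v)))%:E)%E.
  apply: cvgeZl => //; apply: H => //.
  by move=> n v wv; rewrite gee0_abs ?lee_fin ?cmod_ge0//; exact: bnd.
apply: (lee_cvg_to c1 c2).
by apply: nearW => n; exact: (subav_entire (@entire_fdiff f n ef) w r0).
Qed.

(** The mean value theorem is applied to the real and the imaginary part separately, which costs the
    factor 2. *)
Lemma cmod_increment f (a b : C R) M : entire f ->
  (forall t : R, 0 <= t <= 1 -> cmod (derive1 f (a + (t%:C%C : R[i]) * (b - a))) <= M) ->
  cmod (f b - f a) <= 2 * M * cmod (b - a).
Proof.
move=> ef fM; pose l (t : R) : C R := a + (t%:C%C : R[i]) * (b - a).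
have M0 : 0 <= M by apply: le_trans (fM 0 _); [exact: cmod_ge0|lra].
pose m := cmod (b - a); have m0 : 0 <= m by exact: cmod_ge0.
have m1 : 0 < m + 1 by rewrite ltr_wpDl.
have part (q : R[i] -> R) : (forall z w : R[i], q (z - w) = q z - q w) ->
    (forall (z : R[i]) (t : R), q ((t%:C%C : R[i]) * z) = t * q z) ->
    (forall z : C R, `|q z| <= cmod z) ->
    `|q (f b) - q (f a)| <= M * cmod (b - a).
  move=> qB qZ ql; pose F t := q (f (l t)); pose dF t := q ((derive1 f (l t) : R[i]) * (b - a)).
  have lB t h : l (h + t) - l t = (h%:C%C : R[i]) * (b - a).
    by rewrite /l (rmorphD (real_complex R)) mulrDl; ring.
  have D t : is_derive t (1 : R) F (dF t).
    have cv : h^-1 *: (F (h *: 1 + t) - F t) @[h --> 0^'] --> dF t.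
      apply/cvgrPdist_le => e e0; have e1 : 0 < e / (m + 1).
        by rewrite divr_gt0// ltr_wpDl.
      have [d d0 dP] := derivable_eps (ef (l t)) e1.
      have d1 : 0 < d / (m + 1) by rewrite divr_gt0// ltr_wpDl.
      near=> h; have h0 : h != 0 by near: h; exact: nbhs_dnbhs_neq.
      have hd : `|h| <= d / (m + 1) by near: h; apply: dnbhs0_le.
      have := dP (l (h + t)); rewrite lB cmodM -/m.
      have -> : cmod (h%:C%C : C R) = `|h| by rewrite cmodE expr0n/= addr0 sqrtr_sqr.
      have hm : `|h| * m <= d.
        apply: (@le_trans _ _ (d / (m + 1) * (m + 1))); last by rewrite divfK// gt_eqF.
        by apply: ler_pM => //; lra.
      move=> /(_ hm) H.
      have -> : dF t - h^-1 *: (F (h *: 1 + t) - F t) =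
          - (h^-1 * q (f (l (h + t)) - f (l t) - (derive1 f (l t) : R[i]) * ((h%:C%C : R[i]) * (b - a)))).
        rewrite [h *: 1]mulr1 !qB [(derive1 f (l t) : R[i]) * (_ * _)]mulrCA qZ /dF.
        by rewrite /F -[_ *: _]/(_ * _); field.
      rewrite normrN normrM normfV ler_pdivrMl ?normr_gt0//.
      apply: le_trans (ql _) _; apply: le_trans H _.
      rewrite mulrCA ler_wpM2l//.
      rewrite -[leRHS]mulr1 -mulrA ler_wpM2l ?(ltW e0)// mulrC ler_pdivrMr//; lra.
    by apply: DeriveDef; [apply/cvg_ex; exists (dF t)|apply: cvg_lim].
  have cF : continuous F by move=> t; apply: differentiable_continuous; apply/derivable1_diffP; case: (D t).
  have [c] := @MVT R F dF 0 1 ltr01 (fun t _ => D t) (continuous_subspaceT cF).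
  rewrite in_itv/= /F /l subr0 mulr1 => /andP[c0 c1].
  rewrite mul1r mul0r addr0 [a + _]addrC subrK => ->.
  apply: le_trans (ql _) _; rewrite cmodM ler_wpM2r ?cmod_ge0//.
  by apply: fM; rewrite !ltW.
apply: le_trans (cmod_ReIm _) _; rewrite Re_sub Im_sub.
have -> : 2 * M * cmod (b - a) = M * cmod (b - a) + M * cmod (b - a) by ring.
apply: lerD; apply: part.
- exact: Re_sub.
- by move=> [x y] t /=; ring.
- exact: Re_cmod.
- exact: Im_sub.
- by move=> [x y] t /=; ring.
- exact: Im_cmod.
Unshelve. all: by end_near. Qed.

End EntireModulus.

(** * The radial weight *)

Section Halfline.
Context {R : realType}.
Implicit Types (f g phi : R -> R) (a b r : R).

Lemma deriv_le (F dF : R -> R) a b : a <= b ->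
  (forall x, a <= x <= b -> is_derive x 1 F (dF x)) ->
  (forall x, a <= x <= b -> 0 <= dF x) -> F a <= F b.
Proof.
move=> ab F' dF0; rewrite -subr_ge0.
have [c| |c cab ->] := MVT_segment ab (f := F) (df := dF).
- by rewrite in_itv/= => /andP[ac cb]; apply: F'; rewrite !ltW.
- apply: derivable_within_continuous => x; rewrite in_itv/= => xab.
  by have [] := F' x xab.
- by rewrite mulr_ge0 ?subr_ge0//; apply: dF0; rewrite in_itv/= in cab.
Qed.

Lemma hderivable_pos g r : hderivable g -> 0 < r -> is_derive r 1 g (hderive g r).
Proof.
move=> [dg _] r0; apply: DeriveDef; first exact: dg.
by rewrite /hderive r0 derive1E.
Qed.

Lemma C2_continuous_hderive2 phi r : C2_halfline phi -> 0 < r ->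
  {for r, continuous (hderive (hderive phi))}.
Proof.
move=> [_ _ /continuous_within_itvcyP[c _]] r0; apply: c.
by rewrite in_itv/= r0.
Qed.

(** Even reflection makes a function on the half-line, with a one-sided derivative at 0, continuous
    on the whole line, where results on continuous functions apply. *)
Lemma hderivable_abs_continuous g : hderivable g -> continuous (fun r => g `|r|).
Proof.
move=> [dg /cvg_ex[l /= hl]] r; have [->|r0] := eqVneq r 0; last first.
  have r1 : 0 < `|r| by rewrite normr_gt0.
  apply: (@continuous_comp _ _ _ (fun r : R => `|r|) g); first exact: norm_continuous.
  by apply: differentiable_continuous; apply/derivable1_diffP; exact: dg.
apply/cvgrPdist_le => e e0 /=; rewrite normr0.
pose m := `|l| + 1; have m0 : 0 < m by rewrite ltr_wpDl.
have [d /= d0 dP] : exists2 d, 0 < d & forall h, 0 < h -> h < d -> `|l - hquot0 g h| <= 1.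
  move/cvgrPdist_le : hl => /(_ 1 ltr01) /= [d d0 dP]; exists d => // h h0 hd.
  by apply: dP => //=; rewrite sub0r normrN gtr0_norm.
pose dd := Num.min (d / 2) (e / m).
have dd0 : 0 < dd by rewrite lt_min !divr_gt0.
have N : \forall x \near (0 : R), `|x| < dd.
  by apply/nbhs_normP; exists dd => //= y; rewrite /ball_/= sub0r normrN.
apply: filterS N => x; rewrite lt_min => /andP[xd /ltW xe].
have [->|x0] := eqVneq x 0; first by rewrite normr0 subrr normr0 ltW.
have x1 : 0 < `|x| by rewrite normr_gt0.
have gx : g `|x| - g 0 = `|x| * hquot0 g `|x| by rewrite /hquot0 mulVKf ?gt_eqF.
rewrite distrC gx normrM normr_id.
have qm : `|hquot0 g `|x| | <= m.
  have : `|l - hquot0 g `|x| | <= 1 by apply: dP => //; lra.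
  rewrite /m => H.
  by rewrite -[hquot0 _ _](subKr l) (le_trans (ler_normB _ _))// lerD2l.
by rewrite (le_trans (ler_pM _ _ xe qm))// divfK// gt_eqF.
Qed.

Lemma hderivable_bounded g b : hderivable g -> exists M, forall r, 0 <= r <= b -> `|g r| <= M.
Proof.
move=> /hderivable_abs_continuous cg.
have [b0|b0] := leP 0 b; last by exists 0 => r; lra.
have [M [_ MP]] := compact_bounded (continuous_compact (continuous_subspaceT cg) (@segment_compact R 0 b)).
exists (M + 1) => r rb; apply: (MP (M + 1)); first by rewrite ltrDl.
by exists r; rewrite /= ?in_itv/= ?ger0_norm//; lra.
Qed.

Lemma limf_esup_lt (f : R -> R) (a : \bar R) :
  (limf_esup (fun r => (f r)%:E) +oo%R < a)%E ->
  exists q : R, (q%:E < a)%E /\ exists M, forall r, M < r -> f r <= q.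
Proof.
rewrite limf_esupE => /ereal_inf_lt[_ [V [M [_ MV]] <-]] Va.
have ub r : M < r -> ((f r)%:E <= ereal_sup [set (f x)%:E | x in V])%E.
  by move=> Mr; apply: ereal_sup_ubound; exists r => //; exact: MV.
move: Va ub; case: (ereal_sup _) => [q||].
- by move=> qa ub; exists q; split=> //; exists M => r /ub; rewrite lee_fin.
- by rewrite ltNge leey.
- by move=> _ /(_ (M + 1)); rewrite ltrDl ltr01 => /(_ isT); rewrite leNgt ltNyr.
Qed.

Lemma limf_esup_le (f : R -> R) (q M : R) : (forall r, M < r -> f r <= q) ->
  (limf_esup (fun r => (f r)%:E) +oo%R <= q%:E)%E.
Proof.
move=> fq; rewrite limf_esupE.
apply: (@le_trans _ _ (ereal_sup [set (f x)%:E | x in [set x | M < x]])).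
  apply: ereal_inf_lbound; exists [set x | M < x] => //.
  by exists M; split=> //; exact: num_real.
by apply: ub_ereal_sup => _ [r Mr <-]; rewrite lee_fin; exact: fq.
Qed.

Lemma limf_einf_gtNy (f : R -> R) :
  (-oo < limf_einf (fun r => (f r)%:E) +oo%R)%E ->
  exists K M : R, forall r, M < r -> - K <= f r.
Proof.
rewrite /limf_einf => h; have : (limf_esup (fun r => (- f r)%:E) +oo%R < +oo)%E.
  by move: h; rewrite lteNr/=.
move=> /limf_esup_lt[K [_ [M MP]]]; exists K, M => r /MP; lra.
Qed.

Lemma limf_einf_bounded (f : R -> R) (K M : R) : (forall r, M < r -> - K <= f r) ->
  (-oo < limf_einf (fun r => (f r)%:E) +oo%R)%E.
Proof.
move=> fK; rewrite /limf_einf lteNr/=; apply: (@le_lt_trans _ _ K%:E); last exact: ltry.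
by apply: (@limf_esup_le (fun r => - f r) K M) => r /fK; lra.
Qed.

Lemma derive1_hderive_quot phi r : C2_halfline phi -> 0 < r -> hderive phi r != 0 ->
  let d := hderive phi r in let d2 := hderive (hderive phi) r in
  is_derive r 1 (fun s => s / hderive phi s) ((d - r * d2) / d ^+ 2).
Proof.
move=> [h1 h2 _] r0 d0 d d2; have D2 := hderivable_pos h2 r0.
have DV : is_derive r (1 : R) (fun s => (hderive phi s)^-1) (- d ^- 2 *: d2).
  exact: is_deriveV.
have D := @is_deriveM _ _ id (fun s => (hderive phi s)^-1) r 1 1 _ (is_derive_id _ _) DV.
apply: (is_derive_eq D); rewrite /d -/d2.
by rewrite -![_ *: _]/(_ * _) /=; field.
Qed.

(* The two bounds on (r / phi')' / r make 1 / phi' Lipschitz near infinity. *)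
Lemma radial_data (p : R) phi : 0 < p ->
  (forall r, 0 <= r -> 0 <= phi r) -> C2_halfline phi ->
  (exists2 r0 : R, 0 < r0 & forall r, r0 < r -> hderive phi r != 0) ->
  r * expR (- (p * phi r)) / hderive phi r @[r --> +oo] --> (0 : R) ->
  (limf_esup (fun r : R => (r^-1 * derive1 (fun s => s / hderive phi s) r)%:E) +oo%R
      < p%:E)%E ->
  (-oo < limf_einf (fun r : R => (r^-1 * derive1 (fun s => s / hderive phi s) r)%:E) +oo%R)%E ->
  exists r1 e L : R, [/\ 0 < r1, 0 < e, 0 < L & forall r, r1 <= r ->
    let d := hderive phi r in let d' := hderive (hderive phi) r in
    [/\ 0 < d, d^-1 <= L * r, `|d' / d ^+ 2| <= L,
        d^-1 / r - d' / d ^+ 2 <= p - e & - L <= d^-1 / r - d' / d ^+ 2]].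
Proof.
move=> p0 phi0 C2 [r0 r0_gt0 dneq] lim0 /limf_esup_lt[q [qp [M1 M1P]]].
move=> /limf_einf_gtNy[K [M2 M2P]]; move: qp; rewrite lte_fin => qp.
have [h1 h2 _] := C2.
have cd r : 0 < r -> {for r, continuous (hderive phi)}.
  move=> r_gt0; apply: differentiable_continuous; apply/derivable1_diffP.
  by have [] := hderivable_pos h2 r_gt0.
have same a b : r0 < a -> a <= b -> (0 < hderive phi a) = (0 < hderive phi b).
  move=> r0a ab; apply: contrapT => ne.
  have [c] : exists2 c, c \in `[a, b] & hderive phi c = 0.
    apply: IVT => //.
      apply: continuous_in_subspaceT => x; rewrite inE/= in_itv/= => xab; apply: cd; lra.
    have := dneq a r0a; have := dneq b (lt_le_trans r0a ab).
    move: ne; rewrite ge_min le_max.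
    by case: ltgtP => // _; case: ltgtP.
  by rewrite in_itv/= => cab; apply/eqP; apply: dneq; lra.
pose R0 := r0 + 1.
have dpos r : R0 <= r -> 0 < hderive phi r.
  move=> R0r; rewrite -(@same R0)//; last by rewrite /R0 ltrDl.
  rewrite lt_neqAle eq_sym dneq ?/R0 ?ltrDl//= leNgt; apply/negP => dR0.
  have dneg s : R0 <= s -> hderive phi s < 0.
    move=> R0s; have := dneq s; rewrite neq_lt => /(_ _)/orP[|//|].
      by rewrite (lt_le_trans _ R0s)// ltrDl.
    by rewrite -(@same R0)// ?ltrDl//; move: dR0; lra.
  have e0 : 0 < expR (- (p * phi R0)) by exact: expR_gt0.
  have phile s : R0 <= s -> phi s <= phi R0.
    move=> R0s; rewrite -lerN2.
    apply: (@deriv_le (fun s => - phi s) (fun s => - hderive phi s)) => // x xs.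
      by apply: is_deriveN; apply: hderivable_pos => //; rewrite /R0 in xs; lra.
    by rewrite oppr_ge0 ltW// dneg; lra.
  have [S [S1 SP]] : exists S, R0 <= S /\ forall s, S <= s -> hderive phi s <= - 1.
    have : \forall r \near +oo, `|r * expR (- (p * phi r)) / hderive phi r| < expR (- (p * phi R0)).
      by move/cvgrPdist_lt : lim0 => /(_ _ e0); apply: filterS => s; rewrite sub0r normrN.
    move=> [S [_ SP]]; exists (Num.max (S + 1) (R0 + 1)); split; first by rewrite le_max lerDl ler01 orbT.
    move=> s; rewrite ge_max => /andP[Ss R0s]; have := SP s; have ds := dneg s.
    have s1 : R0 <= s by lra.
    have {}ds := ds s1; rewrite normrM normfV (ltr0_norm ds).
    rewrite ltr_pdivrMr ?oppr_gt0// => H; have {H} H := H (lt_le_trans (ltr_pwDr ltr01 (lexx _)) Ss).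
    have : expR (- (p * phi R0)) <= `|s * expR (- (p * phi s))|.
      have s_ge1 : 1 <= s by rewrite /R0 in s1; lra.
      rewrite ger0_norm; last by rewrite mulr_ge0 ?expR_ge0//; lra.
      rewrite -[leLHS]mul1r ler_pM ?expR_ge0 ?ler01//.
      by rewrite ler_expR lerN2 ler_pM2l// phile.
    move=> /le_lt_trans/(_ H); rewrite -[X in X < _]mulr1 ltr_pM2l//; lra.
  (* With slope at most - 1 from [S] on, phi T <= phi S + S - T = - 1. *)
  pose T := S + phi S + 1.
  have phiS : 0 <= phi S by apply: phi0; rewrite /R0 in S1; lra.
  have : phi T + T <= phi S + S.
    rewrite -lerN2; apply: (@deriv_le (fun s => - (phi s + s)) (fun s => - (hderive phi s + 1))).
    - by rewrite /T; lra.
    - move=> x xs; apply: is_deriveN; apply: is_deriveD.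
      by apply: hderivable_pos => //; rewrite /R0 in S1; lra.
    - move=> x xs; have := SP x; lra.
  have : 0 <= phi T by apply: phi0; rewrite /T; rewrite /R0 in S1; lra.
  by rewrite /T; lra.
pose r1 := Num.max R0 (Num.max (M1 + 1) (M2 + 1)).
have r1_gt0 : 0 < r1 by rewrite lt_max /R0 addr_gt0.
have gE r : r1 <= r -> r^-1 * derive1 (fun s => s / hderive phi s) r =
    (hderive phi r)^-1 / r - hderive (hderive phi) r / hderive phi r ^+ 2.
  move=> r1r; have r_gt0 : 0 < r by apply: lt_le_trans r1r.
  have d_gt0 : 0 < hderive phi r by apply: dpos; apply: le_trans r1r; rewrite le_max lexx.
  have D := @derive1_hderive_quot phi r C2 r_gt0 (lt0r_neq0 d_gt0).
  by rewrite derive1E derive_val; field; rewrite !gt_eqF.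
have gb r : r1 <= r -> - K <= (hderive phi r)^-1 / r - hderive (hderive phi) r / hderive phi r ^+ 2 <= q.
  move=> r1r; rewrite -gE//.
  have : M1 + 1 <= r by apply: le_trans r1r; rewrite !le_max lexx !orbT.
  have : M2 + 1 <= r by apply: le_trans r1r; rewrite !le_max lexx !orbT.
  by move=> m2 m1; rewrite M1P ?M2P//; lra.
(* From g' <= q r < p r, g grows at most like p r^2 / 2, whence g <= A r^2 and 1 / phi' <= A r. *)
pose g r := r / hderive phi r; pose A := `|g r1| / r1 ^+ 2 + p.
have A_gt0 : 0 < A by rewrite ltr_wpDl// divr_ge0 ?sqr_ge0.
have tau_le r : r1 <= r -> (hderive phi r)^-1 <= A * r.
  move=> r1r; have r_gt0 : 0 < r by apply: lt_le_trans r1r.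
  have : p / 2 * r1 ^+ 2 - g r1 <= p / 2 * r ^+ 2 - g r.
    apply: (@deriv_le (fun s => p / 2 * s ^+ 2 - g s)
      (fun s => p * s - (hderive phi s - s * hderive (hderive phi) s) / hderive phi s ^+ 2)).
    - exact: r1r.
    - move=> x /andP[r1x xr]; have x_gt0 : 0 < x by apply: lt_le_trans r1x.
      have d_gt0 : 0 < hderive phi x by apply: dpos; apply: le_trans r1x; rewrite le_max lexx.
      have D := @derive1_hderive_quot phi x C2 x_gt0 (lt0r_neq0 d_gt0).
      have D1 : is_derive x (1 : R) (fun s : R => p / 2 * s ^+ 2) (p * x).
        apply: is_derive_eq; rewrite -![_ *: _]/(_ * _).
        by rewrite /=; field.
      exact: (is_deriveB D1 D).
    - move=> x /andP[r1x xr]; have x_gt0 : 0 < x by apply: lt_le_trans r1x.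
    have d_gt0 : 0 < hderive phi x by apply: dpos; apply: le_trans r1x; rewrite le_max lexx.
    have /andP[_ H] := gb x r1x.
    rewrite subr_ge0 -ler_pdivrMr//; apply: le_trans (ltW qp); apply: le_trans H.
    by rewrite le_eqVlt; apply/predU1P; left; field; rewrite !gt_eqF.
  have r12 : 0 < r1 ^+ 2 by rewrite exprn_gt0.
  have r2 : r1 ^+ 2 <= r ^+ 2 by rewrite lerXn2r// nnegrE ltW.
  have g1 := ler_norm (g r1).
  have g2 : `|g r1| <= `|g r1| / r1 ^+ 2 * r ^+ 2.
    by rewrite mulrAC ler_pdivlMr// ler_wpM2l.
  have pr : 0 <= p * r1 ^+ 2 by rewrite mulr_ge0 ?ltW.
  have pr2 : 0 <= p * r ^+ 2 by rewrite mulr_ge0 ?sqr_ge0 ?ltW.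
  move=> H; have {H g1 g2 pr pr2} : g r <= A * r ^+ 2 by rewrite /A; lra.
  by rewrite /g [A * _]mulrA mulrC ler_pM2r.
exists r1, (p - q), (A + `|K| + p + `|q|); split => //; first lra.
  by have := normr_ge0 K; have := normr_ge0 q; lra.
move=> r r1r d d'; have r_gt0 : 0 < r by apply: lt_le_trans r1r.
have d_gt0 : 0 < d by apply: dpos; apply: le_trans r1r; rewrite le_max lexx.
have dA := tau_le r r1r.
have dA' : d^-1 / r <= A by rewrite ler_pdivrMr.
have dr0 : 0 <= d^-1 / r by rewrite divr_ge0 ?invr_ge0 ?ltW.
have /andP[gb1 gb2] := gb r r1r; rewrite -/d -/d' in gb1 gb2.
have K1 := ler_norm K; have q1 := ler_norm q.
have q0 := normr_ge0 q; have K0 := normr_ge0 K.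
split => //.
- by apply: le_trans dA _; rewrite ler_wpM2r ?ltW//; lra.
- by rewrite ler_norml; lra.
- lra.
- lra.
Qed.

End Halfline.

(** * The scale 1 / phi', the tail integral, and shifts along a ray *)

Section RadialWeight.
Context {R : realType} (p : R) (phi : R -> R) (r1 e L : R).
Notation mu := (@lebesgue_measure R).
Implicit Types (r s c x y z dl : R).
Hypothesis p_gt0 : 0 < p.
Hypothesis phi_ge0 : forall r, 0 <= r -> 0 <= phi r.
Hypothesis C2 : C2_halfline phi.
Hypothesis r1_gt0 : 0 < r1.
Hypothesis e_gt0 : 0 < e.
Hypothesis L_gt0 : 0 < L.
Hypothesis data : forall r, r1 <= r ->
  let d := hderive phi r in let d' := hderive (hderive phi) r in
  [/\ 0 < d, d^-1 <= L * r, `|d' / d ^+ 2| <= L,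
      d^-1 / r - d' / d ^+ 2 <= p - e & - L <= d^-1 / r - d' / d ^+ 2].
Hypothesis lim0 : r * expR (- (p * phi r)) / hderive phi r @[r --> +oo] --> (0 : R).

Local Notation d := (hderive phi).
Local Notation d' := (hderive (hderive phi)).

Definition rtau r : R := (hderive phi r)^-1.
Definition rweight r : R := expR (- (p * phi r)).
Local Notation tau := rtau.
Local Notation om := rweight.

Lemma rtau_gt0 r : r1 <= r -> 0 < tau r.
Proof. by move=> /data[d0 _ _ _ _]; rewrite invr_gt0. Qed.

Lemma rtau_le r : r1 <= r -> tau r <= L * r.
Proof. by move=> /data[]. Qed.

Lemma rweight_gt0 r : 0 < om r.
Proof. exact: expR_gt0. Qed.

Lemma is_derive_phi r : 0 < r -> is_derive r (1 : R) phi (d r).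
Proof. by move=> r0; apply: hderivable_pos => //; case: C2. Qed.

Lemma is_derive_rtau r : r1 <= r -> is_derive r (1 : R) tau (- (d' r / d r ^+ 2)).
Proof.
move=> r1r; have [d0 _ _ _ _] := data r1r; have r0 := lt_le_trans r1_gt0 r1r.
have [_ h2 _] := C2; have D2 := hderivable_pos h2 r0.
have D : is_derive r (1 : R) tau (- (d r) ^- 2 *: d' r) by apply: is_deriveV; rewrite gt_eqF.
by apply: (is_derive_eq D); rewrite -[_ *: _]/(_ * _) mulNr mulrC.
Qed.

Lemma rtau_lip r s : r1 <= r -> r1 <= s -> `|tau s - tau r| <= L * `|s - r|.
Proof.
suff H x y : r1 <= x -> x <= y -> `|tau y - tau x| <= L * (y - x).
  move=> r1r r1s; have [rs|/ltW sr] := leP r s.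
    by rewrite (ger0_norm (_ : 0 <= s - r)) ?subr_ge0// H.
  by rewrite distrC (distrC s) (ger0_norm (_ : 0 <= r - s)) ?subr_ge0// H.
move=> r1x xy.
have D z : x <= z <= y -> is_derive z (1 : R) tau (- (d' z / d z ^+ 2)).
  by move=> /andP[xz _]; apply: is_derive_rtau; apply: le_trans xz.
have DL z : is_derive z (1 : R) (fun t : R => L * t) L.
  by apply: is_derive_eq; rewrite -![_ *: _]/(_ * _); ring.
have bd z : x <= z <= y -> - L <= d' z / d z ^+ 2 <= L.
  by move=> /andP[xz _]; have [_ _ + _ _] := data (le_trans r1x xz); rewrite ler_norml.
have h1 : L * x - tau x <= L * y - tau y.
  apply: (@deriv_le _ (fun t => L * t - tau t) (fun z => L - - (d' z / d z ^+ 2)) _ _ xy).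
    by move=> z xz; exact: (is_deriveB (DL z) (D z xz)).
  by move=> z /bd; lra.
have h2 : L * x + tau x <= L * y + tau y.
  apply: (@deriv_le _ (fun t => L * t + tau t) (fun z => L + - (d' z / d z ^+ 2)) _ _ xy).
    by move=> z xz; exact: (is_deriveD (DL z) (D z xz)).
  by move=> z /bd; lra.
by rewrite ler_norml mulrBr; lra.
Qed.

Lemma rtau_cmp c r s : r1 <= r -> r1 <= s -> 0 <= c -> c * L <= 1 / 2 ->
  `|s - r| <= c * tau r -> tau r / 2 <= tau s /\ tau s <= 3 / 2 * tau r.
Proof.
move=> r1r r1s c0 cL sr; have t0 := rtau_gt0 r1r.
have h := rtau_lip r1r r1s.
have {h} : `|tau s - tau r| <= 1 / 2 * tau r.
  apply: (le_trans h); apply: (@le_trans _ _ (L * (c * tau r))).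
    by rewrite ler_pM2l.
  by rewrite mulrA (mulrC L) ler_pM2r.
by rewrite ler_norml; lra.
Qed.

Lemma phi_nondecreasing r s : r1 <= r -> r <= s -> phi r <= phi s.
Proof.
move=> r1r rs; apply: (@deriv_le _ phi d) => // x /andP[rx _].
  by apply: is_derive_phi; apply: lt_le_trans (le_trans r1r rx).
by have [/ltW] := data (le_trans r1r rx).
Qed.

(** Between r and s the Lipschitz bound gives tau >= tau(r) / 2, so phi' <= 2 / tau(r) on an
    interval of length at most c tau(r). *)
Lemma phi_cmp c r s : r1 <= r -> r1 <= s -> 0 <= c -> c * L <= 1 / 2 ->
  `|s - r| <= c * tau r -> `|phi s - phi r| <= 2 * c.
Proof.
move=> r1r r1s c0 cL sr; have t0 := rtau_gt0 r1r.
have A x y : r1 <= x -> x <= y -> (forall z, x <= z <= y -> `|z - r| <= c * tau r) ->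
    phi y - phi x <= 2 / tau r * (y - x).
  move=> r1x xy zr.
  have DL z : is_derive z (1 : R) (fun t : R => 2 / tau r * t) (2 / tau r).
    by apply: is_derive_eq; rewrite -![_ *: _]/(_ * _); ring.
  have : 2 / tau r * x - phi x <= 2 / tau r * y - phi y.
    apply: (@deriv_le _ (fun t => 2 / tau r * t - phi t) (fun z => 2 / tau r - d z) _ _ xy).
      move=> z /andP[xz _]; apply: (is_deriveB (DL z)); apply: is_derive_phi.
      by apply: lt_le_trans (le_trans r1x xz).
    move=> z xz; have r1z : r1 <= z by move: xz => /andP[+ _]; apply: le_trans.
    have [h _] := rtau_cmp r1r r1z c0 cL (zr z xz).
    rewrite subr_ge0 -(invrK (d z)) -[(d z)^-1]/(tau z).
    have tz := rtau_gt0 r1z.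
    by rewrite ler_pdivlMr// mulrC ler_pdivrMr//; lra.
  lra.
have two : 2 / tau r * (c * tau r) = 2 * c by field; rewrite gt_eqF.
have k0 : 0 < 2 / tau r by rewrite divr_gt0.
have [rs|/ltW rs] := leP r s.
  rewrite ger0_norm ?subr_ge0 ?phi_nondecreasing//.
  rewrite ger0_norm ?subr_ge0// in sr.
  apply: le_trans (A r s r1r rs _) _; last by rewrite -two ler_pM2l.
  by move=> z rz; rewrite ger0_norm; lra.
rewrite distrC ger0_norm ?subr_ge0 ?phi_nondecreasing//.
rewrite distrC ger0_norm ?subr_ge0// in sr.
apply: le_trans (A s r r1s rs _) _; last by rewrite -two ler_pM2l.
by move=> z rz; rewrite distrC ger0_norm; lra.
Qed.

Lemma rweight_cmp c r s : r1 <= r -> r1 <= s -> 0 <= c -> c * L <= 1 / 2 ->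
  `|s - r| <= c * tau r -> om s <= expR (p * (2 * c)) * om r.
Proof.
move=> r1r r1s c0 cL sr; have := phi_cmp r1r r1s c0 cL sr.
rewrite ler_norml => /andP[h _]; rewrite /rweight -expRD ler_expR.
have : p * (phi r - phi s) <= p * (2 * c) by rewrite ler_pM2l//; lra.
by rewrite mulrBr; lra.
Qed.

(* The hypothesis [tau' + tau / r <= p - e] is exactly the infinitesimal form
   of this contraction. *)
Lemma shift_contraction dl r : r1 <= r -> 0 < dl -> dl * L <= 1 / 2 -> p * L * dl <= e / 2 ->
  (r + dl * tau r) * om (r + dl * tau r) * (1 - dl * (d' r / d r ^+ 2)) <= expR (- (dl * e / 2)) * (r * om r).
Proof.
move=> r1r dl0 dlL pLdl; set s := r + dl * tau r; have t0 := rtau_gt0 r1r; have r0 := lt_le_trans r1_gt0 r1r.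
have [d0 _ _ De _] := data r1r; have rs : r <= s by rewrite lerDl mulr_ge0 ?ltW.
have L0 : 0 < 1 + L * dl by rewrite addr_gt0// mulr_gt0.
(* On [r, s] the Lipschitz bound gives tau <= tau(r) (1 + L dl), hence a lower bound for phi' = 1 /
   tau. *)
have grow : dl / (1 + L * dl) <= phi s - phi r.
  pose k := (tau r * (1 + L * dl))^-1.
  have k0 : 0 < k by rewrite invr_gt0 mulr_gt0.
  have DL z : is_derive z (1 : R) (fun t : R => k * t) k.
    by apply: is_derive_eq; rewrite -![_ *: _]/(_ * _); ring.
  have : phi r - k * r <= phi s - k * s.
    apply: (@deriv_le _ (fun t => phi t - k * t) (fun z => d z - k) _ _ rs).
      move=> z /andP[rz _]; apply: (fun h => is_deriveB h (DL z)); apply: is_derive_phi.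
      exact: lt_le_trans rz.
    move=> z /andP[rz zs]; have r1z := le_trans r1r rz.
    rewrite subr_ge0 -(invrK (d z)) -[(d z)^-1]/(tau z) lef_pV2 ?posrE ?rtau_gt0 ?mulr_gt0//.
    have := rtau_lip r1r r1z; rewrite (ger0_norm (_ : 0 <= z - r)) ?subr_ge0//.
    have : L * (z - r) <= L * (dl * tau r) by rewrite ler_pM2l//; rewrite /s in zs; lra.
    by rewrite ler_norml; lra.
  have -> : dl / (1 + L * dl) = k * (s - r).
    by rewrite /k /s; field; rewrite !gt_eqF.
  lra.
have b1 : s <= r * expR (dl * (tau r / r)).
  have -> : s = r * (1 + dl * (tau r / r)) by rewrite /s; field; rewrite gt_eqF.
  by rewrite ler_pM2l// expR_ge1Dx.
have b2 : om s <= om r * expR (- (p * (dl / (1 + L * dl)))).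
  rewrite /rweight -expRD ler_expR -opprD lerN2 -mulrDr ler_pM2l//; lra.
have b3 : 1 - dl * (d' r / d r ^+ 2) <= expR (- (dl * (d' r / d r ^+ 2))).
  exact: expR_ge1Dx.
have s0 : 0 <= s by rewrite (le_trans (ltW r0)).
apply: (@le_trans _ _ (s * om s * expR (- (dl * (d' r / d r ^+ 2))))).
  by rewrite ler_wpM2l// mulr_ge0// ltW// rweight_gt0.
apply: (@le_trans _ _ ((r * expR (dl * (tau r / r))) * (om r * expR (- (p * (dl / (1 + L * dl)))))
    * expR (- (dl * (d' r / d r ^+ 2))))).
  by rewrite ler_wpM2r ?expR_ge0// ler_pM// ltW// rweight_gt0.
set a := expR (dl * _); set b := expR (- (p * _)); set c := expR (- (dl * (d' r / _))).
have -> : r * a * (om r * b) * c = a * b * c * (r * om r) by ring.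
rewrite ler_wpM2r ?mulr_ge0 ?(ltW r0) ?(ltW (rweight_gt0 _))//.
rewrite /a /b /c -!expRD ler_expR.
have De' : tau r / r - d' r / d r ^+ 2 <= p - e by [].
have : dl * (tau r / r - d' r / d r ^+ 2) <= dl * (p - e) by rewrite ler_pM2l.
(* The second-order loss is at most p L dl^2, and the smallness of dl makes it at most half of the
   gain e dl. *)
have : p * dl - p * (dl / (1 + L * dl)) <= e / 2 * dl.
  rewrite -mulrBr (_ : dl - dl / (1 + L * dl) = L * dl * dl / (1 + L * dl)); last first.
    by field; rewrite gt_eqF.
  rewrite mulrA ler_pdivrMr// !mulrA; apply: (@le_trans _ _ (e / 2 * dl)).
    by rewrite ler_pM2r.
  have : 0 <= e / 2 * dl * (L * dl).
    by rewrite !mulr_ge0 ?invr_ge0 ?(ltW e_gt0) ?(ltW dl0) ?(ltW L_gt0).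
  by rewrite mulrDr mulr1; lra.
by rewrite !mulrBr; lra.
Qed.

Lemma continuous_phi r : 0 < r -> {for r, continuous phi}.
Proof.
move=> r0; apply: differentiable_continuous; apply/derivable1_diffP.
by have [] := is_derive_phi r0.
Qed.

Lemma continuous_hderive r : 0 < r -> {for r, continuous d}.
Proof.
move=> r0; apply: differentiable_continuous; apply/derivable1_diffP.
by have [_ h2 _] := C2; have [] := hderivable_pos h2 r0.
Qed.

Lemma continuous_rweight r : 0 < r -> {for r, continuous om}.
Proof.
move=> r0; apply: (@continuous_comp _ _ _ (fun r => - (p * phi r)) expR); last exact: continuous_expR.
apply: continuousN; apply: (@continuousM _ _ (fun=> p)); first exact: cst_continuous.
exact: continuous_phi.
Qed.

Lemma continuous_rweight_abs : continuous (fun r => om `|r|).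
Proof.
move=> r; apply: (@continuous_comp _ _ _ (fun r => - (p * phi `|r|)) expR); last exact: continuous_expR.
apply: continuousN; apply: (@continuousM _ _ (fun=> p)); first exact: cst_continuous.
by apply: hderivable_abs_continuous; case: C2.
Qed.

Definition rtail r : R := \int[mu]_(s in `[r, +oo[) (s * om s).

(** The opposite of the derivative of s om(s) tau(s), using tau' = - d' / d^2. *)
Definition rdensity s : R := s * om s * (p - (tau s / s - d' s / d s ^+ 2)).

Lemma continuous_rdensity s : r1 <= s -> {for s, continuous rdensity}.
Proof.
move=> r1s; have s0 := lt_le_trans r1_gt0 r1s.
have [d0 _ _ _ _] := data r1s.
apply: (@continuousM _ _ (fun s => s * om s)).
  apply: (@continuousM _ _ id); [exact: cvg_id|exact: continuous_rweight].
apply: (@continuousB _ _ _ (fun=> p)); first exact: cst_continuous.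
apply: continuousB.
  apply: (@continuousM _ _ tau).
    by apply: continuousV; [rewrite gt_eqF|exact: continuous_hderive].
  by apply: (@continuousV _ _ id); [rewrite gt_eqF|exact: cvg_id].
apply: (@continuousM _ _ d'); first exact: C2_continuous_hderive2.
apply: (@continuousV _ _ (fun s => d s ^+ 2)); first by rewrite gt_eqF// exprn_gt0.
have := @continuousM _ _ d d s (continuous_hderive s0) (continuous_hderive s0).
by rewrite (_ : (d \* d) = (fun s => d s ^+ 2))//; apply/funext => x; rewrite expr2.
Qed.

Lemma within_continuous_rdensity r : r1 <= r -> {within `[r, +oo[, continuous rdensity}.
Proof.
move=> r1r; apply/continuous_within_itvcyP; split.
  by move=> s; rewrite in_itv/= andbT => /ltW rs; apply: continuous_rdensity; apply: le_trans rs.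
by apply: cvg_at_right_filter; exact: continuous_rdensity.
Qed.

(** The fundamental theorem of calculus on a half-line; the boundary term at infinity is exactly the
    limit hypothesis [lim0]. *)
Lemma tail_integral r : r1 <= r ->
  (\int[mu]_(s in `[r, +oo[) (rdensity s)%:E =
   (r * om r * tau r)%:E)%E.
Proof.
move=> r1r; have r0 := lt_le_trans r1_gt0 r1r.
pose G s := s * om s * tau s.
have DG s : r <= s -> is_derive s (1 : R) (fun s => - G s) (rdensity s).
  move=> rs; have r1s := le_trans r1r rs; have s0 := lt_le_trans r0 rs.
  have [d0 _ _ _ _] := data r1s.
  have Dom : is_derive s (1 : R) om (- (p * d s) * om s).
    have Dp := is_derive_phi s0.
    have D1 : is_derive s (1 : R) (fun s => - (p * phi s)) (- (p * d s)).
      by apply: is_derive_eq; rewrite -![_ *: _]/(_ * _); ring.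
    have D := @is_derive1_comp _ expR _ s _ _ (is_derive_expR _) D1.
    by apply: (is_derive_eq D); rewrite mulrC.
  have Dt := is_derive_rtau r1s.
  have D1 : is_derive s (1 : R) (fun s => s * om s) (s * (- (p * d s) * om s) + om s).
    apply: (is_derive_eq (is_deriveM (is_derive_id s (1 : R)) Dom)).
    by rewrite -![_ *: _]/(_ * _) mulr1.
  have D2 : is_derive s (1 : R) G (s * om s * - (d' s / d s ^+ 2) +
      tau s * (s * (- (p * d s) * om s) + om s)).
    by apply: (is_derive_eq (is_deriveM D1 Dt)); rewrite -![_ *: _]/(_ * _).
  have {}D2 := is_deriveN D2.
  apply: (is_derive_eq D2); rewrite /rdensity /rtau; field.
  by rewrite !gt_eqF.
rewrite (@ge0_continuous_FTC2y _ _ (fun s => - G s) r 0).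
- by rewrite EFinN oppeK add0e.
- move=> s rs; have r1s := le_trans r1r rs; have s0 := lt_le_trans r0 rs.
  have [_ _ _ De _] := data r1s; rewrite mulr_ge0//.
    by rewrite mulr_ge0 ?(ltW s0) ?(ltW (rweight_gt0 _)).
  rewrite subr_ge0; apply: (le_trans De); rewrite gerBl; exact: ltW.
- exact: (within_continuous_rdensity r1r).
- rewrite -oppr0; apply: cvgN; exact: lim0.
- by move=> s /ltW rs; have [] := DG s rs.
- have c : {for r, continuous (fun s => - G s)}.
    apply: differentiable_continuous; apply/derivable1_diffP.
    by have [] := DG r (lexx _).
  exact: cvg_at_right_filter c.
- by move=> s; rewrite in_itv/= andbT => /ltW rs; rewrite derive1E; have [_ ->] := DG s rs.
Qed.

Lemma measurable_tail_integrand r : 0 <= r ->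
  measurable_fun `[r, +oo[ (fun s => s * om s).
Proof.
move=> r0; apply: (@eq_measurable_fun _ _ _ _ _ (fun s => s * om `|s|)).
  by move=> s; rewrite inE/= in_itv/= andbT => rs; rewrite ger0_norm// (le_trans r0).
apply: measurable_funTS; apply: continuous_measurable_fun => s.
by apply: (@continuousM _ _ id); [exact: cvg_id|exact: continuous_rweight_abs].
Qed.

(** [rdensity] lies between e and p + L times s om(s). The integrals are extended reals here because
    the upper bound is what makes them finite, in [tail_finite], so that [rtail] has a meaning. *)
Lemma tail_bounds r : r1 <= r ->
  ((r * om r * tau r / (p + L))%:E <= \int[mu]_(s in `[r, +oo[) (s * om s)%:E)%E /\
  (\int[mu]_(s in `[r, +oo[) (s * om s)%:E <= (r * om r * tau r / e)%:E)%E.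
Proof.
move=> r1r; have r0 := lt_le_trans r1_gt0 r1r.
have := tail_integral r1r; set I := integral _ _ _; move=> IE.
have pL : 0 < p + L by rewrite addr_gt0.
have m1 : measurable_fun `[r, +oo[ (fun s => (s * om s)%:E).
  by apply/measurable_EFinP; apply: measurable_tail_integrand; exact: ltW.
have pos s : `[r, +oo[%classic s -> (0 <= (s * om s)%:E)%E.
  rewrite /= in_itv/= andbT => rs; rewrite lee_fin mulr_ge0//; last exact/ltW/rweight_gt0.
  by rewrite (le_trans (ltW r0)).
have up s : r <= s -> e * (s * om s) <= s * om s * (p - (tau s / s - d' s / d s ^+ 2)) <= (p + L) * (s * om s).
  move=> rs; have r1s := le_trans r1r rs; have s0 := lt_le_trans r0 rs.
  have [_ _ _ De DL] := data r1s.
  have {}De : tau s / s - d' s / d s ^+ 2 <= p - e := De.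
  have {}DL : - L <= tau s / s - d' s / d s ^+ 2 := DL.
  have w0 : 0 < s * om s by rewrite mulr_gt0// rweight_gt0.
  by rewrite (mulrC e) (mulrC (p + L)) !ler_pM2l//; lra.
have mI : measurable_fun `[r, +oo[ (fun s => (rdensity s)%:E).
  apply/measurable_EFinP; apply: subspace_continuous_measurable_fun => //.
  exact: within_continuous_rdensity.
have posI s : `[r, +oo[%classic s -> (0 <= (rdensity s)%:E)%E.
  move=> rs; have := pos s rs; move: rs; rewrite /= in_itv/= andbT => /up/andP[+ _].
  by rewrite !lee_fin => h1 h2; apply: le_trans h1; rewrite mulr_ge0// ltW.
have mZ (k : R) : measurable_fun `[r, +oo[ (fun s => k%:E * (s * om s)%:E)%E.
  by apply: emeasurable_funM => //; exact: measurable_cst.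
have posZ (k : R) s : 0 <= k -> `[r, +oo[%classic s -> (0 <= k%:E * (s * om s)%:E)%E.
  by move=> k0 /pos; exact: mule_ge0.
split.
  have h : ((r * om r * tau r)%:E <= (p + L)%:E * \int[mu]_(s in `[r, +oo[) (s * om s)%:E)%E.
    rewrite -IE -ge0_integralZl_EFin ?(ltW pL)//; apply: ge0_le_integral => //.
    - exact: mZ.
    - by move=> s; rewrite /= in_itv/= andbT => /up/andP[_]; rewrite -EFinM lee_fin.
  rewrite mulrC EFinM; apply: (@le_trans _ _ ((p + L)^-1%:E * ((p + L)%:E * \int[mu]_(s in `[r, +oo[) (s * om s)%:E))%E).
    by apply: lee_wpmul2l => //; rewrite lee_fin invr_ge0 ltW.
  by rewrite muleA -EFinM mulVf ?gt_eqF// mul1e.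
have h : (e%:E * \int[mu]_(s in `[r, +oo[) (s * om s)%:E <= (r * om r * tau r)%:E)%E.
  rewrite -IE -ge0_integralZl_EFin ?(ltW e_gt0)//; apply: ge0_le_integral => //.
  - by move=> s; apply: posZ; exact: ltW.
  - exact: mZ.
  - by move=> s; rewrite /= in_itv/= andbT => /up/andP[+ _]; rewrite -EFinM lee_fin.
rewrite mulrC EFinM; apply: (@le_trans _ _ (e^-1%:E * (e%:E * \int[mu]_(s in `[r, +oo[) (s * om s)%:E))%E).
  by rewrite muleA -EFinM mulVf ?gt_eqF// mul1e.
by apply: lee_wpmul2l => //; rewrite lee_fin invr_ge0 ltW.
Qed.

Lemma rweight_le1 r : 0 <= r -> om r <= 1.
Proof.
by move=> r0; rewrite /rweight -expR0 ler_expR oppr_le0 mulr_ge0 ?phi_ge0// ltW.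
Qed.

Lemma tail_integrand_ge0 r s : 0 <= r -> `[r, +oo[%classic s -> (0 <= (s * om s)%:E)%E.
Proof.
rewrite /= in_itv/= andbT => r0 rs; rewrite lee_fin mulr_ge0//.
  exact: le_trans rs.
exact/ltW/rweight_gt0.
Qed.

Lemma tail_finite r : 0 <= r -> (\int[mu]_(s in `[r, +oo[) (s * om s)%:E < +oo)%E.
Proof.
move=> r0; have mw := measurable_tail_integrand (lexx 0).
apply: (@le_lt_trans _ _ (\int[mu]_(s in `[0%R, +oo[) (s * om s)%:E)%E).
  apply: ge0_subset_integral => //.
  - by apply/measurable_EFinP.
  - by move=> s; exact: tail_integrand_ge0.
  - by move=> s /=; rewrite !in_itv/= !andbT; exact: le_trans.
have E : `[0, +oo[%classic = `[0, r1[%classic `|` `[r1, +oo[%classic :> set R.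
  apply/seteqP; split => s /=; rewrite !in_itv/= !andbT.
    by move=> s0; case: (ltP s r1) => h; [left; rewrite s0|right].
  by case => [/andP[]//|]; apply: le_trans; exact: ltW.
rewrite E ge0_integral_setU//; last first.
- by apply/disj_setPS => s /= [] ; rewrite !in_itv/= !andbT => /andP[_ sr] rs; lra.
- by rewrite -E; move=> s; exact: tail_integrand_ge0.
- by rewrite -E; apply/measurable_EFinP.
apply: lte_add_pinfty; last first.
  by apply: le_lt_trans (tail_bounds (lexx r1)).2 _; exact: ltry.
apply: (@le_lt_trans _ _ (\int[mu]_(s in `[0%R, r1[) r1%:E)%E).
  apply: ge0_le_integral => //.
  - by move=> s /=; rewrite in_itv/= => /andP[s0 _]; rewrite lee_fin mulr_ge0// ltW// rweight_gt0.
  - apply/measurable_EFinP; apply: measurable_funS mw => // s /=.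
    by rewrite !in_itv/= => /andP[-> _].
  - move=> s /=; rewrite in_itv/= => /andP[s0 sr]; rewrite lee_fin.
    by rewrite -[leRHS]mulr1; apply: ler_pM => //; [exact/ltW/rweight_gt0|exact: ltW|exact: rweight_le1].
by rewrite integral_cst//= lebesgue_measure_itv/= lte_fin r1_gt0 -EFinD -EFinM ltry.
Qed.

Lemma tail_fin_num r : 0 <= r -> (\int[mu]_(s in `[r, +oo[) (s * om s)%:E)%E \is a fin_num.
Proof.
move=> r0; rewrite ge0_fin_numE; first exact: tail_finite.
by apply: integral_ge0 => s; exact: tail_integrand_ge0.
Qed.

Lemma rtailE r : 0 <= r -> (rtail r)%:E = (\int[mu]_(s in `[r, +oo[) (s * om s)%:E)%E.
Proof. by move=> r0; rewrite /rtail /Rintegral fineK// tail_fin_num. Qed.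

Lemma rtail_bounds r : r1 <= r ->
  r * om r * tau r / (p + L) <= rtail r <= r * om r * tau r / e.
Proof.
move=> r1r; have r0 : 0 <= r by apply: le_trans r1r; exact: ltW.
have [h1 h2] := tail_bounds r1r; rewrite -rtailE// lee_fin in h1.
by rewrite -rtailE// lee_fin in h2; rewrite h1.
Qed.

Lemma rtail_nonincreasing r s : 0 <= r -> r <= s -> rtail s <= rtail r.
Proof.
move=> r0 rs; have s0 := le_trans r0 rs.
rewrite -lee_fin !rtailE//; apply: ge0_subset_integral => //.
- by apply/measurable_EFinP; exact: measurable_tail_integrand.
- by move=> x; exact: tail_integrand_ge0.
- by move=> x /=; rewrite !in_itv/= !andbT; exact: le_trans.
Qed.

Lemma rtail_gt0 r : 0 <= r -> 0 < rtail r.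
Proof.
move=> r0; pose s := Num.max r r1.
have r1s : r1 <= s by rewrite le_max lexx orbT.
apply: (@lt_le_trans _ _ (rtail s)); last by apply: rtail_nonincreasing => //; rewrite le_max lexx.
have /andP[h _] := rtail_bounds r1s; apply: lt_le_trans h.
have s0 : 0 < s by apply: lt_le_trans r1s.
by rewrite divr_gt0 ?addr_gt0// mulr_gt0 ?rtau_gt0// mulr_gt0 ?rweight_gt0.
Qed.

Lemma distortionE r : distortion p phi r = rtail r / ((1 + r) * om r).
Proof. by []. Qed.

(** The normalisation of the distortion leaves a factor r / (1 + r), which lies between r1 / (1 +
    r1) and 1. *)
Lemma distortion_far r : r1 <= r ->
  r1 / (1 + r1) / (p + L) * tau r <= distortion p phi r <= tau r / e.
Proof.
move=> r1r; have r0 := lt_le_trans r1_gt0 r1r.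
have /andP[h1 h2] := rtail_bounds r1r; have o0 := rweight_gt0 r.
have t0 := rtau_gt0 r1r; have pL : 0 < p + L by rewrite addr_gt0.
have d1 : 0 < 1 + r by rewrite addr_gt0.
have d2 : 0 < 1 + r1 by rewrite addr_gt0.
have D0 : 0 < (1 + r) * om r by rewrite mulr_gt0.
rewrite distortionE ler_pdivlMr// ler_pdivrMr//; apply/andP; split.
  apply: le_trans h1; rewrite [leRHS](_ : _ = r / (1 + r) / (p + L) * tau r * ((1 + r) * om r)).
    rewrite ler_pM2r// ler_pM2r// ler_pM2r ?invr_gt0//.
    rewrite ler_pdivrMr// mulrAC ler_pdivlMr// !mulrDr !mulr1 [r * r1]mulrC; lra.
  by field; rewrite !gt_eqF.
apply: (le_trans h2); rewrite [leRHS](_ : _ = (1 + r) * om r * tau r / e); last by field; rewrite gt_eqF.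
by rewrite ler_pM2r ?invr_gt0// !ler_pM2r//; lra.
Qed.

Lemma rweight_near b : exists2 m, 0 < m & forall r, 0 <= r <= b -> m <= om r.
Proof.
have [h1 _ _] := C2; have [B BP] := hderivable_bounded b h1.
exists (expR (- (p * B))) => [|r rb]; first exact: expR_gt0.
rewrite /rweight ler_expR lerN2 ler_pM2l//; exact: le_trans (ler_norm _) (BP r rb).
Qed.

Lemma distortion_near b : 0 <= b -> exists m M, [/\ 0 < m, 0 < M &
  forall r, 0 <= r <= b -> m <= distortion p phi r <= M].
Proof.
move=> b0; have [k k0 kP] := rweight_near b; have b1 : 0 < 1 + b by rewrite ltr_pwDl.
exists (rtail b / (1 + b)), (rtail 0 / k); split.
- by rewrite divr_gt0 ?rtail_gt0.
- by rewrite divr_gt0 ?rtail_gt0.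
move=> r /[dup] rb /andP[r0 rleb]; have orr := kP r rb; have or1 := rweight_le1 r0.
have r1' : 0 < 1 + r by rewrite ltr_pwDl.
have ogt := rweight_gt0 r.
rewrite distortionE; apply/andP; split.
  apply: ler_pM; rewrite ?invr_ge0 ?(ltW b1) ?(ltW (rtail_gt0 _))//.
    exact: rtail_nonincreasing.
  rewrite lef_pV2 ?posrE ?mulr_gt0// -[leRHS]mulr1.
  by apply: ler_pM => //; [exact: ltW|exact: ltW|lra].
apply: ler_pM; rewrite ?invr_ge0 ?(ltW (rtail_gt0 _)) ?mulr_ge0 ?(ltW r1') ?(ltW ogt)//.
  exact: rtail_nonincreasing.
rewrite lef_pV2 ?posrE ?mulr_gt0// -[leLHS]mul1r.
by apply: ler_pM => //; [exact: ltW|lra].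
Qed.

Lemma measurable_distortion_abs : measurable_fun [set: R] (fun r => distortion p phi `|r|).
Proof.
(* Cut off at 0, the tail is nonincreasing on the whole line, hence measurable; the denominator is
   continuous. *)
pose N r := rtail (Num.max 0 r).
have mN : measurable_fun [set: R] N.
  apply: nonincreasing_measurable => // r s rs; apply: rtail_nonincreasing.
    by rewrite le_max lexx.
  by rewrite ge_max !le_max lexx rs orbT.
have mn : measurable_fun [set: R] (fun r : R => `|r|) by apply: continuous_measurable_fun; exact: norm_continuous.
have -> : (fun r => distortion p phi `|r|) = (fun r => N `|r| / ((1 + `|r|) * om `|r|)).
  by apply/funext => r; rewrite distortionE /N max_r.
apply: measurable_funM; first exact: measurableT_comp.
apply: continuous_measurable_fun => r.
apply: (@continuousV _ _ (fun r => (1 + `|r|) * om `|r|)).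
  by rewrite gt_eqF// mulr_gt0 ?rweight_gt0// ltr_pwDl.
apply: (@continuousM _ _ (fun r => 1 + `|r|)); last exact: continuous_rweight_abs.
by apply: cvgD; [exact: cvg_cst|exact: norm_continuous].
Qed.

Lemma measurable_rweight_abs : measurable_fun [set: R] (fun r => om `|r|).
Proof. by apply: continuous_measurable_fun; exact: continuous_rweight_abs. Qed.

Lemma derive1_shift dl r : r1 <= r ->
  is_derive r (1 : R) (fun r => r + dl * tau r) (1 - dl * (d' r / d r ^+ 2)).
Proof.
move=> r1r; have Dt := is_derive_rtau r1r.
apply: is_derive_eq; rewrite -![_ *: _]/(_ * _) mulrN; ring.
Qed.

Lemma shift_lt dl r s : 0 < dl -> dl * L <= 1 / 2 -> r1 <= r -> r < s ->
  r + dl * tau r < s + dl * tau s.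
Proof.
move=> dl0 dlL r1r rs; have r1s : r1 <= s by apply: le_trans (ltW rs).
have := rtau_lip r1r r1s; rewrite (ger0_norm (_ : 0 <= s - r)) ?subr_ge0 ?(ltW rs)//.
rewrite ler_norml => /andP[h _].
have : dl * - (L * (s - r)) <= dl * (tau s - tau r) by rewrite ler_pM2l.
have : dl * L * (s - r) <= 1 / 2 * (s - r) by rewrite ler_pM2r// subr_gt0.
by rewrite mulrBr; lra.
Qed.

Lemma continuous_shift_deriv dl r : r1 <= r ->
  {for r, continuous (fun r => 1 - dl * (d' r / d r ^+ 2))}.
Proof.
move=> r1r; have r0 := lt_le_trans r1_gt0 r1r; have [d0 _ _ _ _] := data r1r.
apply: cvgB; first exact: cvg_cst.
apply: cvgM; first exact: cvg_cst.
apply: cvgM; first exact: C2_continuous_hderive2.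
apply: cvgV; first by rewrite gt_eqF// exprn_gt0.
have := @continuousM _ _ d d r (continuous_hderive r0) (continuous_hderive r0).
by rewrite /continuous_at (_ : (d \* d) = (fun s => d s ^+ 2))//; apply/funext => x; rewrite expr2.
Qed.

Lemma shift_substitution dl (g : R -> R) (T : R) : 0 < dl -> dl * L <= 1 / 2 -> r1 < T ->
  (forall r, 0 < r -> {for r, continuous g}) ->
  (\int[mu]_(x in `[(r1 + dl * tau r1)%R, (T + dl * tau T)%R]) (g x)%:E =
   \int[mu]_(r in `[r1, T]) (g (r + dl * tau r)%R * (1 - dl * (d' r / d r ^+ 2)))%:E)%E.
Proof.
move=> dl0 dlL r1T cg; pose s r := r + dl * tau r.
have Ds r : r1 <= r -> derive1 s r = 1 - dl * (d' r / d r ^+ 2).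
  by move=> r1r; rewrite derive1E; have [_ ->] := derive1_shift dl r1r.
have cs r : r1 <= r -> {for r, continuous s}.
  move=> r1r; apply: differentiable_continuous; apply/derivable1_diffP.
  by have [] := derive1_shift dl r1r.
have cD r : r1 < r -> {for r, continuous (derive1 s)}.
  move=> r1r; have H := @continuous_shift_deriv dl r (ltW r1r).
  have {}H : (fun r => 1 - dl * (d' r / d r ^+ 2)) @ r --> derive1 s r.
    by rewrite Ds ?(ltW r1r).
  apply: cvg_trans H; apply: near_eq_cvg.
  near=> x; apply/esym/Ds; apply: ltW; near: x.
  exact: (@cvgr_gt _ _ (nbhs r) _ id r).
rewrite -/(s r1) -/(s T) (@integration_by_substitution_increasing _ s g r1 T).
- apply: eq_integral => r; rewrite inE/= in_itv/= => /andP[r1r _].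
  by congr EFin; rewrite -Ds.
- exact: ltW.
- move=> x y; rewrite !in_itv/= => /andP[r1x _] _ xy.
  exact: shift_lt.
- by move=> x; rewrite in_itv/= => /andP[r1x _]; exact: cD.
(* At r1 the formula for the derivative of the shift is available only to the right, hence a
   one-sided limit. *)
- apply/cvg_ex; exists (1 - dl * (d' r1 / d r1 ^+ 2)).
  have := cvg_at_right_filter (@continuous_shift_deriv dl r1 (lexx r1)).
  apply: cvg_trans; apply: near_eq_cvg; near=> x; apply/esym/Ds/ltW; near: x.
  exact: nbhs_right_gt.
- by apply/cvg_ex; exists (derive1 s T); apply: cvg_at_left_filter; exact: cD.
- split.
  + by move=> x; rewrite in_itv/= => /andP[/ltW r1x _]; have [] := derive1_shift dl r1x.
  + by apply: cvg_at_right_filter; apply: cs.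
  + by apply: cvg_at_left_filter; apply: cs; exact: ltW.
- apply: continuous_in_subspaceT => x; rewrite inE/= in_itv/= => /andP[sx _]; apply: cg.
  by apply: lt_le_trans sx; rewrite /s addr_gt0 ?mulr_gt0 ?rtau_gt0.
Unshelve. all: by end_near. Qed.

(** Write A for the integral up to T. Since s(T) >= T, A is at most the integral up to s(T), which
    splits at s(r1). On [s(r1), s(T)] the substitution r -> s(r), the contraction and the hypothesis
    on u return at most th A plus the integral of b. The bound b takes extended values, as the
    integrals of |f'|^p may be infinite. *)
Lemma ray_absorption dl k th (u : R -> R) (b : R -> \bar R) :
  0 < dl -> dl * L <= 1 / 2 -> p * L * dl <= e / 2 -> 0 <= k ->
  (1 + k) * expR (- (dl * e / 2)) <= th ->
  continuous u -> (forall r, 0 <= u r) ->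
  measurable_fun `[r1, +oo[ b -> (forall r, (0 <= b r)%E) ->
  (forall r, r1 <= r -> ((u (r + dl * tau r)%R)%:E <= ((1 + k) * u r)%:E + b r)%E) ->
  ((1 - th)%:E * \int[mu]_(r in `[r1, +oo[) (u r * (r * om r))%:E <=
    \int[mu]_(r in `[r1, (r1 + dl * tau r1)%R]) (u r * (r * om r))%:E +
    \int[mu]_(r in `[r1, +oo[) (b r * (r * om r)%:E))%E.
Proof.
move=> dl0 dlL pL k0 kth cu u0 mb b0 ub; pose q := expR (- (dl * e / 2)).
have q1 : q <= 1 by rewrite /q -expR0 ler_expR oppr_le0 divr_ge0// mulr_ge0 ?ltW.
have q0 : 0 <= q := expR_ge0 _.
pose s r := r + dl * tau r; pose g r := u r * (r * om r).
have cg r : 0 < r -> {for r, continuous g}.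
  move=> r_gt0; apply: cvgM; first exact: cu.
  by apply: cvgM; [exact: cvg_id|exact: continuous_rweight].
have g0 r : 0 <= r -> 0 <= g r.
  by move=> r_ge0; rewrite mulr_ge0// mulr_ge0// ltW// rweight_gt0.
have w0 r : 0 <= r -> 0 <= r * om r by move=> ?; rewrite mulr_ge0// ltW// rweight_gt0.
have mg : measurable_fun `[r1, +oo[ (fun r => (g r)%:E).
  apply/measurable_EFinP; apply: measurable_funM; first by apply: measurable_funTS; exact: continuous_measurable_fun.
  by apply: measurable_tail_integrand; exact: ltW.
have mbw : measurable_fun `[r1, +oo[ (fun r => b r * (r * om r)%:E)%E.
  apply: emeasurable_funM => //; apply/measurable_EFinP.
  by apply: measurable_tail_integrand; exact: ltW.
have sub1 (T : R) : `[r1, T]%classic `<=` `[r1, +oo[%classic.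
  by move=> r /=; rewrite !in_itv/= andbT => /andP[].
set X := (X in (_ <= X)%E).
have X0 : (0 <= X)%E.
  apply: adde_ge0; apply: integral_ge0 => r /=; rewrite in_itv/= ?andbT.
    by move=> /andP[r1r _]; rewrite lee_fin g0// (le_trans _ r1r)// ltW.
  by move=> r1r; rewrite mule_ge0// lee_fin w0// (le_trans _ r1r)// ltW.
have pos r : r1 <= r -> 0 <= r by move=> r1r; rewrite (le_trans _ r1r)// ltW.
(* On a bounded range A is finite, so th A can be moved to the left. *)
have fin T : r1 < T -> ((1 - th)%:E * \int[mu]_(r in `[r1, T]) (g r)%:E <= X)%E.
  move=> r1T.
  have AT : (\int[mu]_(r in `[r1, T]) (g r)%:E)%E \is a fin_num.
    apply: integrable_fin_num => //; apply: continuous_compact_integrable.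
      exact: segment_compact.
    apply: continuous_in_subspaceT => x; rewrite inE/= in_itv/= => /andP[r1x _]; apply: cg.
    exact: lt_le_trans r1x.
  set A := integral _ _ _ in AT *.
  have s1 : r1 <= s r1 by rewrite lerDl mulr_ge0 ?ltW ?rtau_gt0.
  have s2 : s r1 <= s T by apply: ltW; apply: shift_lt.
  have s3 : T <= s T by rewrite lerDl mulr_ge0 ?ltW ?rtau_gt0// ltW.
  have step1 : (A <= \int[mu]_(r in `[r1, s r1]) (g r)%:E + \int[mu]_(r in `[s r1, s T]) (g r)%:E)%E.
    apply: (@le_trans _ _ (\int[mu]_(r in `[r1, s T]) (g r)%:E)%E).
      apply: ge0_subset_integral => //.
      - by apply: measurable_funS mg => //; exact: sub1.
      - by move=> r /=; rewrite in_itv/= => /andP[r1r _]; rewrite lee_fin g0// pos.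
      - by move=> r /=; rewrite !in_itv/= => /andP[-> /le_trans]; exact.
    have E : `[r1, s T]%classic = `[r1, s r1[%classic `|` `[s r1, s T]%classic.
      apply/seteqP; split => r /=; rewrite !in_itv/=.
        by move=> /andP[r1r rT]; case: (ltP r (s r1)) => h; [left; rewrite r1r|right].
      case => /andP[h1 h2]; apply/andP; split => //; last exact: le_trans s1 h1.
      exact: le_trans (ltW h2) s2.
    rewrite E ge0_integral_setU//; last 3 first.
    - by rewrite -E; apply: measurable_funS mg => //; exact: sub1.
    - rewrite -E => r /=; rewrite in_itv/= => /andP[r1r _]; rewrite lee_fin g0// pos//.
    - apply/disj_setPS => r /= []; rewrite !in_itv/= => /andP[_ h1] /andP[h2 _].
      by rewrite (lt_geF h1) in h2.
    rewrite integral_itv_bndo_bndc//; apply: measurable_funS mg => // r /=.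
    by rewrite !in_itv/= andbT => /andP[].
  have step2 : (\int[mu]_(r in `[s r1, s T]) (g r)%:E <= th%:E * A +
      \int[mu]_(r in `[r1, +oo[) (b r * (r * om r)%:E))%E.
    rewrite (shift_substitution dl0 dlL r1T cg).
    pose S r := 1 - dl * (d' r / d r ^+ 2).
    have S0 r : r1 <= r -> 0 <= S r.
      move=> r1r; have [_ _ + _ _] := data r1r; rewrite ler_norml => /andP[_ h].
      have : dl * (d' r / d r ^+ 2) <= dl * L by rewrite ler_pM2l.
      by rewrite /S; lra.
    have spos r : r1 <= r -> r1 <= s r.
      by move=> r1r; rewrite (le_trans r1r)// lerDl mulr_ge0 ?ltW ?rtau_gt0.
    have mbT : measurable_fun `[r1, T] (fun r => q%:E * (b r * (r * om r)%:E))%E.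
      apply: emeasurable_funM; first exact: measurable_cst.
      by apply: measurable_funS mbw => //; exact: sub1.
    have mgT : measurable_fun `[r1, T] (fun r => ((1 + k) * q)%:E * (g r)%:E)%E.
      apply: emeasurable_funM; first exact: measurable_cst.
      by apply: measurable_funS mg => //; exact: sub1.
    have gT0 r : `[r1, T]%classic r -> (0 <= (g r)%:E)%E.
      by rewrite /= in_itv/= => /andP[r1r _]; rewrite lee_fin g0// pos.
    have bT0 r : `[r1, T]%classic r -> (0 <= b r * (r * om r)%:E)%E.
      by rewrite /= in_itv/= => /andP[r1r _]; rewrite mule_ge0// lee_fin w0// pos.
    have kq0 : 0 <= (1 + k) * q by rewrite mulr_ge0// addr_ge0.
    apply: (@le_trans _ _ (\int[mu]_(r in `[r1, T])
        (((1 + k) * q)%:E * (g r)%:E + q%:E * (b r * (r * om r)%:E)))%E).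
      apply: ge0_le_integral => //.
      - move=> r /=; rewrite in_itv/= => /andP[r1r _]; rewrite lee_fin.
        exact: (mulr_ge0 (g0 _ (pos _ (spos _ r1r))) (S0 _ r1r)).
      - apply/measurable_EFinP; apply: subspace_continuous_measurable_fun => //.
        apply: continuous_in_subspaceT => r; rewrite inE/= in_itv/= => /andP[r1r _].
        apply: cvgM; last exact: continuous_shift_deriv.
        apply: (@continuous_comp _ _ _ s g); last by apply: cg; apply: lt_le_trans (spos r r1r).
        apply: differentiable_continuous; apply/derivable1_diffP.
        by have [] := derive1_shift dl r1r.
      - exact: emeasurable_funD.
      - move=> r /=; rewrite in_itv/= => /andP[r1r _]; have r0 := pos _ r1r.
        have c1 : (g (s r) * S r <= u (s r) * (q * (r * om r))).
          by rewrite /g -mulrA ler_wpM2l//; apply: shift_contraction.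
        apply: (@le_trans _ _ ((u (s r))%:E * (q * (r * om r))%:E)%E).
          by rewrite -EFinM lee_fin.
        apply: (@le_trans _ _ ((((1 + k) * u r)%:E + b r) * (q * (r * om r))%:E)%E).
          by apply: lee_wpmul2r; [rewrite lee_fin mulr_ge0// w0|exact: ub].
        rewrite ge0_muleDl//; last by rewrite lee_fin !mulr_ge0// addr_ge0.
        rewrite -!EFinM (EFinM q) muleCA; apply: leeD => //.
        by rewrite lee_fin /g le_eqVlt; apply/predU1P; left; ring.
    rewrite ge0_integralD//; last 2 first.
    - by move=> r rT; apply: mule_ge0; [rewrite lee_fin|exact: gT0].
    - by move=> r rT; apply: mule_ge0; [rewrite lee_fin|exact: bT0].
    apply: leeD.
      rewrite ge0_integralZl_EFin//; last by apply: measurable_funS mg => //; exact: sub1.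
      apply: lee_wpmul2r; last by rewrite lee_fin.
      by apply: integral_ge0.
    apply: (@le_trans _ _ (\int[mu]_(r in `[r1, T]) (b r * (r * om r)%:E))%E).
      rewrite ge0_integralZl_EFin//; last by apply: measurable_funS mbw => //; exact: sub1.
      rewrite -[leRHS]mul1e; apply: lee_wpmul2r; last by rewrite lee_fin.
      by apply: integral_ge0.
    apply: ge0_subset_integral => //.
    by move=> r /=; rewrite in_itv/= andbT => r1r; rewrite mule_ge0// lee_fin w0// pos.
  have step3 : (A <= th%:E * A + X)%E.
    apply: (le_trans step1); apply: le_trans (leeD2l _ step2) _.
    by rewrite /X addeCA.
  rewrite -(fineK AT) -EFinM; rewrite -(fineK AT) in step3; move: step3.
  case: X X0 => [x||]//; last by move=> _ _; rewrite leey.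
  by rewrite -EFinM -EFinD !lee_fin; lra.
(* Monotone convergence along T = r1 + n + 1; the shift by one keeps r1 < T. *)
have E : \bigcup_n `[r1, (r1 + n.+1%:R)%R]%classic = `[r1, +oo[%classic :> set R.
  apply/seteqP; split => [r [n _] /=|r /=]; rewrite !in_itv/= andbT; first by case/andP.
  move=> r1r; exists (Num.truncn (r - r1)) => //=; rewrite in_itv/= r1r/= -lerBlDl.
  by rewrite ltW// truncnS_gt.
have cv : (\int[mu]_(r in `[r1, (r1 + n.+1%:R)%R]) (g r)%:E @[n --> \oo] -->
    \int[mu]_(r in `[r1, +oo[) (g r)%:E)%E.
  rewrite -E; apply: ge0_nondecreasing_set_cvg_integral => //.
  - apply/nondecreasing_seqP => n; apply/subsetPset => r /=; rewrite !in_itv/= => /andP[-> /le_trans].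
    by apply; rewrite lerD2l ler_nat.
  - by move=> n; apply: measurable_funS mg => //; exact: sub1.
  - by move=> n r /=; rewrite in_itv/= => /andP[r1r _]; rewrite lee_fin g0// pos.
have cz : ((1 - th)%:E * \int[mu]_(r in `[r1, (r1 + n.+1%:R)%R]) (g r)%:E @[n --> \oo] -->
    (1 - th)%:E * \int[mu]_(r in `[r1, +oo[) (g r)%:E)%E by exact: cvgeZl.
apply: (cvge_le _ cz); apply: nearW => n; apply: fin.
by rewrite ltrDl.
Qed.

End RadialWeight.

(** * Integration along rays *)

Section SlopeCoordinates.
Context {R : realType}.
Notation mu := (@lebesgue_measure R).
Implicit Types (F H : R * R -> \bar R).

Lemma measurable_ray F (c s : R) : measurable_fun [set: R * R] F ->
  measurable_fun [set: R] (fun r => F (r * c, r * s)).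
Proof.
move=> mF; apply: (measurableT_comp mF).
by apply/measurable_fun_pairP; split; apply: measurable_funM.
Qed.

(** The substitution y = t x on each vertical line, with Jacobian |x|; the line x = 0 is
    negligible. *)
Lemma slope_integral F : measurable_fun [set: R * R] F -> (forall w, (0 <= F w)%E) ->
  (\int[mu \x mu]_w F w = \int[mu]_t \int[mu]_x (`|x|%:E * F (x, t * x)%R))%E.
Proof.
move=> mF F0; have -> : (\int[mu \x mu]_w F w = \int[mu]_x \int[mu]_y F (x, y))%E.
  exact: fubini_tonelli1.
pose H (w : R * R) : \bar R := (`|w.1|%:E * F (w.1, w.2 * w.1)%R)%E.
have H0 w : (0 <= H w)%E by rewrite /H mule_ge0.
have mH : measurable_fun [set: R * R] H.
  apply: emeasurable_funM.
    by apply/measurable_EFinP; apply: measurableT_comp.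
  apply: (measurableT_comp mF); apply/measurable_fun_pairP; split.
    exact: measurable_fst.
  exact: (measurable_funM measurable_snd measurable_fst).
have -> : (\int[mu]_t \int[mu]_x (`|x|%:E * F (x, t * x)%R) = \int[mu]_x \int[mu]_t H (x, t))%E.
  by rewrite (@fubini_tonelli _ _ _ _ _ mu mu H).
have mF1 : measurable_fun [set: R] (fun x => \int[mu]_y F (x, y))%E.
  exact: measurable_fun_fubini_tonelli_F.
have mH1 : measurable_fun [set: R] (fun x => \int[mu]_t H (x, t))%E.
  exact: measurable_fun_fubini_tonelli_F.
have D1 (f : R -> \bar R) : measurable_fun [set: R] f ->
    (\int[mu]_x f x = \int[mu]_(x in [set: R] `\ 0%R) f x)%E.
  by move=> mf; rewrite integral_setD1//; [exact: measurableD|exact: measurable_funTS].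
rewrite /fubini_F (D1 _ mF1) (D1 _ mH1).
apply: eq_integral => x; rewrite inE => -[_ /= /eqP x0].
rewrite (@integral_affine _ _ x 0)//; last by apply: measurableT_comp => //; exact: measurable_pair1.
rewrite -ge0_integralZl//.
- by apply: eq_integral => t _; rewrite /H/= addr0 mulrC.
- apply: (measurableT_comp mF); apply/measurable_fun_pairP; split.
    exact: measurable_cst.
  by apply: measurable_funD => //; apply: measurable_funM.
Qed.

(** A line of slope t consists of two opposite rays, so an inequality on every ray with the polar
    density r can be integrated over the slopes. *)
Lemma polar_le F H : measurable_fun [set: R * R] F -> measurable_fun [set: R * R] H ->
  (forall w, (0 <= F w)%E) -> (forall w, (0 <= H w)%E) ->
  (forall c s : R, c ^+ 2 + s ^+ 2 = 1 ->
    (\int[mu]_(r in `[0%R, +oo[) (r%:E * F (r * c, r * s)%R) <=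
     \int[mu]_(r in `[0%R, +oo[) (r%:E * H (r * c, r * s)%R))%E) ->
  (\int[mu \x mu]_w F w <= \int[mu \x mu]_w H w)%E.
Proof.
move=> mF mH F0 H0 FH; rewrite !slope_integral//.
have mS (K : R * R -> \bar R) : measurable_fun [set: R * R] K -> (forall w, (0 <= K w)%E) ->
    measurable_fun [set: R] (fun t => \int[mu]_x (`|x|%:E * K (x, t * x)%R))%E.
  move=> mK K0.
  pose K' (w : R * R) : \bar R := (`|w.2|%:E * K (w.2, w.1 * w.2)%R)%E.
  apply: (@measurable_fun_fubini_tonelli_F _ _ _ _ _ mu K') => [|w].
    apply: emeasurable_funM.
      by apply/measurable_EFinP; apply: measurableT_comp.
    apply: (measurableT_comp mK); apply/measurable_fun_pairP; split.
      exact: measurable_snd.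
    exact: (measurable_funM measurable_fst measurable_snd).
  by rewrite mule_ge0.
apply: ge0_le_integral => //.
- by move=> t _; apply: integral_ge0 => x _; rewrite mule_ge0.
- exact: mS.
- exact: mS.
move=> t _.
(* (c, s) is the unit vector of slope t. With x = c r the density |x| dx becomes c^2 |r| dr, and c^2
   is the same factor for F and H. *)
pose k := Num.sqrt (1 + t ^+ 2); have k0 : 0 < k by rewrite sqrtr_gt0 ltr_wpDr ?sqr_ge0.
pose c := k^-1; pose s := t / k; have c0 : 0 < c by rewrite invr_gt0.
have cs : c ^+ 2 + s ^+ 2 = 1.
  have k2 : k ^+ 2 = 1 + t ^+ 2 by rewrite sqr_sqrtr// addr_ge0 ?sqr_ge0.
  rewrite /c /s (_ : k^-1 ^+ 2 + (t / k) ^+ 2 = (1 + t ^+ 2) / k ^+ 2).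
    by rewrite k2 divff// gt_eqF// ltr_wpDr ?sqr_ge0.
  by field; rewrite gt_eqF.
have split2 (K : R * R -> \bar R) : measurable_fun [set: R * R] K -> (forall w, (0 <= K w)%E) ->
    (\int[mu]_x (`|x|%:E * K (x, t * x)%R) = (c ^+ 2)%:E *
      (\int[mu]_(r in `[0%R, +oo[) (r%:E * K (r * c, r * s)%R) +
       \int[mu]_(r in `[0%R, +oo[) (r%:E * K (r * - c, r * - s)%R)))%E.
  move=> mK K0.
  have mnorm : measurable_fun [set: R] (fun r : R => `|r|).
    by apply: continuous_measurable_fun; exact: norm_continuous.
  have mr a b : measurable_fun [set: R] (fun r => `|r|%:E * K (r * a, r * b)%R)%E.
    apply: emeasurable_funM; first by apply/measurable_EFinP; exact: mnorm.
    exact: measurable_ray.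
  rewrite (@integral_affine _ _ c 0)//; last 3 first.
  - by rewrite gt_eqF.
  - apply: emeasurable_funM; first by apply/measurable_EFinP; exact: mnorm.
    have := measurable_ray 1 t mK.
    by apply: eq_measurable_fun => x _; rewrite mulr1 mulrC.
  - by move=> x; rewrite mule_ge0.
  have -> : (\int[mu]_x (`|c * x + 0|%:E * K (c * x + 0, t * (c * x + 0))%R) =
      c%:E * \int[mu]_r (`|r|%:E * K (r * c, r * s)%R))%E.
    have mcs := mr c s.
    have pos (r : R) : (0 <= `|r|%:E * K (r * c, r * s)%R)%E by rewrite mule_ge0.
    rewrite -ge0_integralZl_EFin ?(ltW c0)//.
    apply: eq_integral => r _; rewrite addr0 muleA -EFinM normrM (gtr0_norm c0) [c * r]mulrC.
    congr (_ * K (_, _))%E; rewrite /s /c; ring.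
  rewrite (gtr0_norm c0) muleA -EFinM -expr2; congr (_ * _)%E.
  have E : [set: R] = `]-oo, 0[%classic `|` `[0, +oo[%classic.
    apply/seteqP; split => x //= _; rewrite !in_itv/= andbT.
    by case: (ltP x 0) => h; [left|right].
  rewrite E ge0_integral_setU//; last 3 first.
  - by rewrite -E; exact: mr.
  - by move=> r _; rewrite mule_ge0.
  - apply/disj_setPS => x /= []; rewrite !in_itv/= andbT => h1 h2; lra.
  rewrite addeC; congr (_ + _)%E.
    by apply: eq_integral => r; rewrite inE/= in_itv/= andbT => r0; rewrite ger0_norm.
  rewrite integral_itv_bndo_bndc; last exact: measurable_funTS.
  transitivity (\int[mu]_(r in `[0%R, +oo[) (`|r|%:E * K (r * - c, r * - s)%R))%E; last first.
    by apply: eq_integral => r; rewrite inE/= in_itv/= andbT => r0; rewrite ger0_norm.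
  rewrite ge0_integration_by_substitution0//; last by move=> r; rewrite mule_ge0.
  by apply: eq_integral => r _; rewrite normrN !mulrNN.
rewrite (split2 F)// (split2 H)//; apply: lee_wpmul2l; first by rewrite lee_fin sqr_ge0.
by apply: leeD; apply: FH; rewrite ?sqrrN.
Qed.

End SlopeCoordinates.

(** * Averages over squares of variable size *)

Section SquareAverages.
Context {R : realType}.
Notation mu := (@lebesgue_measure R).
Implicit Types (w v : R * R) (a b h rho : R * R -> R) (D : set (R * R)).

Lemma sigma_finite_mu2 : sigma_finite [set: R * R] (mu \x mu)%E.
Proof.
exists (fun n => sq (0, 0) n%:R).
  apply/seteqP; split => // -[x y] _.
  have lt_n : `|x| + `|y| <= (Num.truncn (`|x| + `|y|)).+1%:R by rewrite ltW// truncnS_gt.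
  exists (Num.truncn (`|x| + `|y|)).+1 => //; split; rewrite /= subr0; apply: le_trans lt_n.
    by rewrite lerDl.
  by rewrite lerDr.
by move=> n; split; [exact: measurable_sq|rewrite mu_sq// ltry].
Qed.
(** A name for the product measure, so that it can carry the sigma-finite structure used by
    Tonelli's theorem on pairs of points of the plane. *)
Definition plane_measure : set (measurableTypeR R * measurableTypeR R) -> \bar R := (mu \x mu)%E.
HB.instance Definition _ := Measure.on plane_measure.
HB.instance Definition _ := Measure_isSigmaFinite.Build _ _ _ plane_measure sigma_finite_mu2.

Lemma measurable_ge0_set d (T : measurableType d) (g : T -> R) :
  measurable_fun [set: T] g -> measurable [set z | 0 <= g z].
Proof.
move=> mg; have := mg measurableT `[0, +oo[%classic (measurable_itv _).
by rewrite setTI (_ : _ @^-1` _ = [set z | 0 <= g z])//; apply/seteqP; split => z /=;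
  rewrite in_itv/= andbT.
Qed.

Lemma measurable_sq_rel rho : measurable_fun [set: R * R] rho ->
  measurable [set z : (R * R) * (R * R) | sq z.1 (rho z.1) z.2].
Proof.
move=> mrho.
have m11 : measurable_fun [set: (R * R) * (R * R)] (fun z => z.1.1).
  exact: (measurableT_comp measurable_fst measurable_fst).
have m12 : measurable_fun [set: (R * R) * (R * R)] (fun z => z.1.2).
  exact: (measurableT_comp measurable_snd measurable_fst).
have m21 : measurable_fun [set: (R * R) * (R * R)] (fun z => z.2.1).
  exact: (measurableT_comp measurable_fst measurable_snd).
have m22 : measurable_fun [set: (R * R) * (R * R)] (fun z => z.2.2).
  exact: (measurableT_comp measurable_snd measurable_snd).
have mr : measurable_fun [set: (R * R) * (R * R)] (fun z => rho z.1).
  exact: (measurableT_comp mrho measurable_fst).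
have mn (f : (R * R) * (R * R) -> R) : measurable_fun setT f -> measurable_fun setT (fun z => `|f z|).
  by move=> mf; apply: measurableT_comp.
rewrite (_ : [set z | _] = [set z : (R * R) * (R * R) | 0 <= rho z.1 - `|z.2.1 - z.1.1|] `&`
    [set z : (R * R) * (R * R) | 0 <= rho z.1 - `|z.2.2 - z.1.2|]); last first.
  by apply/seteqP; split => z /=; rewrite /sq/= !subr_ge0.
apply: measurableI; apply: measurable_ge0_set; apply: measurable_funB => //;
  by apply: mn; apply: measurable_funB.
Qed.

Lemma measurable_sq_integral rho h : measurable_fun [set: R * R] rho ->
  measurable_fun [set: R * R] h -> (forall w, 0 <= h w) ->
  measurable_fun [set: R * R] (fun w => \int[mu \x mu]_(v in sq w (rho w)) (h v)%:E)%E.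
Proof.
move=> mrho mh h0; pose S := [set z : (R * R) * (R * R) | sq z.1 (rho z.1) z.2].
pose Phi : (R * R) * (R * R) -> \bar R := (fun z => (h z.2)%:E) \_ S.
have mPhi : measurable_fun [set: (R * R) * (R * R)] Phi.
  apply/(measurable_restrictT _ _).1; first exact: measurable_sq_rel.
  apply: measurable_funTS; apply/measurable_EFinP.
  exact: (measurableT_comp mh measurable_snd).
have Phi0 z : (0 <= Phi z)%E by rewrite /Phi patchE; case: ifP => // _; rewrite lee_fin.
have := @measurable_fun_fubini_tonelli_F _ _ _ _ R plane_measure Phi mPhi Phi0.
apply: eq_measurable_fun => w _; rewrite /fubini_F [RHS]integral_mkcond.
apply: eq_integral => v _; rewrite /Phi !patchE.
by congr (if _ then _ else _); apply/idP/idP; rewrite !inE.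
Qed.

(** After exchanging the integrals, a given v is reached only from points w of the square
    [sq v (rho2 v)], whose area 4 rho2(v)^2 is the factor on the right. *)
Lemma tonelli_average a b h rho rho2 D D' :
  measurable_fun [set: R * R] a -> measurable_fun [set: R * R] b ->
  measurable_fun [set: R * R] h -> measurable_fun [set: R * R] rho ->
  measurable_fun [set: R * R] rho2 -> measurable D -> measurable D' ->
  (forall w, 0 <= a w) -> (forall w, 0 <= b w) -> (forall w, 0 <= h w) ->
  (forall w, 0 <= rho2 w) ->
  (forall w v, D w -> sq w (rho w) v -> [/\ D' v, a w <= b v & sq v (rho2 v) w]) ->
  (\int[mu \x mu]_(w in D) ((a w)%:E * \int[mu \x mu]_(v in sq w (rho w)) (h v)%:E) <=
   \int[mu \x mu]_(v in D') (b v * h v * (4 * rho2 v ^+ 2))%:E)%E.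
Proof.
move=> ma mb mh mr mr2 mD mD' a0 b0 h0 rho0 H.
pose S := [set z : (R * R) * (R * R) | D z.1] `&`
  [set z : (R * R) * (R * R) | sq z.1 (rho z.1) z.2].
have mS : measurable S.
  apply: measurableI; last exact: measurable_sq_rel.
  have := @measurable_fst _ _ (R * R)%type (R * R)%type measurableT D mD.
  by rewrite setTI.
pose Phi : (R * R) * (R * R) -> \bar R := (fun z => (a z.1 * h z.2)%:E) \_ S.
have mPhi : measurable_fun [set: (R * R) * (R * R)] Phi.
  apply/(measurable_restrictT _ _).1 => //.
  apply: measurable_funTS; apply/measurable_EFinP; apply: measurable_funM.
    exact: (measurableT_comp ma measurable_fst).
  exact: (measurableT_comp mh measurable_snd).
have Phi0 z : (0 <= Phi z)%E.
  by rewrite /Phi patchE; case: ifP => // _; rewrite lee_fin mulr_ge0.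
have -> : (\int[mu \x mu]_(w in D) ((a w)%:E * \int[mu \x mu]_(v in sq w (rho w)) (h v)%:E) =
    \int[mu \x mu]_w \int[mu \x mu]_v Phi (w, v))%E.
  rewrite integral_mkcond; apply: eq_integral => w _; rewrite patchE.
  case: ifPn => [|wD]; last first.
    rewrite integral0_eq// => v _; rewrite /Phi patchE ifF//.
    by apply: contraNF wD; rewrite !inE => -[].
  rewrite inE => wD; rewrite -ge0_integralZl_EFin//.
  - rewrite [LHS]integral_mkcond; apply: eq_integral => v _; rewrite /Phi !patchE/=.
    by congr (if _ then _ else _); apply/idP/idP; rewrite !inE => // -[].
  - exact: measurable_sq.
  - by move=> v _; rewrite lee_fin.
  - by apply: measurable_funTS; exact/measurable_EFinP.
rewrite (@fubini_tonelli _ _ _ _ R plane_measure plane_measure Phi mPhi Phi0).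
have mR : measurable_fun [set: R * R] (fun v => (b v * h v * (4 * rho2 v ^+ 2))%:E).
  apply/measurable_EFinP; apply: measurable_funM; first exact: measurable_funM.
  by apply: measurable_funM => //; apply: measurable_funX.
rewrite [leRHS]integral_mkcond; apply: ge0_le_integral => //.
- by move=> v _; apply: integral_ge0 => w _.
- exact: (@measurable_fun_fubini_tonelli_G _ _ _ _ R plane_measure Phi mPhi Phi0).
- by apply/(measurable_restrictT _ _).1 => //; apply: measurable_funTS.
move=> v _; rewrite patchE /fubini_G.
case: ifPn => [|vD]; last first.
  rewrite integral0_eq// => w _; rewrite /Phi patchE ifF//.
  by apply: contraNF vD; rewrite !inE => -[/= Dw /(H w v Dw)[]].
rewrite inE => vD.
apply: (@le_trans _ _ (\int[mu \x mu]_(w in sq v (rho2 v)) (b v * h v)%:E)%E).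
  rewrite [leRHS]integral_mkcond; apply: ge0_le_integral => //.
  - by apply: (measurableT_comp mPhi); exact: measurable_pair2.
  - apply/(measurable_restrictT _ _).1; first exact: measurable_sq.
    by apply: measurable_funTS; exact: measurable_cst.
  - move=> w _; rewrite /Phi !patchE; case: ifPn => [|_].
      rewrite inE => -[/= Dw wv]; have [_ ab ws] := H w v Dw wv.
      by rewrite ifT ?inE// lee_fin ler_wpM2r.
    by case: ifP => // _; rewrite lee_fin mulr_ge0.
rewrite integral_cst//=; last exact: measurable_sq.
by rewrite mu_sq// -EFinM.
Qed.

Definition nrm w : R := cmod (pl w).

Lemma nrm_ge0 w : 0 <= nrm w.
Proof. exact: cmod_ge0. Qed.

Lemma nrmE w : nrm w = Num.sqrt (w.1 ^+ 2 + w.2 ^+ 2).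
Proof. by []. Qed.

Lemma measurable_nrm : measurable_fun [set: R * R] nrm.
Proof.
apply: (@measurable_cmod R id); apply: entire_continuous => z.
exact: derivable_id.
Qed.

Lemma nrm_sq w v r : sq w r v -> `|nrm v - nrm w| <= 2 * r.
Proof.
move=> [h1 h2]; apply: le_trans (cmod_dist _ _) _; apply: le_trans (cmod_ReIm _) _ => /=.
by rewrite /= in h1 h2; lra.
Qed.

Lemma sq_sym w v r : sq w r v -> sq v r w.
Proof. by move=> [h1 h2]; split; rewrite distrC. Qed.

Lemma sq_le w r s : r <= s -> sq w r `<=` sq w s.
Proof. by move=> rs v [h1 h2]; split; [exact: le_trans h1 rs|exact: le_trans h2 rs]. Qed.

Lemma sq_nrm w : sq (0, 0) (nrm w) w.
Proof.
split; rewrite /= subr0; [exact: (Re_cmod (pl w))|exact: (Im_cmod (pl w))].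
Qed.

Lemma nrm_ray (c s r : R) : c ^+ 2 + s ^+ 2 = 1 -> 0 <= r -> nrm (r * c, r * s) = r.
Proof.
move=> cs r0; rewrite nrmE/= !exprMn -mulrDr cs mulr1 sqrtr_sqr ger0_norm//.
Qed.

End SquareAverages.

(** * Powers of an entire function and of its derivative *)

Section PowerBounds.
Context {R : realType}.
Notation mu := (@lebesgue_measure R).
Implicit Types (f : C R -> C R) (w v : R * R) (p k r l : R).

Definition fmod f w : R := cmod (f (pl w)).
Definition dmod f w : R := cmod (derive1 f (pl w)).

Lemma fmod_ge0 f w : 0 <= fmod f w. Proof. exact: cmod_ge0. Qed.
Lemma dmod_ge0 f w : 0 <= dmod f w. Proof. exact: cmod_ge0. Qed.

Lemma measurable_fmod_powR f p : entire f -> measurable_fun [set: R * R] (fun w => fmod f w `^ p).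
Proof.
by move=> ef; apply: measurable_powR_comp; apply: measurable_cmod; exact: entire_continuous.
Qed.

Lemma measurable_dmod_powR f p : entire f -> measurable_fun [set: R * R] (fun w => dmod f w `^ p).
Proof. by move=> ef; apply: measurable_powR_comp; exact: measurable_deriv. Qed.

Lemma subav_fmod_dmod p : 0 < p -> exists2 K, 0 < K & forall f, entire f ->
  subav K (fun w => fmod f w `^ p) /\ subav K (fun w => dmod f w `^ p).
Proof.
move=> p0; have [K K0 KP] := @subav_powR R 4 p (ltr0Sn R 3) p0.
exists K => // f ef; split; apply: KP.
- by move=> w; exact: fmod_ge0.
- by apply: measurable_cmod; exact: entire_continuous.
- exact: (jcont_bounded (jcont_cmod (entire_continuous ef))).
- exact: subav_entire.
- by move=> w; exact: dmod_ge0.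
- exact: measurable_deriv.
- exact: deriv_bounded.
- exact: subav_deriv.
Qed.

Lemma sq_subset w v r s : sq w s v -> sq v r `<=` sq w (r + s).
Proof.
by move=> [h1 h2] z [h3 h4]; split; rewrite /= in h1 h2 h3 h4 *;
  move: h1 h2 h3 h4; rewrite !ler_norml; lra.
Qed.

Lemma le_sq_integral (h : R * R -> R) w v r s t : measurable_fun [set: R * R] h ->
  (forall z, 0 <= h z) -> sq w s v -> r + s <= t ->
  (\int[mu \x mu]_(z in sq v r) (h z)%:E <= \int[mu \x mu]_(z in sq w t) (h z)%:E)%E.
Proof.
move=> mh h0 wv rst; apply: ge0_subset_integral.
- exact: measurable_sq.
- exact: measurable_sq.
- by apply: measurable_funTS; exact/measurable_EFinP.
- by move=> z _; rewrite lee_fin.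
- by apply: subset_trans (sq_subset wv) _; exact: sq_le.
Qed.

Lemma powR_root_le p (x y : R) : 0 < p -> 0 <= x -> x `^ p <= y -> x <= y `^ p^-1.
Proof.
move=> p0 x0 xy; have y0 : 0 <= y by apply: le_trans xy; exact: powR_ge0.
rewrite -[leLHS]powRr1// -(@divff _ p) ?gt_eqF// powRrM.
by apply: ge0_ler_powR; rewrite ?nnegrE ?powR_ge0 ?invr_ge0 ?(ltW p0).
Qed.

Lemma powR_rootK p (y : R) : 0 < p -> 0 <= y -> (y `^ p^-1) `^ p = y.
Proof. by move=> p0 y0; rewrite -powRrM mulVf ?gt_eqF// powRr1. Qed.

(** Either y <= k x or x < y / k, and one of the two terms suffices. This holds for every p > 0,
    with a coefficient of x^p as close to 1 as desired. *)
Lemma power_sum p k (x y : R) : 0 < p -> 0 < k -> 0 <= x -> 0 <= y ->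
  (x + y) `^ p <= (1 + k) `^ p * x `^ p + (1 + k^-1) `^ p * y `^ p.
Proof.
move=> p0 k0 x0 y0; have k1 : 0 <= 1 + k by lra.
have k2 : 0 <= 1 + k^-1 by rewrite addr_ge0// invr_ge0 ltW.
have mono (a b : R) : 0 <= a -> a <= b -> a `^ p <= b `^ p.
  by move=> a0 ab; apply: ge0_ler_powR; rewrite ?nnegrE ?(ltW p0)// (le_trans a0).
have [yx|xy] := leP y (k * x).
  apply: (@le_trans _ _ ((1 + k) `^ p * x `^ p)).
    by rewrite -powRM//; apply: mono; [lra|rewrite mulrDl mul1r; lra].
  by rewrite lerDl mulr_ge0 ?powR_ge0.
apply: (@le_trans _ _ ((1 + k^-1) `^ p * y `^ p)).
  rewrite -powRM//; apply: mono; first lra.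
  by rewrite mulrDl mul1r addrC lerD2l// ler_pdivlMl// ltW.
by rewrite lerDr mulr_ge0 ?powR_ge0.
Qed.

(** Subaveraging at scale r / 2 bounds |f| on the half-size square, with M^p = 4 K i / r^2, and
    Cauchy's estimate there gives |f'| <= 16 M / (r / 2) = 32 M / r. *)
Lemma deriv_power_bound p : 0 < p -> exists2 K, 0 < K & forall f, entire f ->
  forall w r, 0 < r -> ((r ^+ 2 * (r * dmod f w) `^ p)%:E <=
    K%:E * \int[mu \x mu]_(v in sq w r) (fmod f v `^ p)%:E)%E.
Proof.
move=> p0; have [K K0 KP] := subav_fmod_dmod p0.
exists (32 `^ p * (4 * K)) => [|f ef w r r0]; first by rewrite !mulr_gt0// powR_gt0.
have [Kf _] := KP f ef; have mf := measurable_fmod_powR p ef.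
set I := (\int[_]_(v in _) _)%E.
have I0 : (0 <= I)%E by apply: integral_ge0 => v _; rewrite lee_fin powR_ge0.
have c0 : 0 < 32 `^ p * (4 * K) by rewrite !mulr_gt0// powR_gt0.
case IE : I I0 => [i||]//; last by rewrite gt0_muley ?leey.
rewrite -EFinM !lee_fin => i0.
have r2 : 0 < r / 2 by rewrite divr_gt0.
pose M := (4 * K * i / r ^+ 2) `^ p^-1.
have Mb v : sq w (r / 2) v -> fmod f v <= M.
  move=> wv; apply: powR_root_le => //; first exact: fmod_ge0.
  have := Kf v (r / 2) r2.
  have : (K%:E * \int[mu \x mu]_(z in sq v (r / 2)) (fmod f z `^ p)%:E <= (K * i)%:E)%E.
    rewrite (EFinM K) -IE; apply: lee_wpmul2l; first by rewrite lee_fin ltW.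
    by apply: (le_sq_integral mf _ wv) => [z|]; [exact: powR_ge0|lra].
  move=> h1 h2; have := le_trans h2 h1; rewrite lee_fin => h.
  rewrite ler_pdivlMr ?exprn_gt0//.
  have -> : fmod f v `^ p * r ^+ 2 = 4 * ((r / 2) ^+ 2 * fmod f v `^ p) by field.
  by rewrite -mulrA ler_pM2l.
have := cauchy_estimate ef r2 Mb; rewrite -/(dmod f w) => h.
have h' : r * dmod f w <= 32 * M.
  rewrite mulrC -ler_pdivlMr//; apply: (le_trans h).
  by rewrite le_eqVlt; apply/predU1P; left; field; rewrite gt_eqF.
have M0 : 0 <= M by exact: powR_ge0.
have : (r * dmod f w) `^ p <= (32 * M) `^ p.
  by apply: ge0_ler_powR; rewrite ?nnegrE ?mulr_ge0 ?dmod_ge0 ?(ltW p0) ?(ltW r0).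
rewrite (@powRM _ 32 M)// /M powR_rootK//; last by rewrite divr_ge0 ?sqr_ge0// !mulr_ge0// ltW.
move=> h4; apply: (@le_trans _ _ (r ^+ 2 * (32 `^ p * (4 * K * i / r ^+ 2)))).
  by rewrite ler_pM2l// exprn_gt0.
by rewrite le_eqVlt; apply/predU1P; left; field; rewrite gt_eqF.
Qed.

Lemma dmod_sup_bound p : 0 < p -> exists2 K, 0 < K & forall f, entire f ->
  forall w r l i, 0 < l -> (\int[mu \x mu]_(v in sq w (r + l)) (dmod f v `^ p)%:E = i%:E)%E ->
  forall v, sq w r v -> dmod f v <= (K * i / l ^+ 2) `^ p^-1.
Proof.
move=> p0; have [K K0 KP] := subav_fmod_dmod p0.
exists K => // f ef w r l i l0 IE v wv; have [_ Kd] := KP f ef.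
have md := measurable_dmod_powR p ef.
apply: powR_root_le => //; first exact: dmod_ge0.
have : (K%:E * \int[mu \x mu]_(z in sq v l) (dmod f z `^ p)%:E <= (K * i)%:E)%E.
  rewrite (EFinM K) -IE; apply: lee_wpmul2l; first by rewrite lee_fin ltW.
  by apply: (le_sq_integral md _ wv) => [z|]; [exact: powR_ge0|lra].
move=> h1; have := le_trans (Kd v l l0) h1; rewrite lee_fin => h.
by rewrite ler_pdivlMr ?exprn_gt0// mulrC.
Qed.

Lemma fmod_increment f w v M : entire f ->
  (forall t : R, 0 <= t <= 1 -> dmod f (w.1 + t * (v.1 - w.1), w.2 + t * (v.2 - w.2)) <= M) ->
  fmod f v <= fmod f w + 2 * M * (`|v.1 - w.1| + `|v.2 - w.2|).
Proof.
move=> ef dM; have M0 : 0 <= M by apply: le_trans (dM 0 _); [exact: dmod_ge0|lra].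
have H (t : R) : 0 <= t <= 1 ->
    cmod (derive1 f (pl w + (t%:C%C : R[i]) * (pl v - pl w))) <= M.
  move=> t01.
  have -> : pl w + (t%:C%C : R[i]) * (pl v - pl w) =
      pl (w.1 + t * (v.1 - w.1), w.2 + t * (v.2 - w.2)).
    by rewrite /pl/=; congr Complex => /=; ring.
  exact: dM.
have h := cmod_increment ef H.
have h2 : cmod (pl v - pl w) <= `|v.1 - w.1| + `|v.2 - w.2| by exact: le_trans (cmod_ReIm _) _.
have := cmodD (f (pl v) - f (pl w)) (f (pl w)); rewrite subrK -!/(fmod _ _) => h3.
apply: (le_trans h3); rewrite addrC lerD2l; apply: (le_trans h).
by rewrite ler_wpM2l// mulr_ge0.
Qed.

(** The segment from r to r + l stays in the square of half-side l, where subaveraging at scale l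
    bounds |f'|; hence the square of half-side 2 l. The factor (1 + k)^p is what the contraction of
    the weight must beat. *)
Lemma increment_power p k : 0 < p -> 0 < k -> exists2 K, 0 < K & forall f, entire f ->
  forall c s r l, c ^+ 2 + s ^+ 2 = 1 -> 0 < l ->
  ((fmod f ((r + l) * c, (r + l) * s) `^ p)%:E <=
    ((1 + k) `^ p * fmod f (r * c, r * s) `^ p)%:E +
    (K * (l `^ p / l ^+ 2))%:E *
      \int[mu \x mu]_(v in sq (r * c, r * s)%R (2 * l)) (dmod f v `^ p)%:E)%E.
Proof.
move=> p0 k0; have [K K0 KP] := dmod_sup_bound p0.
have k1 : 0 < 1 + k^-1 by rewrite addr_gt0// invr_gt0.
exists ((1 + k^-1) `^ p * 4 `^ p * K); first by rewrite !mulr_gt0// powR_gt0.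
move=> f ef c s r l cs l0; set w := (r * c, r * s).
set I := (\int[_]_(v in _) _)%E.
have I0 : (0 <= I)%E by apply: integral_ge0 => v _; rewrite lee_fin powR_ge0.
have c0 : 0 < (1 + k^-1) `^ p * 4 `^ p * K * (l `^ p / l ^+ 2).
  by apply: mulr_gt0; rewrite ?divr_gt0 ?powR_gt0 ?exprn_gt0// !mulr_gt0 ?powR_gt0.
case IE : I I0 => [i||]//; last by move=> _; rewrite gt0_muley// addey// leey.
rewrite -EFinM -EFinD !lee_fin => i0.
have IE' : (\int[mu \x mu]_(v in sq w (l + l)) (dmod f v `^ p)%:E = i%:E)%E.
  by rewrite -IE /I (_ : l + l = 2 * l)//; ring.
pose M := (K * i / l ^+ 2) `^ p^-1.
have c1 : `|c| <= 1.
  rewrite -(@ler_pXn2r _ 2)// ?nnegrE// real_normK ?num_real// expr1n -cs lerDl sqr_ge0//.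
have s1 : `|s| <= 1.
  rewrite -(@ler_pXn2r _ 2)// ?nnegrE// real_normK ?num_real// expr1n -cs lerDr sqr_ge0//.
have Mb v : sq w l v -> dmod f v <= M by move=> wv; exact: (KP f ef w l l i).
have e1 (x : R) : (r + l) * x - r * x = l * x by ring.
have tl (t x : R) : 0 <= t <= 1 -> `|x| <= 1 -> `|t * (l * x)| <= l.
  move=> /andP[t0 t1] x1; rewrite !normrM (ger0_norm t0) (gtr0_norm l0) -[leRHS]mul1r.
  by apply: ler_pM; rewrite ?mulr_ge0 ?(ltW l0)// -[leRHS]mulr1 ler_pM2l.
have := @fmod_increment f w ((r + l) * c, (r + l) * s) M ef.
rewrite /= !e1 => H; have {H} h : fmod f ((r + l) * c, (r + l) * s) <=
    fmod f w + 2 * M * (`|l * c| + `|l * s|).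
  apply: H => t t01; apply: Mb; split; rewrite /= addrC addKr; exact: tl.
have M0 : 0 <= M by exact: powR_ge0.
have h2 : fmod f ((r + l) * c, (r + l) * s) <= fmod f w + 4 * l * M.
  apply: (le_trans h); rewrite lerD2l.
  have : `|l * c| + `|l * s| <= 2 * l.
    by rewrite !normrM (gtr0_norm l0) -mulrDr mulrC ler_pM2r//; lra.
  move=> h3; apply: (@le_trans _ _ (2 * M * (2 * l))).
    by rewrite ler_wpM2l// mulr_ge0.
  by rewrite le_eqVlt; apply/predU1P; left; ring.
have y0 : 0 <= 4 * l * M by rewrite !mulr_ge0// ltW.
apply: (@le_trans _ _ ((fmod f w + 4 * l * M) `^ p)).
  by apply: ge0_ler_powR; rewrite ?nnegrE ?addr_ge0 ?fmod_ge0 ?(ltW p0).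
apply: le_trans (power_sum p0 k0 (fmod_ge0 _ _) y0) _; rewrite lerD2l.
rewrite !powRM ?mulr_ge0 ?(ltW l0)// /M powR_rootK//; last first.
  by rewrite divr_ge0 ?sqr_ge0// mulr_ge0// ltW.
by rewrite le_eqVlt; apply/predU1P; left; field; rewrite gt_eqF.
Qed.

(** The same increment estimate from the origin, with scale 1: it controls the bounded region, where
    the asymptotic bounds on phi' say nothing. *)
Lemma near_power p b : 0 < p -> 0 < b -> exists2 K, 0 < K & forall f, entire f ->
  forall w, sq (0, 0) b w -> ((fmod f w `^ p)%:E <=
    K%:E * ((fmod f (0, 0) `^ p)%:E +
      \int[mu \x mu]_(v in sq (0, 0)%R (b + 1)) (dmod f v `^ p)%:E))%E.
Proof.
move=> p0 b0; have [K K0 KP] := dmod_sup_bound p0.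
exists (2 `^ p * (1 + (4 * b) `^ p * K)).
  by rewrite mulr_gt0 ?powR_gt0// addr_gt0// mulr_gt0// powR_gt0// mulr_gt0.
move=> f ef w bw; set I := (\int[_]_(v in _) _)%E.
have I0 : (0 <= I)%E by apply: integral_ge0 => v _; rewrite lee_fin powR_ge0.
have c0 : 0 < 2 `^ p * (1 + (4 * b) `^ p * K).
  by rewrite mulr_gt0 ?powR_gt0// addr_gt0// mulr_gt0// powR_gt0// mulr_gt0.
case IE : I I0 => [i||]//; last by move=> _; rewrite addey// gt0_muley// leey.
rewrite -EFinD -EFinM !lee_fin => i0.
pose M := (K * i / 1 ^+ 2) `^ p^-1.
have M0 : 0 <= M by exact: powR_ge0.
have Mb v : sq (0, 0) b v -> dmod f v <= M by move=> bv; exact: (KP f ef (0, 0) b 1 i).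
have [w1 w2] : `|w.1| <= b /\ `|w.2| <= b by move: bw; rewrite /sq/= !subr0.
have h : fmod f w <= fmod f (0, 0) + 2 * M * (`|w.1| + `|w.2|).
  have := @fmod_increment f (0, 0) w M ef; rewrite /= !subr0; apply.
  move=> t /andP[t0 t1]; apply: Mb; split; rewrite /= add0r subr0 normrM (ger0_norm t0).
    by apply: le_trans w1; rewrite ler_piMl.
  by apply: le_trans w2; rewrite ler_piMl.
have h2 : fmod f w <= fmod f (0, 0) + 4 * b * M.
  apply: (le_trans h); rewrite lerD2l (_ : 4 * b * M = 2 * M * (2 * b)); last ring.
  by rewrite ler_wpM2l ?mulr_ge0//; lra.
have y0 : 0 <= 4 * b * M by rewrite !mulr_ge0// ltW.
apply: (@le_trans _ _ ((fmod f (0, 0) + 4 * b * M) `^ p)).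
  by apply: ge0_ler_powR; rewrite ?nnegrE ?addr_ge0 ?fmod_ge0 ?(ltW p0).
apply: le_trans (power_sum p0 ltr01 (fmod_ge0 _ _) y0) _.
rewrite (@powRM _ (4 * b)) ?mulr_ge0 ?(ltW b0)// /M powR_rootK//; last first.
  by rewrite divr_ge0 ?sqr_ge0// mulr_ge0// ltW.
rewrite invr1 expr1n divr1 -mulrDr -mulrA ler_wpM2l ?powR_ge0//.
set A := fmod f (0, 0) `^ p; have A0 : 0 <= A by exact: powR_ge0.
rewrite -subr_ge0 (_ : _ - _ = i + (4 * b) `^ p * (K * A)); last by ring.
by rewrite addr_ge0// mulr_ge0 ?powR_ge0// mulr_ge0// ltW.
Qed.

End PowerBounds.

(** * Norm equivalence *)

Lemma measurable_inv_sqr (R : realType) (g : R * R -> R) : measurable_fun [set: R * R] g ->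
  (forall w, 0 < g w) -> measurable_fun [set: R * R] (fun w => (g w ^+ 2)^-1).
Proof.
move=> mg g0; rewrite (_ : (fun _ => _) = (fun w => g w `^ (-2))).
  exact: measurable_powR_comp.
by apply/funext => w; rewrite powRN powR_mulrn// ltW.
Qed.

Section FockEquivalence.
Context {R : realType} (p : R) (phi : R -> R) (r1 e L : R).
Notation mu := (@lebesgue_measure R).
Implicit Types (w v : R * R) (f : C R -> C R).
Hypothesis p_gt0 : 0 < p.
Hypothesis phi_ge0 : forall r, 0 <= r -> 0 <= phi r.
Hypothesis C2 : C2_halfline phi.
Hypothesis r1_gt0 : 0 < r1.
Hypothesis e_gt0 : 0 < e.
Hypothesis L_gt0 : 0 < L.
Hypothesis data : forall r, r1 <= r ->
  let d := hderive phi r in let d' := hderive (hderive phi) r in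
  [/\ 0 < d, d^-1 <= L * r, `|d' / d ^+ 2| <= L,
      d^-1 / r - d' / d ^+ 2 <= p - e & - L <= d^-1 / r - d' / d ^+ 2].

(** Frozen at its value at r1 inside the disc of radius r1, where phi' may vanish; it is thus
    positive and measurable on the whole plane. *)
Definition ptau w : R := rtau phi (Num.max (nrm w) r1).
Definition pweight w : R := rweight p phi (nrm w).
Definition outer (b : R) := [set w : R * R | b <= nrm w].
Local Notation TT := ptau.
Local Notation OM := pweight.
Local Notation D := (outer (2 * r1)).
Local Notation D1 := (outer r1).

Lemma ptau_gt0 w : 0 < TT w.
Proof. by apply: (rtau_gt0 data); rewrite le_max lexx orbT. Qed.

Lemma ptauE w : r1 <= nrm w -> TT w = rtau phi (nrm w).
Proof. by move=> h; rewrite /ptau max_l. Qed.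

Lemma pweight_gt0 w : 0 < OM w.
Proof. exact: rweight_gt0. Qed.

Lemma pweight_le1 w : OM w <= 1.
Proof. by apply: rweight_le1 => //; exact: nrm_ge0. Qed.

Lemma measurable_ptau : measurable_fun [set: R * R] TT.
Proof.
pose T r := rtau phi (Num.max r r1).
suff cT : continuous T.
  exact: (measurableT_comp (continuous_measurable_fun cT) (@measurable_nrm R)).
move=> x; apply/cvgrPdist_le => k k0; near=> y.
have r1x : r1 <= Num.max x r1 by rewrite le_max lexx orbT.
have r1y : r1 <= Num.max y r1 by rewrite le_max lexx orbT.
apply: le_trans (rtau_lip C2 r1_gt0 data r1y r1x) _.
apply: (@le_trans _ _ (L * `|x - y|)).
  rewrite ler_pM2l//; case: (leP x r1) => hx; case: (leP y r1) => hy; rewrite ler_norml.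
  - by rewrite subrr; have := normr_ge0 (x - y); lra.
  - by have := ler_norm (y - x); rewrite distrC; have := normr_ge0 (x - y); lra.
  - by have := ler_norm (x - y); have := normr_ge0 (x - y); lra.
  - by rewrite -ler_norml.
rewrite -ler_pdivlMl//; near: y.
by apply: (@cvgr_dist_le _ _ _ _ _ id) => //; rewrite mulrC divr_gt0.
Unshelve. all: by end_near. Qed.

Lemma measurable_pweight : measurable_fun [set: R * R] OM.
Proof.
rewrite (_ : OM = (fun r => rweight p phi `|r|) \o nrm).
  exact: (measurableT_comp (measurable_rweight_abs p C2) (@measurable_nrm R)).
by apply/funext => w /=; rewrite ger0_norm// nrm_ge0.
Qed.

Lemma measurable_outer (b : R) : measurable (outer b).
Proof.
have : measurable_fun [set: R * R] (fun w => nrm w - b).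
  by apply: measurable_funB => //; exact: measurable_nrm.
move=> /measurable_ge0_set.
by rewrite (_ : [set z | _] = outer b)//; apply/seteqP;
  split => w; rewrite /outer /= subr_ge0.
Qed.

(** On the square of half-side c tau(w) the scale and the weight are comparable to their values at
    w. The squares then all count points with bounded multiplicity relative to tau^2. The exponent m
    is 0 when f' is bounded by f, and p in the converse. *)
Lemma weighted_average (c m : R) : 0 < c -> 4 * c * L <= 1 / 2 -> 0 <= m ->
  exists2 K, 0 < K & forall h : R * R -> R, measurable_fun [set: R * R] h ->
  (forall w, 0 <= h w) ->
  (\int[mu \x mu]_(w in D) ((TT w `^ m / TT w ^+ 2 * OM w)%:E *
      \int[mu \x mu]_(v in sq w (c * TT w)%R) (h v)%:E) <=
   K%:E * \int[mu \x mu]_(v in D1) (TT v `^ m * OM v * h v)%:E)%E.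
Proof.
move=> c0 cL m0; pose E := expR (p * (2 * (4 * c))).
have E0 : 0 < E by exact: expR_gt0.
exists (2 `^ m * 4 * E * (16 * c ^+ 2)) => [|h mh h0].
  by rewrite !mulr_gt0 ?powR_gt0 ?exprn_gt0.
have mT := measurable_ptau; have mO := measurable_pweight.
have mTm : measurable_fun [set: R * R] (fun w => TT w `^ m).
  exact: measurable_powR_comp.
have mTi : measurable_fun [set: R * R] (fun w => (TT w ^+ 2)^-1).
  by apply: measurable_inv_sqr => // w; exact: ptau_gt0.
have ma : measurable_fun [set: R * R] (fun w => TT w `^ m / TT w ^+ 2 * OM w).
  by apply: measurable_funM => //; apply: measurable_funM.
have mr (k : R) : measurable_fun [set: R * R] (fun w => k * TT w).
  by apply: measurable_funM.
have mb : measurable_fun [set: R * R] (fun w => 2 `^ m * 4 * E * (TT w `^ m / TT w ^+ 2 * OM w)).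
  by apply: measurable_funM.
have a0 w : 0 <= TT w `^ m / TT w ^+ 2 * OM w.
  by rewrite !mulr_ge0 ?powR_ge0 ?invr_ge0 ?sqr_ge0// ltW// pweight_gt0.
have K0 : 0 <= 2 `^ m * 4 * E by rewrite !mulr_ge0 ?powR_ge0 ?(ltW E0).
have := @tonelli_average R _ _ h _ (fun w => 2 * c * TT w) D D1 ma mb mh (mr c) (mr (2 * c))
  (measurable_outer _) (measurable_outer _) a0.
move=> /(_ _ h0 _ _)/le_trans; apply.
- by move=> w; rewrite mulr_ge0.
- by move=> w; rewrite !mulr_ge0// ltW// ptau_gt0.
- move=> w v Dw wv; rewrite /outer/= in Dw.
  have r1_gt0' := r1_gt0; have r1w : r1 <= nrm w by lra.
  have tw : TT w = rtau phi (nrm w) by exact: ptauE.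
  have tw0 := ptau_gt0 w; have tv0 := ptau_gt0 v.
  have twL : TT w <= L * nrm w by rewrite tw; exact: (rtau_le data).
  have d1 := nrm_sq wv.
  (* As tau(w) <= L |w|, the square moves |w| by at most a quarter, so |w| >= 2 r1 keeps its points
     beyond r1. This is why the average goes from [D] to [D1]. *)
  have d2 : 2 * (c * TT w) <= nrm w / 4.
    apply: (@le_trans _ _ (2 * c * (L * nrm w))); first by rewrite mulrA ler_pM2l// mulr_gt0.
    have : 4 * c * L * nrm w <= 1 / 2 * nrm w by rewrite ler_wpM2r// nrm_ge0.
    by lra.
  have r1v : r1 <= nrm v by move: d1; rewrite ler_norml; lra.
  have tv : TT v = rtau phi (nrm v) by exact: ptauE.
  have [t1 t2] : TT w / 2 <= TT v /\ TT v <= 3 / 2 * TT w.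
    rewrite tv tw; apply: (rtau_cmp C2 r1_gt0 L_gt0 data (c := 2 * c)) => //.
    - by rewrite mulr_ge0// ltW.
    - by have := mulr_gt0 c0 L_gt0; move: cL; lra.
    - by rewrite -tw -mulrA.
  have t3 : TT v <= 2 * TT w by apply: (le_trans t2); rewrite ler_pM2r// ler_pdivrMr// -natrM ler_nat.
  have t4 : TT w <= 2 * TT v by rewrite mulrC -ler_pdivrMr.
  (* From tau(w) <= 2 tau(v), w lies in the square of half-side 2 c tau(v) about v, and |w| and |v|
     differ by at most 4 c tau(v); these are the constants 2 c and 4 c. *)
  split; [exact: r1v| |by apply: sq_sym; apply: sq_le wv; rewrite -mulrA (mulrCA 2) ler_pM2l].
  have A1 : TT w `^ m <= 2 `^ m * TT v `^ m.
    have tv0' := ltW tv0.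
    rewrite -powRM//; apply: (ge0_ler_powR m0 _ _ t4); rewrite nnegrE; first exact: ltW.
    by rewrite mulr_ge0.
  have A2 : (TT w ^+ 2)^-1 <= 4 / TT v ^+ 2.
    have : TT v ^+ 2 <= (2 * TT w) ^+ 2 by rewrite lerXn2r ?nnegrE ?mulr_ge0 ?(ltW tv0) ?(ltW tw0).
    rewrite exprMn => H2; rewrite ler_pdivlMr ?exprn_gt0// mulrC ler_pdivrMr ?exprn_gt0//.
    by apply: (le_trans H2); rewrite expr2 -natrM.
  have A3 : OM w <= E * OM v.
    apply: (rweight_cmp p_gt0 C2 r1_gt0 L_gt0 data (c := 4 * c)) => //.
    - by rewrite mulr_ge0// ltW.
    - rewrite -tv distrC; apply: (le_trans d1).
      rewrite (_ : 4 * c * TT v = 2 * (c * (2 * TT v))); last by ring.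
      by rewrite !ler_pM2l.
  apply: (@le_trans _ _ (2 `^ m * TT v `^ m * (4 / TT v ^+ 2) * (E * OM v))).
    have B0 : 0 <= TT w `^ m / TT w ^+ 2 by rewrite mulr_ge0 ?powR_ge0// invr_ge0 sqr_ge0.
    have B1 : 0 <= (TT w ^+ 2)^-1 by rewrite invr_ge0 sqr_ge0.
    exact: (ler_pM B0 (ltW (pweight_gt0 w)) (ler_pM (powR_ge0 _ _) B1 A1 A2) A3).
  by rewrite le_eqVlt; apply/predU1P; left; ring.
rewrite -ge0_integralZl_EFin//; last 4 first.
- exact: measurable_outer.
- by move=> v _; rewrite lee_fin !mulr_ge0 ?powR_ge0// ltW// pweight_gt0.
- apply: measurable_funTS; apply/measurable_EFinP; apply: measurable_funM => //.
  exact: measurable_funM.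
- by apply: mulr_ge0 => //; apply: mulr_ge0 => //; exact: sqr_ge0.
rewrite le_eqVlt; apply/predU1P; left; apply: eq_integral => v _.
rewrite -EFinM; congr EFin; have := ptau_gt0 v; move: (TT v `^ m) (TT v) => t x x0.
by field; rewrite gt_eqF.
Qed.

End FockEquivalence.

(** * The norm equivalence for a general distortion weight *)

Section WeightedEquivalence.
Context {R : realType} (p : R) (phi : R -> R) (r1 e L : R).
Notation mu := (@lebesgue_measure R).
Implicit Types (w v : R * R) (f : C R -> C R).
Hypothesis p_gt0 : 0 < p.
Hypothesis phi_ge0 : forall r, 0 <= r -> 0 <= phi r.
Hypothesis C2 : C2_halfline phi.
Hypothesis r1_gt0 : 0 < r1.
Hypothesis e_gt0 : 0 < e.
Hypothesis L_gt0 : 0 < L.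
Hypothesis data : forall r, r1 <= r ->
  let d := hderive phi r in let d' := hderive (hderive phi) r in
  [/\ 0 < d, d^-1 <= L * r, `|d' / d ^+ 2| <= L,
      d^-1 / r - d' / d ^+ 2 <= p - e & - L <= d^-1 / r - d' / d ^+ 2].

(** [Psi] stands for either weight on f': the distortion function, or 1 / (1 + phi'). Both are
    comparable to 1 / phi' far away and to a positive constant on bounded sets. *)
Context (Psi : R -> R).
Hypothesis measurable_Psi : measurable_fun [set: R] (fun r => Psi `|r|).
Hypothesis Psi_far : exists2 k, 0 < k & forall r, r1 <= r ->
  k^-1 * rtau phi r <= Psi r <= k * rtau phi r.
Hypothesis Psi_near : forall b, 0 <= b -> exists m M, [/\ 0 < m, 0 < M &
  forall r, 0 <= r <= b -> m <= Psi r <= M].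

Local Notation TT := (ptau phi r1).
Local Notation OM := (pweight p phi).
Local Notation D := (outer (2 * r1)).
Local Notation D1 := (outer r1).
Local Notation PS w := (Psi (nrm w)).

Definition fock_integral f : \bar R := (\int[mu \x mu]_w (fmod f w `^ p * OM w)%:E)%E.
Definition deriv_integral f : \bar R :=
  (\int[mu \x mu]_w (dmod f w `^ p * (PS w `^ p * OM w))%:E)%E.
Local Notation FN := fock_integral.
Local Notation DN := deriv_integral.

Lemma Psi_gt0 w : 0 < PS w.
Proof.
have [m [M [m0 _ H]]] := Psi_near (nrm_ge0 w).
by have /andP[h _] := H (nrm w) (introT andP (conj (nrm_ge0 w) (lexx _))); exact: lt_le_trans h.
Qed.

Lemma measurable_PS_powR : measurable_fun [set: R * R] (fun w => PS w `^ p).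
Proof.
apply: measurable_powR_comp.
rewrite (_ : (fun w => PS w) = (fun r => Psi `|r|) \o nrm).
  exact: (measurableT_comp measurable_Psi (@measurable_nrm R)).
by apply/funext => w /=; rewrite ger0_norm// nrm_ge0.
Qed.

Lemma near_integral (m : R) (B : set (R * R)) (g h : R * R -> R) :
  measurable B -> measurable_fun [set: R * R] g -> measurable_fun [set: R * R] h ->
  (forall w, 0 <= g w) -> (forall w, 0 <= h w) -> 0 < m -> (forall w, B w -> m <= g w) ->
  (\int[mu \x mu]_(w in B) (h w)%:E <= m^-1%:E * \int[mu \x mu]_w (h w * g w)%:E)%E.
Proof.
move=> mB mg mh g0 h0 m0 Bg.
have mhg : measurable_fun [set: R * R] (fun w => (h w * g w)%:E).
  by apply/measurable_EFinP; exact: measurable_funM.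
have hg0 w : (0 <= (h w * g w)%:E)%E by rewrite lee_fin mulr_ge0.
apply: (@le_trans _ _ (\int[mu \x mu]_(w in B) (m^-1%:E * (h w * g w)%:E))%E).
  apply: ge0_le_integral => //.
  - by move=> w _; rewrite lee_fin.
  - by apply: measurable_funTS; apply/measurable_EFinP.
  - by apply: measurable_funeM; exact: measurable_funTS.
  - by move=> w Bw; rewrite -EFinM lee_fin ler_pdivlMl// mulrC ler_wpM2l// Bg.
rewrite ge0_integralZl_EFin//; [|exact: measurable_funTS|by rewrite invr_ge0 ltW].
apply: lee_wpmul2l; first by rewrite lee_fin invr_ge0 ltW.
by apply: ge0_subset_integral => //.
Qed.

Lemma integral_le_area (B : set (R * R)) (g : R * R -> R) (x : \bar R) (r : R) :
  measurable B -> measurable_fun [set: R * R] g -> (forall w, 0 <= g w) -> 0 <= r ->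
  B `<=` sq (0, 0) r -> (forall w, sq (0, 0) r w -> ((g w)%:E <= x)%E) ->
  (\int[mu \x mu]_(w in B) (g w)%:E <= x * (4 * r ^+ 2)%:E)%E.
Proof.
move=> mB mg g0 r0 Br gx; have msq := @measurable_sq R (0, 0) r.
have mg' : measurable_fun [set: R * R] (fun w => (g w)%:E) by apply/measurable_EFinP.
apply: (@le_trans _ _ (\int[mu \x mu]_(w in sq (0, 0)%R r) (g w)%:E)%E).
  by apply: ge0_subset_integral => //; [exact: measurable_funTS|move=> w _; rewrite lee_fin].
rewrite -(mu_sq (0, 0) r0) -integral_cst//.
apply: ge0_le_integral => //.
- by move=> w _; rewrite lee_fin.
- exact: measurable_funTS.
Qed.

Lemma near_weights (b : R) : 0 <= b -> exists m M, [/\ 0 < m, 0 < M &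
  forall w, sq (0, 0) b w -> [/\ m <= OM w, m <= PS w `^ p * OM w & PS w `^ p <= M]].
Proof.
move=> b0; have b20 : 0 <= 2 * b by rewrite mulr_ge0.
have [m m0 mP] := rweight_near p_gt0 C2 (2 * b).
have [n [M [n0 M0 nP]]] := Psi_near b20.
exists (Num.min m (n `^ p * m)), (M `^ p); split.
- by rewrite lt_min m0 mulr_gt0// powR_gt0.
- exact: powR_gt0.
move=> w wb; have nw : 0 <= nrm w <= 2 * b.
  rewrite nrm_ge0/=; have := nrm_sq wb; have -> : nrm (0 : R, 0 : R) = 0.
    by rewrite nrmE/= expr0n/= addr0 sqrtr0.
  by rewrite subr0 ger0_norm// nrm_ge0.
have h1 := mP _ nw; have /andP[h2 h3] := nP _ nw.
have h4 : n `^ p <= PS w `^ p.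
  by apply: ge0_ler_powR; rewrite ?nnegrE ?(ltW p_gt0) ?(ltW n0) ?(ltW (Psi_gt0 w)).
split; first by rewrite ge_min h1.
- by rewrite ge_min; apply/orP; right; apply: ler_pM; rewrite ?powR_ge0// ltW.
- by apply: ge0_ler_powR; rewrite ?nnegrE ?(ltW p_gt0) ?(ltW M0) ?(ltW (Psi_gt0 w)).
Qed.

(** The largest c allowed by the condition 4 c L <= 1 / 2 of [weighted_average]. *)
Let cc : R := (8 * L)^-1.

Lemma fock_deriv_le : exists2 K, 0 < K & forall f, entire f ->
  ((fmod f (0, 0)%R `^ p)%:E + DN f <= K%:E * FN f)%E.
Proof.
have c0 : 0 < cc by rewrite invr_gt0 mulr_gt0.
have cL : 4 * cc * L <= 1 / 2.
  by rewrite le_eqVlt; apply/predU1P; left; rewrite /cc; field; rewrite gt_eqF.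
have [KA KA0 HA] := weighted_average p_gt0 C2 r1_gt0 L_gt0 data c0 cL (lexx 0).
have [Kd Kd0 Hd] := deriv_power_bound p_gt0.
have [Ks Ks0 Hs] := subav_fmod_dmod (R := R) p_gt0.
have [k k0 Hk] := Psi_far.
have r20 : 0 <= 2 * r1 by rewrite mulr_ge0// ltW.
have b0 : 0 <= 2 * r1 + 1 by rewrite addr_ge0.
have [m [M [m0 M0 mM]]] := near_weights b0.
(* The constant from Psi <= k tau and from the scale r = cc tau in [deriv_power_bound], whose
   left-hand side carries cc^2 cc^p. *)
pose A := k `^ p / (cc ^+ 2 * cc `^ p).
have A0 : 0 < A by rewrite divr_gt0 ?mulr_gt0 ?powR_gt0// exprn_gt0.
have K10 : 0 < Ks * m^-1 by rewrite divr_gt0.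
have K20 : 0 < M * Kd * m^-1 * (4 * (2 * r1) ^+ 2).
  by rewrite !mulr_gt0 ?invr_gt0// exprn_gt0// mulr_gt0.
have K30 : 0 < A * Kd * KA by exact: mulr_gt0 (mulr_gt0 A0 Kd0) KA0.
exists (Ks * m^-1 + (M * Kd * m^-1 * (4 * (2 * r1) ^+ 2) + A * Kd * KA)) => [|f ef].
  by rewrite !addr_gt0.
have mf := measurable_fmod_powR p ef; have md := measurable_dmod_powR p ef.
have mO := measurable_pweight p C2; have mP := measurable_PS_powR.
have mT := measurable_ptau C2 r1_gt0 L_gt0 data.
have f0 w : 0 <= fmod f w `^ p by exact: powR_ge0.
have O0 w : 0 <= OM w by rewrite ltW// pweight_gt0.
have F0 : (0 <= FN f)%E by apply: integral_ge0 => w _; rewrite lee_fin mulr_ge0.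
have mDN : measurable_fun [set: R * R] (fun w => dmod f w `^ p * (PS w `^ p * OM w)).
  by apply: measurable_funM => //; exact: measurable_funM.
have DN0 w : 0 <= dmod f w `^ p * (PS w `^ p * OM w) by rewrite !mulr_ge0// powR_ge0.
have nearF (B : set (R * R)) : measurable B -> B `<=` sq (0, 0) (2 * r1 + 1) ->
    (\int[mu \x mu]_(w in B) (fmod f w `^ p)%:E <= m^-1%:E * FN f)%E.
  move=> mB Bb; apply: near_integral => // w /Bb bw; by have [] := mM w bw.
rewrite EFinD ge0_muleDl ?lee_fin ?(ltW K10)//; last first.
  by rewrite addr_ge0 ?(ltW K20) ?(ltW K30).
apply: leeD.
  have := (Hs f ef).1 (0, 0) 1 ltr01; rewrite expr1n mul1r => /le_trans; apply.
  rewrite EFinM -muleA; apply: lee_wpmul2l; first by rewrite lee_fin ltW.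
  apply: nearF; first exact: measurable_sq.
  by apply: sq_le; rewrite lerDr.
rewrite EFinD ge0_muleDl ?lee_fin ?(ltW K20) ?(ltW K30)//.
have mD := measurable_outer (R := R) (2 * r1).
have -> : DN f = (\int[mu \x mu]_(w in ~` D) (dmod f w `^ p * (PS w `^ p * OM w))%:E +
    \int[mu \x mu]_(w in D) (dmod f w `^ p * (PS w `^ p * OM w))%:E)%E.
  rewrite -ge0_integral_setU//; last 4 first.
  - exact: measurableC.
  - by rewrite setvU; apply/measurable_EFinP.
  - by move=> w _; rewrite lee_fin.
  - by rewrite disj_set2E setICl.
  by rewrite setvU.
apply: leeD.
  (* In the disc of radius 2 r1 the pointwise estimate at scale 1 is enough, since there the weights
     are bounded above and below. *)
  rewrite EFinM muleAC.
  apply: integral_le_area => //.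
  - exact: measurableC.
  - move=> w; rewrite /outer /= => /negP; rewrite -ltNge => hw.
    by apply: sq_le (sq_nrm w); exact: ltW.
  move=> w hw; have hw' : sq (0, 0) (2 * r1 + 1) w by apply: sq_le hw; rewrite lerDl.
  have [_ _ HM] := mM w hw'.
  apply: (@le_trans _ _ (M%:E * (dmod f w `^ p)%:E)%E).
    rewrite -EFinM lee_fin mulrC ler_wpM2r ?powR_ge0//.
    by apply: le_trans HM; rewrite ler_piMr ?powR_ge0// pweight_le1.
  rewrite EFinM EFinM -!muleA; apply: lee_wpmul2l; first by rewrite lee_fin ltW.
  have := Hd f ef w 1 ltr01; rewrite expr1n !mul1r => /le_trans; apply.
  apply: lee_wpmul2l; first by rewrite lee_fin ltW.
  apply: le_trans (nearF _ (measurable_sq (0, 0) (2 * r1 + 1)) (fun=> id)).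
  by apply: le_sq_integral hw _ => //; rewrite addrC.
have {}HA := HA (fun w => fmod f w `^ p) mf f0.
apply: (@le_trans _ _ ((A * Kd)%:E * (KA%:E * FN f))%E); last by rewrite muleA -EFinM.
have AK0 : 0 <= A * Kd by exact/ltW/mulr_gt0.
apply: (@le_trans _ _ ((A * Kd)%:E * \int[mu \x mu]_(w in D)
    ((TT w `^ 0 / TT w ^+ 2 * OM w)%:E *
      \int[mu \x mu]_(v in sq w (cc * TT w)%R) (fmod f v `^ p)%:E))%E); last first.
  apply: lee_wpmul2l; first by rewrite lee_fin.
  apply: (le_trans HA); apply: lee_wpmul2l; first by rewrite lee_fin ltW.
  apply: (@le_trans _ _ (\int[mu \x mu]_(w in D1) (fmod f w `^ p * OM w)%:E)%E).
    rewrite le_eqVlt; apply/predU1P; left; apply: eq_integral => w _.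
    by rewrite powRr0 mul1r mulrC.
  apply: ge0_subset_integral => //; first exact: measurable_outer.
  - by apply/measurable_EFinP; exact: measurable_funM.
  - by move=> w _; rewrite lee_fin mulr_ge0.
have mI : measurable_fun [set: R * R] (fun w => (TT w `^ 0 / TT w ^+ 2 * OM w)%:E *
      \int[mu \x mu]_(v in sq w (cc * TT w)%R) (fmod f v `^ p)%:E)%E.
  apply: emeasurable_funM.
    apply/measurable_EFinP; apply: measurable_funM => //; apply: measurable_funM => //.
      exact: measurable_powR_comp.
    by apply: measurable_inv_sqr => // w; exact: (ptau_gt0 data).
  apply: measurable_sq_integral => //; exact: measurable_funM.
have I0 w : (0 <= (TT w `^ 0 / TT w ^+ 2 * OM w)%:E *
      \int[mu \x mu]_(v in sq w (cc * TT w)%R) (fmod f v `^ p)%:E)%E.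
  apply: mule_ge0; first by rewrite lee_fin !mulr_ge0 ?powR_ge0// invr_ge0 sqr_ge0.
  by apply: integral_ge0 => v _; rewrite lee_fin.
rewrite -ge0_integralZl_EFin//; last exact: measurable_funTS.
apply: ge0_le_integral => //.
- by move=> w _; rewrite lee_fin.
- by apply: measurable_funTS; apply/measurable_EFinP.
- by apply: measurable_funeM; exact: measurable_funTS.
move=> w; rewrite /outer/= => Dw.
have T0 := ptau_gt0 data w.
have H := Hd f ef w _ (mulr_gt0 c0 T0).
have r1w : r1 <= nrm w by apply: le_trans Dw; rewrite ler_peMl ?(ltW r1_gt0)// ler1n.
have /andP[_ PT] := Hk _ r1w; rewrite -(ptauE phi r1w) in PT.
have PTp : PS w `^ p <= k `^ p * TT w `^ p.
  rewrite -powRM ?(ltW k0) ?(ltW T0)//.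
  by apply: ge0_ler_powR; rewrite ?nnegrE ?(ltW p_gt0) ?(ltW (Psi_gt0 w)) ?mulr_ge0 ?(ltW T0) ?(ltW k0).
set a := TT w `^ 0 / TT w ^+ 2 * OM w.
have a0 : 0 <= a by rewrite !mulr_ge0 ?powR_ge0// invr_ge0 sqr_ge0.
apply: (@le_trans _ _ ((A * a)%:E * ((cc * TT w) ^+ 2 * (cc * TT w * dmod f w) `^ p)%:E)%E); last first.
  have Aa0 : (0 <= (A * a)%:E)%E by rewrite lee_fin; apply: mulr_ge0 => //; exact: ltW.
  have := lee_wpmul2l Aa0 H; set I := (\int[_]_(_ in _) _)%E.
  rewrite (EFinM A a) (EFinM A Kd) => /le_trans; apply; rewrite le_eqVlt; apply/predU1P; left.
  by rewrite -!muleA; congr mule; rewrite muleCA.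
rewrite -EFinM lee_fin !powRM ?mulr_ge0 ?dmod_ge0 ?(ltW c0) ?(ltW T0)//.
apply: (@le_trans _ _ (dmod f w `^ p * ((k `^ p * TT w `^ p) * OM w))).
  by apply: ler_wpM2l; rewrite ?powR_ge0//; apply: ler_wpM2r.
rewrite /a /A powRr0 le_eqVlt; apply/predU1P; left.
have cp : cc `^ p != 0 by rewrite gt_eqF// powR_gt0.
move: (dmod f w `^ p) (k `^ p) (TT w `^ p) (cc `^ p) cp (OM w) => x1 x2 x3 x4 x40 x5.
move: (TT w) T0 cc c0 => t t0 s s0.
by field; rewrite x40 !gt_eqF.
Qed.

(** At a zero of g the power need not be differentiable when p < 1, so continuity is checked there
    through the p-th root of the tolerance. *)
Lemma continuous_powR_comp (g : R -> R) : continuous g -> (forall x, 0 <= g x) ->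
  continuous (fun x => g x `^ p).
Proof.
move=> cg g0 x; have := g0 x; rewrite le_eqVlt => /orP[/eqP gx|gx]; last first.
  apply: (@continuous_comp _ _ _ g (fun y => y `^ p)); first exact: cg.
  apply: differentiable_continuous; apply/derivable1_diffP.
  by apply: derivable_powR; rewrite in_itv/= gx.
apply/cvgrPdist_le => q q0; rewrite -gx powR0 ?gt_eqF//.
have q1 : 0 < q `^ p^-1 by exact: powR_gt0.
move/cvgrPdist_le : (cg x) => /(_ _ q1); apply: filterS => y.
rewrite -gx !sub0r !normrN !ger0_norm ?powR_ge0// => h.
rewrite -(powR_rootK p_gt0 (ltW q0)).
by apply: ge0_ler_powR; rewrite ?nnegrE ?(ltW p_gt0) ?powR_ge0.
Qed.

Lemma continuous_fmod_ray f (c s : R) : entire f -> c ^+ 2 + s ^+ 2 = 1 ->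
  continuous (fun r : R => fmod f (r * c, r * s) `^ p).
Proof.
move=> ef cs.
have [c1 s1] : `|c| <= 1 /\ `|s| <= 1.
  have hc := sqr_ge0 c; have hs := sqr_ge0 s.
  by split; rewrite -(@ler_pXn2r _ 2) ?nnegrE// real_normK ?num_real// expr1n; lra.
apply: (@continuous_powR_comp (fun r => fmod f (r * c, r * s))) => [a|r]; last exact: fmod_ge0.
apply/cvgrPdist_le => q q0.
have [d d0 H] := jcont_cmod (entire_continuous ef) (a * c) (a * s) q0.
near=> r; rewrite distrC; apply: H; rewrite -mulrBl normrM.
  apply: (@le_trans _ _ `|r - a|); first by rewrite ler_piMr.
  by near: r; rewrite near_simpl; under eq_near do rewrite distrC; exact: (@cvgr_dist_le _ _ _ _ _ id).
apply: (@le_trans _ _ `|r - a|); first by rewrite ler_piMr.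
by near: r; rewrite near_simpl; under eq_near do rewrite distrC; exact: (@cvgr_dist_le _ _ _ _ _ id).
Unshelve. all: by end_near. Qed.

Lemma ray_restrict (A : set (R * R)) (B : set R) (F : R * R -> \bar R) (g : R -> \bar R) (c s : R) :
  B `<=` `[0%R, +oo[%classic ->
  (forall r, 0 <= r -> A (r * c, r * s) <-> B r) ->
  (forall r, B r -> F (r * c, r * s) = g r) ->
  (\int[mu]_(r in `[0%R, +oo[) (r%:E * (F \_ A) (r * c, r * s)%R) =
   \int[mu]_(r in B) (r%:E * g r))%E.
Proof.
move=> B0 AB Fg; rewrite -(setIidr B0) integral_mkcondr; apply: eq_integral => r.
rewrite inE/= in_itv/= andbT => r0; rewrite /patch.
have [Br|nBr] := pselect (B r).
  by rewrite !mem_set ?Fg//; apply/AB.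
by rewrite (memNset nBr) (memNset (fun h => nBr ((AB r r0).1 h))) mule0.
Qed.

(** The bound 1 / (16 L) permits squares of half-side 2 dl tau in [weighted_average]; the bound e /
    (2 p L) is the smallness required by [shift_contraction]. In [th], half of the exponent dl e / 2
    of that contraction is kept. *)
Let dl : R := Num.min (16 * L)^-1 (e / (2 * p * L)).
Let th : R := expR (- (dl * e / 4)).
Local Notation R1 := (2 * r1 + dl * rtau phi (2 * r1)).

Lemma dl_gt0 : 0 < dl.
Proof.
by rewrite /dl lt_min; apply/andP; split; [rewrite invr_gt0 mulr_gt0|rewrite divr_gt0// !mulr_gt0].
Qed.

Lemma dl_L : dl * L <= 1 / 16.
Proof.
have : dl <= (16 * L)^-1 by rewrite ge_min lexx.
rewrite -(ler_pM2r L_gt0) => /le_trans; apply; rewrite le_eqVlt; apply/predU1P; left.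
by field; rewrite gt_eqF.
Qed.

Lemma dl_e : p * L * dl <= e / 2.
Proof.
have : dl <= e / (2 * p * L) by rewrite ge_min lexx orbT.
rewrite -(ler_pM2l (mulr_gt0 p_gt0 L_gt0)) => /le_trans; apply; rewrite le_eqVlt; apply/predU1P; left.
by field; rewrite !gt_eqF.
Qed.

Lemma th_lt1 : 0 < 1 - th.
Proof. by rewrite subr_gt0 expR_lt1 oppr_lt0 divr_gt0// mulr_gt0// dl_gt0. Qed.

Local Notation F0 f := (fun w => (fmod f w `^ p * OM w)%:E).
Local Notation Bf K f := (fun w => (K * ((dl * TT w) `^ p / (dl * TT w) ^+ 2))%:E *
      \int[mu \x mu]_(v in sq w (2 * (dl * TT w))%R) (dmod f v `^ p)%:E)%E.
Local Notation ann := ([set: R * R] `&` nrm @^-1` `[2 * r1, R1]%classic).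

(** The ray estimate assembled over all directions. The annulus [ann] is the union of the initial
    segments from 2 r1 to the shifted radius [R1], and [Bf] is the error of [increment_power] for a
    shift dl tau. *)
Lemma radial_absorption : exists2 K, 0 < K & forall f, entire f ->
  (\int[mu \x mu]_(w in D) F0 f w <= (1 - th)^-1%:E *
    (\int[mu \x mu]_(w in ann) F0 f w + \int[mu \x mu]_(w in D) (Bf K f w * (OM w)%:E)))%E.
Proof.
have d0 := dl_gt0; have dL := dl_L; have de := dl_e; have t1 := th_lt1.
(* Chosen so that (1 + kp)^p <= exp(p kp) = exp(dl e / 4); against exp(- dl e / 2) this leaves
   [th]. *)
pose kp := dl * e / (4 * p).
have kp0 : 0 < kp by rewrite divr_gt0 ?mulr_gt0.
have [K K0 HK] := increment_power p_gt0 kp0; exists K => // f ef.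
have r20 : 0 < 2 * r1 by rewrite mulr_gt0.
have r12 : r1 <= 2 * r1 by rewrite ler_peMl ?(ltW r1_gt0)// ler1n.
have data2 r : 2 * r1 <= r -> _ := fun h => data (le_trans r12 h).
have mf := measurable_fmod_powR p ef; have md := measurable_dmod_powR p ef.
have mO := measurable_pweight p C2; have mT := measurable_ptau C2 r1_gt0 L_gt0 data.
have O0 w : 0 <= OM w by rewrite ltW// pweight_gt0.
have mF : measurable_fun [set: R * R] (F0 f) by apply/measurable_EFinP; exact: measurable_funM.
have F00 w : (0 <= F0 f w)%E by rewrite lee_fin mulr_ge0// powR_ge0.
have mdT (a : R) : measurable_fun [set: R * R] (fun w => a * TT w) by exact: measurable_funM.
have mB : measurable_fun [set: R * R] (Bf K f).
  apply: emeasurable_funM; last first.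
    apply: measurable_sq_integral => //; last by move=> w; exact: powR_ge0.
    by apply: measurable_funM => //; exact: mdT.
  apply/measurable_EFinP; apply: measurable_funM => //; apply: measurable_funM => //.
    exact: measurable_powR_comp.
  by apply: measurable_inv_sqr => // w; rewrite mulr_gt0// (ptau_gt0 data).
have B0 w : (0 <= Bf K f w)%E.
  apply: mule_ge0; first by rewrite lee_fin mulr_ge0 ?(ltW K0)// mulr_ge0 ?powR_ge0// invr_ge0 sqr_ge0.
  by apply: integral_ge0 => v _; rewrite lee_fin powR_ge0.
have mBO : measurable_fun [set: R * R] (fun w => Bf K f w * (OM w)%:E)%E.
  by apply: emeasurable_funM => //; exact/measurable_EFinP.
have BO0 w : (0 <= Bf K f w * (OM w)%:E)%E by rewrite mule_ge0// lee_fin.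
have mD := measurable_outer (R := R) (2 * r1).
have mA : measurable ann by apply: measurable_nrm => //; exact: measurable_itv.
have pos (A : set (R * R)) (F : R * R -> \bar R) : (forall w, (0 <= F w)%E) ->
    forall w, (0 <= (F \_ A) w)%E.
  by move=> F_ge0 w; rewrite /patch; case: ifP.
have meas (A : set (R * R)) (F : R * R -> \bar R) : measurable A ->
    measurable_fun [set: R * R] F -> measurable_fun [set: R * R] (F \_ A).
  by move=> ? ?; apply/measurable_restrict => //; exact: measurable_funTS.
have m1 := meas _ _ mA mF; have p1 := pos ann _ F00.
have m2 := meas _ _ mD mBO; have p2 := pos D _ BO0.
rewrite [leLHS]integral_mkcond [X in (_ * (X + _))%E]integral_mkcond
  [X in (_ * (_ + X))%E]integral_mkcond.
have q0 : 0 <= (1 - th)^-1 by rewrite invr_ge0 ltW.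
rewrite -ge0_integralD// -ge0_integralZl_EFin//; last 2 first.
- by move=> w _; apply: adde_ge0.
- exact: emeasurable_funD.
apply: polar_le.
- exact: meas.
- by apply: measurable_funeM; exact: emeasurable_funD.
- exact: pos.
- by move=> w; apply: mule_ge0; [rewrite lee_fin|apply: adde_ge0].
move=> c s cs.
have nr r : 0 <= r -> nrm (r * c, r * s) = r by move=> r0; exact: nrm_ray.
pose u r := fmod f (r * c, r * s) `^ p.
pose b r := Bf K f (r * c, r * s).
have OE r : 0 <= r -> OM (r * c, r * s) = rweight p phi r by move=> r0; rewrite /pweight nr.
have sub1 : `[2 * r1, +oo[%classic `<=` `[0%R, +oo[%classic.
  by move=> r /=; rewrite !in_itv/= !andbT; apply: le_trans; exact: ltW.
have sub2 : `[2 * r1, R1]%classic `<=` `[0%R, +oo[%classic.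
  by move=> r /=; rewrite !in_itv/= !andbT => /andP[+ _]; apply: le_trans; exact: ltW.
have iffD r : 0 <= r -> D (r * c, r * s) <-> `[2 * r1, +oo[%classic r.
  by move=> r0; rewrite /outer /= nr// in_itv/= andbT.
have iffA r : 0 <= r -> ann (r * c, r * s) <-> `[2 * r1, R1]%classic r.
  by move=> r0; rewrite /= nr//; split => [[]|].
rewrite (@ray_restrict D _ (F0 f) (fun r => (u r * rweight p phi r)%:E) _ _ sub1 iffD); last first.
  by move=> r /sub1; rewrite /= in_itv/= andbT => r0; rewrite OE.
have -> : (\int[mu]_(r in `[0%R, +oo[) (r%:E * ((1 - th)^-1%:E *
    ((F0 f \_ ann) (r * c, r * s)%R +
     ((fun w => Bf K f w * (OM w)%:E) \_ D) (r * c, r * s)%R))) =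
  (1 - th)^-1%:E * (\int[mu]_(r in `[0%R, +oo[) (r%:E * (F0 f \_ ann) (r * c, r * s)%R) +
   \int[mu]_(r in `[0%R, +oo[)
     (r%:E * ((fun w => Bf K f w * (OM w)%:E) \_ D) (r * c, r * s)%R)))%E.
  have mray (G : R * R -> \bar R) : measurable_fun [set: R * R] G ->
      measurable_fun (`[0%R, +oo[%classic : set R) (fun r => r%:E * G (r * c, r * s)%R)%E.
    move=> mG; apply: emeasurable_funM; first by apply/measurable_EFinP.
    by apply: measurable_funTS; exact: measurable_ray.
  have pray (G : R * R -> \bar R) : (forall w, 0 <= G w)%E ->
      forall r : R, `[0%R, +oo[%classic r -> (0 <= r%:E * G (r * c, r * s)%R)%E.
    by move=> G0 r; rewrite /= in_itv/= andbT => r0; rewrite mule_ge0// lee_fin.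
  rewrite -ge0_integralD//; [|exact: pray|exact: mray|exact: pray|exact: mray].
  rewrite -ge0_integralZl_EFin//; last 2 first.
  - by move=> r r0; apply: adde_ge0; exact: pray.
  - by apply: emeasurable_funD; exact: mray.
  by apply: eq_integral => r _; rewrite muleCA ge0_muleDr.
rewrite (@ray_restrict ann _ (F0 f) (fun r => (u r * rweight p phi r)%:E) _ _ sub2 iffA); last first.
  by move=> r /sub2; rewrite /= in_itv/= andbT => r0; rewrite OE.
rewrite (@ray_restrict D _ (fun w => Bf K f w * (OM w)%:E)%E
   (fun r => b r * (rweight p phi r)%:E)%E _ _ sub1 iffD); last first.
  by move=> r /sub1; rewrite /= in_itv/= andbT => r0; rewrite OE.
pose k := (1 + kp) `^ p - 1.
have kE : 1 + k = (1 + kp) `^ p by rewrite /k addrC subrK.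
have k0 : 0 <= k.
  rewrite subr_ge0; suff : 1 `^ p <= (1 + kp) `^ p by rewrite powR1.
  apply: ge0_ler_powR; rewrite ?nnegrE ?(ltW p_gt0)//.
    by rewrite addr_ge0// ltW.
  by rewrite lerDl ltW.
have kth : (1 + k) * expR (- (dl * e / 2)) <= th.
  rewrite kE; apply: (@le_trans _ _ (expR (dl * e / 4) * expR (- (dl * e / 2)))).
    rewrite ler_wpM2r ?expR_ge0//.
    rewrite (_ : dl * e / 4 = kp * p); last by rewrite /kp; field; rewrite gt_eqF.
    rewrite expRM; apply: ge0_ler_powR; rewrite ?nnegrE ?(ltW p_gt0) ?expR_ge0//.
      by rewrite addr_ge0// ltW.
    exact: expR_ge1Dx.
  by rewrite -expRD (_ : _ + _ = - (dl * e / 4)) //; field.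
have dL2 : dl * L <= 1 / 2 by apply: (le_trans dL); rewrite ler_pM2l// lef_pV2 ?posrE ?ler_nat.
have H := ray_absorption (p := p) p_gt0 C2 r20 e_gt0 L_gt0 data2 d0 dL2 de k0 kth
  (continuous_fmod_ray ef cs) (fun r => powR_ge0 _ _) (b := b).
have {H} := H _ (fun r => B0 _) _; move/(_ (measurable_funTS (measurable_ray c s mB))) => H.
suff h r : 2 * r1 <= r ->
    ((u (r + dl * rtau phi r))%:E <= ((1 + k) * u r)%:E + b r)%E.
  have {H} := H h => H; rewrite lee_pdivlMl//.
  suff [-> -> ->] : [/\ (\int[mu]_(r in `[(2 * r1)%R, +oo[) (r%:E * (u r * rweight p phi r)%:E) =
        \int[mu]_(r in `[(2 * r1)%R, +oo[) (u r * (r * rweight p phi r))%:E)%E,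
      (\int[mu]_(r in `[(2 * r1)%R, R1]) (r%:E * (u r * rweight p phi r)%:E) =
        \int[mu]_(r in `[(2 * r1)%R, R1]) (u r * (r * rweight p phi r))%:E)%E &
      (\int[mu]_(r in `[(2 * r1)%R, +oo[) (r%:E * (b r * (rweight p phi r)%:E)) =
        \int[mu]_(r in `[(2 * r1)%R, +oo[) (b r * (r * rweight p phi r)%:E))%E] by exact: H.
  split; apply: eq_integral => r _; first by rewrite -EFinM mulrCA.
    by rewrite -EFinM mulrCA.
  by rewrite muleCA EFinM.
move=> hr; have r0 : 0 <= r by apply: le_trans hr; exact: ltW.
have r1r : r1 <= nrm (r * c, r * s) by rewrite nr//; exact: le_trans hr.
have := HK f ef c s r (dl * rtau phi r) cs (mulr_gt0 d0 (rtau_gt0 data (le_trans r12 hr))).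
by rewrite /b /u kE (ptauE phi r1r) nr.
Qed.

Lemma deriv_fock_le : exists2 K, 0 < K & forall f, entire f ->
  (FN f <= K%:E * ((fmod f (0, 0)%R `^ p)%:E + DN f))%E.
Proof.
have d0 := dl_gt0; have dL := dl_L; have t1 := th_lt1.
have [K3 K30 H3] := radial_absorption.
have d20 : 0 < 2 * dl by rewrite mulr_gt0.
have d2L : 4 * (2 * dl) * L <= 1 / 2 by lra.
have [KA KA0 HA] := weighted_average p_gt0 C2 r1_gt0 L_gt0 data d20 d2L (ltW p_gt0).
have [k k0 Hk] := Psi_far.
have r20 : 0 < 2 * r1 by rewrite mulr_gt0.
have r12 : r1 <= 2 * r1 by rewrite ler_peMl ?(ltW r1_gt0)// ler1n.
have R10 : 0 < R1 by rewrite addr_gt0// mulr_gt0// (rtau_gt0 data).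
have [Kn Kn0 Hn] := near_power (R := R) p_gt0 R10.
have R11 : 0 <= R1 + 1 by rewrite addr_ge0// ltW.
have [m [M [m0 M0 mM]]] := near_weights R11.
set x := (1 - th)^-1 in H3; have x0 : 0 < x by rewrite invr_gt0.
have [Cn CnE] : exists Cn, Cn = Kn * (1 + m^-1) by eexists.
have Cn0 : 0 < Cn by rewrite CnE mulr_gt0// addr_gt0// invr_gt0.
have [a aE] : exists a, a = 4 * R1 ^+ 2 by eexists.
have a0 : 0 < a by rewrite aE mulr_gt0// exprn_gt0.
have [y yE] : exists y, y = K3 * (dl `^ p / dl ^+ 2) by eexists.
have y0 : 0 < y by rewrite yE mulr_gt0// divr_gt0 ?powR_gt0// exprn_gt0.
have kp0 : 0 < k `^ p by exact: powR_gt0.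
have z0 : 0 < y * KA * k `^ p by rewrite !mulr_gt0.
exists (Cn * a + x * (Cn * a + y * KA * k `^ p)) => [|f ef].
  by rewrite !(addr_gt0, mulr_gt0).
have mf := measurable_fmod_powR p ef; have md := measurable_dmod_powR p ef.
have mO := measurable_pweight p C2; have mP := measurable_PS_powR.
have mT := measurable_ptau C2 r1_gt0 L_gt0 data.
have O0 w : 0 <= OM w by rewrite ltW// pweight_gt0.
have mF' : measurable_fun [set: R * R] (fun w => fmod f w `^ p * OM w) by exact: measurable_funM.
have mF : measurable_fun [set: R * R] (F0 f) by apply/measurable_EFinP.
have F00' w : 0 <= fmod f w `^ p * OM w by rewrite mulr_ge0// powR_ge0.
have F00 w : (0 <= F0 f w)%E by rewrite lee_fin.
have mPO : measurable_fun [set: R * R] (fun w => PS w `^ p * OM w) by exact: measurable_funM.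
have PO0 w : 0 <= PS w `^ p * OM w by rewrite mulr_ge0// powR_ge0.
have DN0 : (0 <= DN f)%E by apply: integral_ge0 => w _; rewrite lee_fin mulr_ge0// powR_ge0.
set X := (_ + DN f)%E; have X0 : (0 <= X)%E by rewrite adde_ge0// lee_fin powR_ge0.
(* In the bounded region f is controlled by f(0) and by |f'|^p on a slightly larger square, where
   the weights are at least m > 0. *)
have near w : sq (0, 0) R1 w -> ((fmod f w `^ p * OM w)%:E <= Cn%:E * X)%E.
  move=> hw; apply: (@le_trans _ _ (fmod f w `^ p)%:E).
    by rewrite lee_fin ler_piMr ?powR_ge0// pweight_le1.
  apply: (le_trans (Hn f ef w hw)); rewrite CnE EFinM -muleA.
  apply: lee_wpmul2l; first by rewrite lee_fin ltW.
  rewrite EFinD ge0_muleDl ?lee_fin ?invr_ge0 ?(ltW m0)// mul1e.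
  apply: (@le_trans _ _ ((fmod f (0, 0)%R `^ p)%:E + m^-1%:E * DN f)%E).
    apply: leeD => //; apply: near_integral => //; first exact: measurable_sq.
      by move=> v; exact: powR_ge0.
    by move=> v hv; have [] := mM v hv.
  apply: leeD; first by rewrite leeDl.
  by apply: lee_wpmul2l; [rewrite lee_fin invr_ge0 ltW|rewrite leeDr// lee_fin powR_ge0].
have mD := measurable_outer (R := R) (2 * r1).
have mA : measurable ann by apply: measurable_nrm => //; exact: measurable_itv.
have R1sq w : nrm w <= R1 -> sq (0, 0) R1 w by move=> hw; apply: sq_le (sq_nrm w).
have hR1 : 2 * r1 <= R1 by rewrite lerDl mulr_ge0 ?(ltW d0)// ltW// (rtau_gt0 data).
have -> : FN f = (\int[mu \x mu]_(w in ~` D) F0 f w + \int[mu \x mu]_(w in D) F0 f w)%E.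
  rewrite -ge0_integral_setU//; last 3 first.
  - exact: measurableC.
  - by rewrite setvU.
  - by rewrite disj_set2E setICl.
  by rewrite setvU.
rewrite EFinD ge0_muleDl ?lee_fin ?mulr_ge0 ?addr_ge0 ?mulr_ge0 ?(ltW x0) ?(ltW y0) ?(ltW Cn0) ?(ltW a0) ?(ltW KA0) ?(ltW kp0)//.
apply: leeD.
  rewrite EFinM muleAC aE; apply: integral_le_area => //.
  - exact: measurableC.
  - exact: ltW.
  - move=> w; rewrite /outer /= => /negP; rewrite -ltNge => hw.
    by apply: R1sq; exact: le_trans (ltW hw) hR1.
apply: (le_trans (H3 f ef)); rewrite EFinM -muleA.
apply: lee_wpmul2l; first by rewrite lee_fin ltW.
rewrite EFinD ge0_muleDl ?lee_fin ?mulr_ge0 ?(ltW y0) ?(ltW Cn0) ?(ltW a0) ?(ltW KA0) ?(ltW kp0)//.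
apply: leeD.
  rewrite EFinM muleAC aE; apply: integral_le_area => //.
  - exact: ltW.
  - by move=> w /= [_]; rewrite in_itv/= => /andP[_ hw]; exact: R1sq.
(* Beyond 2 r1 only the error term remains: its factor dl^p / dl^2 goes into [y], and the average
   over squares costs [KA], and tau <= k Psi costs k^p. *)
apply: (@le_trans _ _ (y%:E * (KA%:E * ((k `^ p)%:E * DN f)))%E); last first.
  rewrite !muleA -!EFinM; apply: lee_wpmul2l; first by rewrite lee_fin ltW.
  by rewrite leeDr// lee_fin powR_ge0.
have {}HA := HA (fun w => dmod f w `^ p) md (fun w => powR_ge0 _ _).
apply: (@le_trans _ _ (y%:E * \int[mu \x mu]_(w in D)
    ((TT w `^ p / TT w ^+ 2 * OM w)%:E *
      \int[mu \x mu]_(v in sq w (2 * dl * TT w)%R) (dmod f v `^ p)%:E))%E).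
  rewrite -ge0_integralZl_EFin//; last 3 first.
  - move=> w _; apply: mule_ge0; first by rewrite lee_fin !mulr_ge0 ?powR_ge0// invr_ge0 sqr_ge0.
    by apply: integral_ge0 => v _; rewrite lee_fin powR_ge0.
  - apply: measurable_funTS; apply: emeasurable_funM.
      apply/measurable_EFinP; apply: measurable_funM => //; apply: measurable_funM => //.
        exact: measurable_powR_comp.
      by apply: measurable_inv_sqr => // w; exact: (ptau_gt0 data).
    apply: measurable_sq_integral => //; last by move=> w; exact: powR_ge0.
    exact: measurable_funM.
  - exact: ltW.
  rewrite le_eqVlt; apply/predU1P; left; apply: eq_integral => w _.
  have T0 := ptau_gt0 data w; rewrite mulrA; set I := (\int[_]_(_ in _) _)%E.
  rewrite muleAC -EFinM muleA -EFinM; congr (_%:E * _)%E.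
  rewrite yE powRM ?(ltW d0) ?(ltW T0)//.
  move: (TT w `^ p) (dl `^ p) (OM w) => x1 x2 x3; move: (TT w) T0 dl d0 => t t0 s s0.
  by field; rewrite !gt_eqF.
apply: lee_wpmul2l; first by rewrite lee_fin ltW.
apply: (le_trans HA); apply: lee_wpmul2l; first by rewrite lee_fin ltW.
rewrite -ge0_integralZl_EFin//; last 3 first.
- by move=> w _; rewrite lee_fin mulr_ge0// powR_ge0.
- by apply/measurable_EFinP; exact: measurable_funM.
- exact: ltW.
apply: (@le_trans _ _ (\int[mu \x mu]_(w in D1) ((k `^ p)%:E * (dmod f w `^ p * (PS w `^ p * OM w))%:E))%E); last first.
  apply: ge0_subset_integral => //; first exact: measurable_outer.
  - by apply: measurable_funeM; apply/measurable_EFinP; exact: measurable_funM.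
  - by move=> w _; rewrite mule_ge0 ?lee_fin ?(ltW kp0) ?mulr_ge0 ?powR_ge0.
apply: ge0_le_integral => //.
- exact: measurable_outer.
- by move=> w _; rewrite lee_fin !mulr_ge0 ?powR_ge0.
- apply: measurable_funTS; apply/measurable_EFinP; apply: measurable_funM => //.
  by apply: measurable_funM => //; exact: measurable_powR_comp.
- by apply: measurable_funTS; apply: measurable_funeM; apply/measurable_EFinP; exact: measurable_funM.
move=> w; rewrite /outer/= => Dw; rewrite -EFinM lee_fin.
have /andP[PT _] := Hk _ Dw; rewrite -(ptauE phi Dw) ler_pdivrMl// in PT.
have T0 := ptau_gt0 data w.
have PTp : TT w `^ p <= k `^ p * PS w `^ p.
  rewrite -powRM ?(ltW k0) ?(ltW (Psi_gt0 w))//.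
  by apply: ge0_ler_powR; rewrite ?nnegrE ?(ltW p_gt0) ?(ltW T0) ?mulr_ge0 ?(ltW (Psi_gt0 w)) ?(ltW k0).
rewrite (_ : k `^ p * _ = k `^ p * PS w `^ p * OM w * dmod f w `^ p); last by ring.
by rewrite ler_wpM2r ?powR_ge0// ler_wpM2r.
Qed.

Lemma fock_equivalence : asymp_on (@entire R) (fock_normp p phi)
  (fun f => ((cmod (f 0) `^ p)%:E + area_integral (fun z =>
    (cmod (derive1 f z) `^ p * Psi (cmod z) `^ p * expR (- (p * phi (cmod z))))%:E))%E).
Proof.
have [K K0 HK] := fock_deriv_le; have [K' K'0 HK'] := deriv_fock_le.
exists (K + K') => [|f ef]; first exact: addr_gt0.
have EX : fock_normp p phi f = FN f by [].
have -> : ((cmod (f 0) `^ p)%:E + area_integral (fun z =>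
    (cmod (derive1 f z) `^ p * Psi (cmod z) `^ p * expR (- (p * phi (cmod z))))%:E) =
    (fmod f (0, 0) `^ p)%:E + DN f)%E.
  by congr adde; apply: eq_integral => w _; rewrite mulrA.
have F0 : (0 <= FN f)%E.
  by apply: integral_ge0 => w _; rewrite lee_fin mulr_ge0 ?powR_ge0// ltW// pweight_gt0.
have D0 : (0 <= DN f)%E.
  by apply: integral_ge0 => w _; rewrite lee_fin !mulr_ge0 ?powR_ge0// ltW// pweight_gt0.
rewrite EX; split.
  rewrite lee_pdivrMl ?addr_gt0//; apply: (le_trans (HK' f ef)); apply: lee_wpmul2r.
    by rewrite adde_ge0// lee_fin powR_ge0.
  by rewrite lee_fin lerDr ltW.
apply: (le_trans (HK f ef)); apply: lee_wpmul2r => //.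
by rewrite lee_fin lerDl ltW.
Qed.

End WeightedEquivalence.

(** * The two weights *)

Lemma distortion_equivalence (R : realType) (p : R) (phi : R -> R) : 0 < p ->
  (forall r, 0 <= r -> 0 <= phi r) -> C2_halfline phi ->
  (exists2 r0 : R, 0 < r0 & forall r, r0 < r -> hderive phi r != 0) ->
  r * expR (- (p * phi r)) / hderive phi r @[r --> +oo] --> (0 : R) ->
  (limf_esup (fun r : R => (r^-1 * derive1 (fun s => s / hderive phi s) r)%:E) +oo%R
      < p%:E)%E ->
  (-oo < limf_einf (fun r : R => (r^-1 * derive1 (fun s => s / hderive phi s) r)%:E) +oo%R)%E ->
  asymp_on (@entire R) (fock_normp p phi)
    (fun f => ((cmod (f 0) `^ p)%:E + area_integral (fun z =>
      (cmod (derive1 f z) `^ p * distortion p phi (cmod z) `^ p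
         * expR (- (p * phi (cmod z))))%:E))%E)
  /\ (exists2 r1 : R, 0 < r1 & asymp_on [set z : C R | r1 <= cmod z]
       (fun z => (distortion p phi (cmod z))%:E) (fun z => ((hderive phi (cmod z))^-1)%:E)).
Proof.
move=> p0 phi0 C2 nz lim0 lsup linf.
have [r1 [e [L [r10 e0 L0 data]]]] := radial_data p0 phi0 C2 nz lim0 lsup linf.
pose c := r1 / (1 + r1) / (p + L).
have c0 : 0 < c by rewrite !divr_gt0// addr_gt0.
have k0 : 0 < c^-1 + e^-1 by rewrite addr_gt0// invr_gt0.
have far r : r1 <= r -> (c^-1 + e^-1)^-1 * rtau phi r <= distortion p phi r <= (c^-1 + e^-1) * rtau phi r.
  move=> h; have t0 := rtau_gt0 data h.
  have /andP[h1 h2] := distortion_far p0 phi0 C2 r10 e0 L0 data lim0 h.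
  apply/andP; split.
    apply: le_trans h1; rewrite ler_pM2r// -/c -[leRHS]invrK lef_pV2 ?posrE ?invr_gt0//.
    by rewrite lerDl invr_ge0 ltW.
  apply: (le_trans h2); rewrite mulrC ler_pM2r// lerDr invr_ge0 ltW//.
split.
  apply: (fock_equivalence p0 phi0 C2 r10 e0 L0 data).
  - exact: (measurable_distortion_abs p0 phi0 C2 r10 e0 L0 data lim0).
  - by exists (c^-1 + e^-1).
  - exact: (distortion_near p0 phi0 C2 r10 e0 L0 data lim0).
exists r1 => //; exists (c^-1 + e^-1) => // z hz; have /andP[h1 h2] := far _ hz.
rewrite -!EFinM !lee_fin; split; first by rewrite ler_pdivrMl.
by rewrite -ler_pdivrMl.
Qed.

(** * Rapidly increasing functions *)

Section RapidlyIncreasing.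
Context {R : realType}.
Implicit Types (tau phi : R -> R) (r M : R).

Lemma pinfty_small (f : R -> R) (q : R) : f r @[r --> +oo] --> (0 : R) -> 0 < q ->
  exists M, forall r, M < r -> `|f r| <= q.
Proof.
move=> /cvgrPdist_le h q0; have [M [_ HM]] := h _ q0.
by exists M => r /HM; rewrite sub0r normrN.
Qed.

(** The derivative is that of the radial function at (r, 0) in the direction (1, 0), since |h + r| =
    h + r for h near 0. *)
Lemma derivable_profile tau r : 0 < r ->
  (forall w : R * R, differentiable (fun v : R * R => tau (cmod (Complex v.1 v.2)) : R^o) w) ->
  derivable tau r 1.
Proof.
move=> r0 dg; have := @diff_derivable _ _ _ _ (r, 0) (1, 0) (dg (r, 0)).
have cE (x : R) : 0 < x -> cmod (Complex x 0) = x.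
  by move=> x0; rewrite -[cmod _]/(nrm (x, 0)) nrmE/= expr0n/= addr0 sqrtr_sqr gtr0_norm.
move=> /cvg_ex[l cl]; apply/cvg_ex; exists l; apply: cvg_trans cl; apply: near_eq_cvg.
near=> h; have hr : 0 < h + r.
  near: h; exists r => // t /=; rewrite sub0r normrN => /ltr_normlP[t1 _] _; lra.
change (h^-1 *: (tau (cmod (Complex (h * 1 + r) (h * 0 + 0))) - tau (cmod (Complex r 0))) =
  h^-1 *: (tau (h * 1 + r) - tau r)).
by rewrite mulr1 mulr0 addr0 !cE.
Unshelve. all: by end_near. Qed.

(** (r phi')' = r Lap phi > 0, and r phi' tends to 0 at 0. The sign makes 1 + phi' positive on the
    whole half-line. *)
Lemma derive1_ge0_of_radial phi : C2_halfline phi ->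
  (forall r, 0 < r -> 0 < radial_laplacian phi r) ->
  forall r, 0 <= r -> 0 <= hderive phi r.
Proof.
move=> [hp hd cd] lap.
have c0 : continuous (fun r => hderive phi `|r|) by exact: hderivable_abs_continuous.
have mono s r : 0 < s -> s <= r -> s * hderive phi s <= r * hderive phi r.
  move=> s0 sr; apply: (@deriv_le _ (fun x => x * hderive phi x)
    (fun x => x * radial_laplacian phi x)) => // x /andP[sx _].
    have x0 : 0 < x by exact: lt_le_trans sx.
    have dx := hderivable_pos hd x0.
    apply: is_derive_eq; rewrite /radial_laplacian/GRing.scale/= mulr1.
    by field; rewrite gt_eqF.
  have x0 : 0 < x by exact: lt_le_trans sx.
  by rewrite mulr_ge0 ?(ltW x0)// ltW// lap.
have pos r : 0 < r -> 0 <= hderive phi r.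
  move=> r0; rewrite -(pmulr_rge0 _ r0).
  have cl : (fun s => s * hderive phi `|s|) x @[x --> 0^'+] --> (0 : R).
    apply: cvg_at_right_filter; have := @cvgM _ _ (nbhs (0 : R)) _ id _ 0 _ cvg_id (c0 0).
    by rewrite mul0r; exact.
  rewrite -(cvg_lim _ cl)//; apply: limr_le; first exact: cvgP cl.
  near=> s; rewrite /= gtr0_norm//; apply: mono => //.
  by near: s; exact: nbhs_right_le.
move=> r; rewrite le_eqVlt => /orP[/eqP <-|]; last exact: pos.
have cl : (fun s => hderive phi `|s|) x @[x --> 0^'+] --> hderive phi 0.
  have c00 : hderive phi `|x| @[x --> (0 : R)] --> hderive phi `|0 : R| := c0 0.
  by apply: cvg_at_right_filter; rewrite normr0 in c00.
rewrite -(cvg_lim _ cl)//; apply: limr_ge; first exact: cvgP cl.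
near=> s; rewrite /= gtr0_norm//; exact: pos.
Unshelve. all: by end_near. Qed.

Lemma profile_bounds phi tau : (forall r, 0 < r -> 0 < radial_laplacian phi r) ->
  (forall r, 0 <= r -> 0 < tau r) ->
  asymp_on [set r | 1 <= r] (fun r => (tau r)%:E)
    (fun r => ((Num.sqrt (radial_laplacian phi r))^-1)%:E) ->
  exists a b, [/\ 0 < a, 0 < b & forall r, 1 <= r ->
    a <= radial_laplacian phi r * tau r ^+ 2 <= b].
Proof.
move=> lap tau0 [k k0 H]; exists (k^-1 ^+ 2), (k ^+ 2); split; rewrite ?exprn_gt0 ?invr_gt0//.
move=> r r1; have r0 : 0 < r by exact: lt_le_trans r1.
have l0 := lap r r0; have t0 := tau0 r (ltW r0).
have s0 : 0 < Num.sqrt (radial_laplacian phi r) by rewrite sqrtr_gt0.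
have [] := H r r1; rewrite -!EFinM !lee_fin => h1 h2.
rewrite -[X in X * _](sqr_sqrtr (ltW l0)) -exprMn.
set s := Num.sqrt _ in s0 h1 h2 *.
have st0 : 0 <= s * tau r by rewrite mulr_ge0// ltW.
apply/andP; split; rewrite lerXn2r ?nnegrE ?invr_ge0 ?(ltW k0)//.
  by rewrite -[leLHS]mul1r ler_pdivrMr// -mulrA -ler_pdivrMl// mulr1 mulrC.
by move: h1; rewrite -[leRHS]mul1r ler_pdivlMr// -mulrA ler_pdivrMl// mulr1 mulrC.
Qed.

Lemma deriv_profile_bound phi tau : C2_halfline phi ->
  (forall r, 0 < r -> 0 < radial_laplacian phi r) ->
  (forall r, 0 <= r -> 0 < tau r) ->
  (forall w : R * R, differentiable (fun v : R * R => tau (cmod (Complex v.1 v.2)) : R^o) w) ->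
  asymp_on [set r | 1 <= r] (fun r => (tau r)%:E)
    (fun r => ((Num.sqrt (radial_laplacian phi r))^-1)%:E) ->
  tau r @[r --> +oo] --> (0 : R) -> derive1 tau r @[r --> +oo] --> (0 : R) ->
  exists c M, [/\ 0 < c, 1 <= M & forall r, M <= r -> c <= hderive phi r * tau r].
Proof.
move=> [hp hd cd] lap tau0 dtau /(profile_bounds lap tau0)[a [b [a0 b0 Hab]]] lt ldt.
have [M1 H1] := pinfty_small lt ltr01; have [M2 H2] := pinfty_small ldt ltr01.
pose M := Num.max 1 (Num.max M1 M2) + 1.
have MM r : M <= r -> [/\ 1 <= r, 0 < r, tau r <= 1 & `|derive1 tau r| <= 1].
  rewrite /M => hr.
  have [m1 m2 m3] : [/\ 1 <= Num.max 1 (Num.max M1 M2), M1 <= Num.max 1 (Num.max M1 M2) &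
      M2 <= Num.max 1 (Num.max M1 M2)] by rewrite !le_max !lexx !orbT.
  split; [lra|lra| |by apply: H2; lra].
  by apply: le_trans (ler_norm _) _; apply: H1; lra.
(* Once r >= 1 and tau, |tau'| <= 1, tau / r - tau' <= 2. As tau^2 Lap phi >= a, the value c = a / 2
   makes the derivative of [F] nonnegative. *)
pose c := a / 2; have c0 : 0 < c by rewrite divr_gt0.
pose F r := r * hderive phi r - c * (r / tau r).
have mono r : M <= r -> F M <= F r.
  move=> Mr; apply: (@deriv_le _ F (fun r => r * radial_laplacian phi r -
      c * ((tau r)^-1 - r * derive1 tau r / tau r ^+ 2))) => // x /andP[Mx _].
    have [x1 x0 _ _] := MM _ Mx.
    have dx := hderivable_pos hd x0; have t0 := tau0 x (ltW x0).
    have dt : is_derive x 1 tau (derive1 tau x).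
      by rewrite derive1E; apply: derivableP; exact: derivable_profile.
    have t00 : tau x != 0 by rewrite gt_eqF.
    have dti : is_derive x 1 (fun y => (tau y)^-1) (- (tau x) ^- 2 *: derive1 tau x).
      exact: is_deriveV.
    apply: is_derive_eq; rewrite /radial_laplacian/GRing.scale/= !mulr1.
    by field; rewrite !gt_eqF.
  have [x1 x0 tx dtx] := MM _ Mx; have t0 := tau0 x (ltW x0).
  have /andP[h _] := Hab x x1.
  rewrite (_ : _ - _ = x / tau x ^+ 2 * (radial_laplacian phi x * tau x ^+ 2 -
     c * (tau x / x - derive1 tau x))); last by field; rewrite !gt_eqF.
  rewrite mulr_ge0 ?divr_ge0 ?sqr_ge0 ?(ltW x0)// subr_ge0; apply: le_trans h.
  have tx1 : tau x / x <= 1 by rewrite ler_pdivrMr// mul1r (le_trans tx).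
  have : tau x / x - derive1 tau x <= 2.
    by move: dtx; rewrite ler_norml => /andP[d1 _]; lra.
  by rewrite -(ler_pM2l c0) /c => h2; apply: (le_trans h2); lra.
pose B := `|F M|; have B0 : 0 <= B by exact: normr_ge0.
(* When (B + 1) tau <= c / 2, r phi' tau >= c r - B tau >= c r / 2 for r >= 1; this absorbs the
   initial value of [F]. *)
have q0 : 0 < c / 2 / (B + 1) by rewrite !divr_gt0// ltr_wpDl.
have [M3 H3] := pinfty_small lt q0.
exists (c / 2), (Num.max M (Num.max 1 (M3 + 1))); split; rewrite ?divr_gt0 ?le_max ?lexx ?orbT//.
move=> r; rewrite !ge_max => /and3P[h1 h2 h3].
have [r1 r0 _ _] := MM _ h1; have t0 := tau0 r (ltW r0).
have H := mono r h1.
have t3 : tau r <= c / 2 / (B + 1) by apply: le_trans (ler_norm _) _; apply: H3; lra.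
have FB : - B <= F M by rewrite /B lerNl -normrN ler_norm.
have h4 : c * (r / tau r) - B <= r * hderive phi r by move: H FB; rewrite /F; lra.
rewrite -(ler_pM2l r0).
have h5 : (c * (r / tau r) - B) * tau r <= r * hderive phi r * tau r by rewrite ler_pM2r.
rewrite [leRHS]mulrA; apply: le_trans h5.
rewrite (_ : _ * tau r = c * r - B * tau r); last by field; rewrite gt_eqF.
have h6 : (B + 1) * tau r <= c / 2.
  by rewrite mulrC -ler_pdivlMr// ltr_wpDl.
have h7 : c / 2 <= c / 2 * r by rewrite ler_peMr// ltW// divr_gt0.
by lra.
Qed.

(** phi' >= 1 gives phi(r) >= r - M, and exp(p r) >= (p r / 2)^2 then bounds the ratio by A / r. *)
Lemma weight_ratio_cvg0 (p : R) phi M : 0 < p -> (forall r, 0 <= r -> 0 <= phi r) ->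
  C2_halfline phi -> 0 < M -> (forall r, M <= r -> 1 <= hderive phi r) ->
  r * expR (- (p * phi r)) / hderive phi r @[r --> +oo] --> (0 : R).
Proof.
move=> p0 phi0 [hp hd cd] M0 HM.
have key r : M <= r -> r - M <= phi r.
  move=> Mr; have h : phi M - M <= phi r - r.
    apply: (@deriv_le _ (fun x => phi x - x) (fun x => hderive phi x - 1)) => // x /andP[Mx _].
      have dx := hderivable_pos hp (lt_le_trans M0 Mx).
      exact: is_deriveB.
    by rewrite subr_ge0 HM.
  by have := phi0 M (ltW M0); lra.
pose A := expR (p * M) * (4 / p ^+ 2).
have A0 : 0 < A by rewrite mulr_gt0 ?expR_gt0// divr_gt0// exprn_gt0.
apply/cvgrPdist_le => q q0; near=> r.
have Mr : M <= r by near: r; apply: nbhs_pinfty_ge; rewrite num_real.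
have r0 : 0 < r by exact: lt_le_trans Mr.
have d1 := HM r Mr; have d0 : 0 < hderive phi r by exact: lt_le_trans d1.
have v0 : 0 <= r * expR (- (p * phi r)) / hderive phi r.
  by rewrite divr_ge0 ?(ltW d0)// mulr_ge0 ?(ltW r0)// expR_ge0.
rewrite sub0r normrN ger0_norm//.
apply: (@le_trans _ _ (A / r)); last first.
  rewrite ler_pdivrMr// -ler_pdivrMl//.
apply: (@le_trans _ _ (r * expR (- (p * phi r)))).
  by rewrite ler_pdivrMr// ler_peMr// mulr_ge0 ?(ltW r0)// expR_ge0.
apply: (@le_trans _ _ (r * (expR (p * M) * expR (- (p * r))))).
  rewrite ler_pM2l// -expRD ler_expR.
  by have := key r Mr; rewrite -(ler_pM2l p0); lra.
have e1 : p * r / 2 <= expR (p * r / 2).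
  by apply: le_trans (expR_ge1Dx _); rewrite lerDr.
have e2 : (p * r / 2) ^+ 2 <= expR (p * r).
  rewrite (_ : expR (p * r) = expR (p * r / 2) ^+ 2); last first.
    by rewrite expr2 -expRD; congr expR; lra.
  by rewrite lerXn2r// nnegrE ?expR_ge0// !mulr_ge0 ?(ltW p0) ?(ltW r0).
rewrite /A expRN mulrCA -!mulrA ler_pM2l ?expR_gt0//.
rewrite ler_pdivrMr ?expR_gt0//.
apply: (@le_trans _ _ (4 * ((p ^+ 2)^-1 * r^-1) * (p * r / 2) ^+ 2)).
  by rewrite le_eqVlt; apply/predU1P; left; field; rewrite !gt_eqF.
by rewrite ler_pM2l// !mulr_gt0// invr_gt0 ?exprn_gt0.
Unshelve. all: by end_near. Qed.

Lemma rapidly_increasing_data (p : R) phi : 0 < p -> rapidly_increasing phi ->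
  exists r1 e L : R, [/\ 0 < r1, 0 < e, 0 < L & forall r, r1 <= r ->
    1 <= hderive phi r /\
    let d := hderive phi r in let d' := hderive (hderive phi) r in
    [/\ 0 < d, d^-1 <= L * r, `|d' / d ^+ 2| <= L,
        d^-1 / r - d' / d ^+ 2 <= p - e & - L <= d^-1 / r - d' / d ^+ 2]].
Proof.
move=> p0 [phi0 C2 lap [tau [[tau0 dtau _ asy] [_ lt ldt _]]]].
have [hp hd cd] := C2.
have [c [M [c0 M1 HM]]] := deriv_profile_bound C2 lap tau0 dtau asy lt ldt.
have [a [b [a0 b0 Hab]]] := profile_bounds lap tau0 asy.
have [M2 H2] := pinfty_small lt c0.
(* Beyond M2, tau <= c and so phi' >= 1; r >= 4 / p makes 2 / (r phi') at most p / 2, below the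
   required p. *)
pose N := Num.max M (Num.max (M2 + 1) (4 / p)).
have HN r : N <= r -> [/\ 1 <= r, 0 < r, 1 <= hderive phi r, c <= hderive phi r * tau r & 4 / p <= r].
  rewrite /N !ge_max => /and3P[h1 h2 h3].
  have r1 : 1 <= r by exact: le_trans h1.
  have r0 : 0 < r by exact: lt_le_trans r1.
  have h := HM r h1; split => //.
  have t0 := tau0 r (ltW r0).
  have tc : tau r <= c by apply: le_trans (ler_norm _) _; apply: H2; lra.
  by rewrite -(ler_pM2r t0) mul1r (le_trans tc).
have N0 : 0 < N by rewrite /N lt_max (lt_le_trans ltr01 M1).
have lim0 := weight_ratio_cvg0 p0 phi0 C2 N0 (fun r h => let: And5 _ _ h3 _ _ := HN r h in h3).
have dq r : N < r -> r^-1 * derive1 (fun s => s / hderive phi s) r =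
    2 / (r * hderive phi r) - radial_laplacian phi r / hderive phi r ^+ 2.
  move=> /ltW/HN[_ r0 d1 _ _]; have d0 : 0 < hderive phi r by exact: lt_le_trans d1.
  have dn : hderive phi r != 0 by rewrite gt_eqF.
  have D := derive1_hderive_quot C2 r0 dn; rewrite derive1E (@derive_val _ _ _ _ _ _ _ D).
  by rewrite /radial_laplacian; field; rewrite dn gt_eqF.
have nz : exists2 r0 : R, 0 < r0 & forall r, r0 < r -> hderive phi r != 0.
  exists N => // r /ltW/HN[_ _ d1 _ _]; rewrite gt_eqF//; exact: lt_le_trans d1.
have lsup : (limf_esup (fun r : R => (r^-1 * derive1 (fun s => s / hderive phi s) r)%:E) +oo%R < p%:E)%E.
  apply: (@le_lt_trans _ _ (p / 2)%:E); last by rewrite lte_fin ltr_pdivrMr// ltr_pMr// ltr1n.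
  apply: (@limf_esup_le _ _ _ N) => r Nr; rewrite dq//.
  have [_ r0 d1 _ h4] := HN r (ltW Nr); have d0 : 0 < hderive phi r by exact: lt_le_trans d1.
  have l0 : 0 <= radial_laplacian phi r / hderive phi r ^+ 2.
    by rewrite divr_ge0 ?sqr_ge0// ltW// lap.
  apply: (@le_trans _ _ (2 / (r * hderive phi r))); first by rewrite gerBl.
  rewrite ler_pdivrMr ?mulr_gt0//.
  move: h4; rewrite ler_pdivrMr// => h4.
  by have : r * p <= r * hderive phi r * p; [rewrite ler_pM2r// ler_peMr// ltW|lra].
have linf : (-oo < limf_einf (fun r : R => (r^-1 * derive1 (fun s => s / hderive phi s) r)%:E) +oo%R)%E.
  apply: (@limf_einf_bounded _ _ (b / c ^+ 2) N) => r Nr; rewrite dq//.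
  have [r1 r0 d1 h3 _] := HN r (ltW Nr); have d0 : 0 < hderive phi r by exact: lt_le_trans d1.
  have t0 := tau0 r (ltW r0).
  have q0 : 0 <= 2 / (r * hderive phi r) by rewrite divr_ge0// mulr_ge0 ?(ltW r0) ?(ltW d0).
  suff : radial_laplacian phi r / hderive phi r ^+ 2 <= b / c ^+ 2 by lra.
  have /andP[_ h] := Hab r r1.
  rewrite ler_pdivlMr ?exprn_gt0// mulrAC ler_pdivrMr ?exprn_gt0//.
  apply: (@le_trans _ _ (radial_laplacian phi r * (hderive phi r * tau r) ^+ 2)).
    rewrite ler_pM2l ?lap// lerXn2r ?nnegrE ?(ltW c0)//.
    by rewrite mulr_ge0 ?(ltW d0) ?(ltW t0).
  by rewrite exprMn mulrCA mulrC ler_pM2r ?exprn_gt0.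
have [r1 [e [L [r10 e0 L0 data]]]] := radial_data p0 phi0 C2 nz lim0 lsup linf.
exists (Num.max r1 N), e, L; split => //; first by rewrite lt_max r10.
move=> r; rewrite ge_max => /andP[h1 /HN[_ _ h2 _ _]]; split => //; exact: data.
Qed.

Lemma rapid_equivalence (p : R) phi : 0 < p -> rapidly_increasing phi ->
  asymp_on (@entire R) (fock_normp p phi)
    (fun f => ((cmod (f 0) `^ p)%:E + area_integral (fun z =>
      (cmod (derive1 f z) `^ p * expR (- (p * phi (cmod z)))
         / (1 + hderive phi (cmod z)) `^ p)%:E))%E).
Proof.
move=> p0 ri; have [phi0 C2 lap _] := ri; have [hp hd cd] := C2.
have [r1 [e [L [r10 e0 L0 data0]]]] := rapidly_increasing_data p0 ri.
have data r (h : r1 <= r) := (data0 r h).2.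
have dge0 := derive1_ge0_of_radial C2 lap.
have d1 r : 0 <= r -> 0 < 1 + hderive phi r by move=> r0; rewrite ltr_pwDl// dge0.
pose E2 (f : C R -> C R) : \bar R := ((cmod (f 0) `^ p)%:E + area_integral (fun z =>
  (cmod (derive1 f z) `^ p * (1 + hderive phi (cmod z))^-1 `^ p *
     expR (- (p * phi (cmod z))))%:E))%E.
suff [k k0 Hk] : asymp_on (@entire R) (fock_normp p phi) E2.
  exists k => // f ef; have := Hk f ef; cbv beta.
  suff -> : E2 f = ((cmod (f 0) `^ p)%:E + area_integral (fun z =>
      (cmod (derive1 f z) `^ p * expR (- (p * phi (cmod z)))
         / (1 + hderive phi (cmod z)) `^ p)%:E))%E by [].
  congr adde; rewrite /area_integral; apply: eq_integral => w _.
  congr EFin; rewrite -mulrA [X in _ * X]mulrC mulrA; congr (_ * _).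
  set x := 1 + _; have x0 : 0 < x by rewrite d1// nrm_ge0.
  by rewrite -powR_inv1 ?(ltW x0)// powRAC powR_inv1// powR_ge0.
apply: (fock_equivalence (Psi := fun r => (1 + hderive phi r)^-1) p0 phi0 C2 r10 e0 L0 data).
- apply: continuous_measurable_fun => x.
  apply: cvgV; first by rewrite gt_eqF// d1.
  by apply: cvgD; [exact: cvg_cst|exact: (hderivable_abs_continuous hd)].
(* phi' >= 1 gives phi' <= 1 + phi' <= 2 phi'. *)
- exists 2 => // r hr; have [d_1 [d0 _ _ _ _]] := data0 r hr.
  rewrite /rtau -invfM !lef_pV2 ?posrE ?mulr_gt0 ?addr_gt0 //.
  apply/andP; split; first by lra.
  rewrite -[leRHS]invrK lef_pV2 ?posrE ?invr_gt0 ?mulr_gt0 ?invr_gt0 ?addr_gt0//.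
  rewrite invfM invrK; lra.
- move=> b b0; have [B HB] := hderivable_bounded b hd.
  have B0 : 0 <= B by apply: le_trans (HB 0 _); rewrite ?normr_ge0// lexx.
  exists (1 + B)^-1, 1; split => [||r rb]; rewrite ?invr_gt0 ?ltr_pwDl//.
  have h0 := dge0 r (andP rb).1; have h1 := HB r rb; rewrite ger0_norm// in h1.
  rewrite lef_pV2 ?posrE ?ltr_pwDl// lerD2l h1/= invf_le1 ?ltr_pwDl//; lra.
Qed.

End RapidlyIncreasing.

Theorem theorem19 (R : realType) (p : R) (phi : R -> R) :
  0 < p ->
  ((forall r, 0 <= r -> 0 <= phi r) ->
   C2_halfline phi ->
   (exists2 r0 : R, 0 < r0 & forall r, r0 < r -> hderive phi r != 0) ->
   r * expR (- (p * phi r)) / hderive phi r @[r --> +oo] --> (0 : R) ->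
   (limf_esup (fun r : R => (r^-1 * derive1 (fun s => s / hderive phi s) r)%:E) +oo%R
      < p%:E)%E ->
   (-oo <
    limf_einf (fun r : R => (r^-1 * derive1 (fun s => s / hderive phi s) r)%:E) +oo%R)%E ->
   asymp_on (@entire R)
     (fock_normp p phi)
     (fun f => ((cmod (f 0) `^ p)%:E +
        area_integral (fun z =>
          (cmod (derive1 f z) `^ p * distortion p phi (cmod z) `^ p
             * expR (- (p * phi (cmod z))))%:E))%E)
   /\ (exists2 r1 : R, 0 < r1 &
       asymp_on [set z : C R | r1 <= cmod z]
         (fun z => (distortion p phi (cmod z))%:E)
         (fun z => ((hderive phi (cmod z))^-1)%:E)))
  /\ (rapidly_increasing phi ->
      asymp_on (@entire R)
        (fock_normp p phi)
        (fun f => ((cmod (f 0) `^ p)%:E +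
           area_integral (fun z =>
             (cmod (derive1 f z) `^ p * expR (- (p * phi (cmod z)))
                / (1 + hderive phi (cmod z)) `^ p)%:E))%E)).
Proof.
move=> p0; split; first exact: distortion_equivalence.
exact: rapid_equivalence.
Qed.
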